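(* Let $G$ be a nontrivial $3$-critical graph of order $n$. Then at least one of the following holds. (a) $G$ is obtained from a nontrivial $3$-critical graph of order $n-2$ through a vertex-blowup. (b) $G$ is obtained from two smaller $3$-critical graphs (i.e. each of order less than $n$), at least one of which is nontrivial, through a Hajós-join. (c) $G$ is obtained from a nontrivial $3$-critical graph by a Meredith-type extension (with $\Delta=3$) through a class 1 graph. (d) $n$ is odd and $G$ is obtained from a snark of order $n+1$ by deleting exactly one vertex and some (possibly no) edges. (e) $n$ is even and $G$ is obtained from a snark of order $n$ by deleting some edges.
   Context: All graphs are finite and simple. The chromatic index $\chi'(G)$ is the least $k$ such that $G$ has a proper edge coloring with $k$ colors. A graph $G$ is class 1 if $\chi'(G)=\Delta(G)$ and class 2 if $\chi'(G)=\Delta(G)+1$. A graph $G$ is $3$-critical if it is connected, $\Delta(G)=3$, $\chi'(G)=4$, and $\chi'(G-e)=3$ for every edge $e\in E(G)$. A $3$-critical graph $G$ is trivial if it contains a $3$-overfull subgraph, i.e. a subgraph $H\subseteq G$ with $\Delta(H)=3$ and $|E(H)|>3\lfloor |V(H)|/2\rfloor$; otherwise it is nontrivial. A graph is subcubic if its maximum degree is at most $3$. Vertex-blowup: let $H$ be a subcubic graph and $x\in V(H)$. A graph obtained from $H-x$ and a disjoint triangle by joining each neighbor of $x$ to a distinct vertex of the triangle is called a vertex-blowup of $H$ at $x$. Hajós-join: let $G_1,G_2$ be (disjoint) graphs with $u_1v_1\in E(G_1)$ and $u_2v_2\in E(G_2)$. The graph obtained from $G_1-u_1v_1$ and $G_2-u_2v_2$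 by identifying $u_1$ and $u_2$ and then adding the edge $v_1v_2$ is called a Hajós-join of $G_1$ and $G_2$. Meredith-type extension: let $G_0$ and $H$ be disjoint graphs, each of maximum degree $\Delta$, such that $H$ has exactly $\Delta$ vertices of degree $\Delta-1$ (the connector vertices) and every other vertex of $H$ has degree $\Delta$. Let $y\in V(G_0)$ have degree $\Delta$, with neighborhood $\{y_1,\dots,y_\Delta\}$. A Meredith-type extension of $G_0$ through $H$ at $y$ is a graph obtained from the disjoint union of $H$ and $G_0-y$ by adding a perfect matching of $\Delta$ edges between the connector vertices of $H$ and $y_1,\dots,y_\Delta$. For an integer $k\ge 0$, a graph $G$ is cyclically $k$-edge-connected if for every edge set $F\subseteq E(G)$ with $|F|<k$, at most one component of $G-F$ contains a cycle. A snark is a cubic class 2 graph that has no triangle and is cyclically $4$-edge-connected. *)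

(* Defs.v *)
From mathcomp Require Import all_boot.

Set Implicit Arguments.
Unset Strict Implicit.
Unset Printing Implicit Defensive.

Record sgraph := SGraph {
  vertex :> finType;
  adj : rel vertex;
  adj_sym : symmetric adj;
  adj_irr : irreflexive adj }.

Arguments adj {s} : rename.

Definition iso (G H : sgraph) : Prop :=
  exists2 f : G -> H, bijective f & forall x y, adj (f x) (f y) = adj x y.

(* Subgraphs are taken up to isomorphism. *)
Definition subgraph (H G : sgraph) : Prop :=
  exists2 f : H -> G, injective f & forall x y, adj x y -> adj (f x) (f y).

Definition nbhd (G : sgraph) (x : G) : {set G} := [set y | adj x y].

Definition deg (G : sgraph) (x : G) : nat := #|nbhd x|.

Definition max_deg (G : sgraph) : nat := \max_(x : G) deg x.

Definition edges (G : sgraph) : {set {set G}} :=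
  [set e | [exists x : G, exists y : G, adj x y && (e == [set x; y])]].

Definition connected (G : sgraph) : Prop :=
  0 < #|G| /\ forall x y : G, connect adj x y.

Section Deletion.
Variable G : sgraph.

Definition del_edges_adj (F : {set {set G}}) : rel G :=
  fun x y => adj x y && ([set x; y] \notin F).

Lemma del_edges_sym F : symmetric (del_edges_adj F).
Proof. by move=> x y; rewrite /del_edges_adj adj_sym setUC. Qed.

Lemma del_edges_irr F : irreflexive (del_edges_adj F).
Proof. by move=> x; rewrite /del_edges_adj adj_irr. Qed.

Definition del_edges (F : {set {set G}}) : sgraph :=
  SGraph (del_edges_sym F) (del_edges_irr F).

Definition del_vertex_adj (x : G) : rel {y : G | y != x} :=
  fun a b => adj (val a) (val b).

Lemma del_vertex_sym x : symmetric (@del_vertex_adj x).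
Proof. by move=> a b; rewrite /del_vertex_adj adj_sym. Qed.

Lemma del_vertex_irr x : irreflexive (@del_vertex_adj x).
Proof. by move=> a; rewrite /del_vertex_adj adj_irr. Qed.

Definition del_vertex (x : G) : sgraph :=
  SGraph (@del_vertex_sym x) (@del_vertex_irr x).

End Deletion.

(* The disjoint union of A and B, plus an edge between a in A and b in B
   whenever r a b. *)
Section Glue.
Variables (A B : sgraph) (r : A -> B -> bool).

Definition glue_adj : rel (A + B)%type := fun u v =>
  match u, v with
  | inl a, inl a' => adj a a'
  | inr b, inr b' => adj b b'
  | inl a, inr b | inr b, inl a => r a b
  end.

Lemma glue_sym : symmetric glue_adj.
Proof. by move=> [a|b] [a'|b'] //=; rewrite adj_sym. Qed.

Lemma glue_irr : irreflexive glue_adj.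
Proof. by move=> [a|b] /=; rewrite adj_irr. Qed.

Definition glue : sgraph := SGraph glue_sym glue_irr.

End Glue.

Lemma triangle_sym : symmetric (fun i j : 'I_3 => i != j).
Proof. by move=> i j; rewrite eq_sym. Qed.

Lemma triangle_irr : irreflexive (fun i j : 'I_3 => i != j).
Proof. by move=> i; rewrite eqxx. Qed.

Definition triangle : sgraph := SGraph triangle_sym triangle_irr.

Section EdgeColouring.
Variable G : sgraph.

Definition edge : finType := {e : {set G} | e \in edges G}.

Definition proper_edge_colouring k (c : {ffun edge -> 'I_k}) : bool :=
  [forall e : edge, forall f : edge,
    (e != f) && ~~ [disjoint val e & val f] ==> (c e != c f)].

Definition edge_colourable (k : nat) : bool :=
  [exists c : {ffun edge -> 'I_k}, proper_edge_colouring c].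

Lemma ex_edge_colourable : exists k, edge_colourable k.
Proof.
exists #|edge|; apply/existsP; exists [ffun e => enum_rank e].
apply/forallP=> e; apply/forallP=> f; apply/implyP=> /andP[ef _].
by rewrite !ffunE (inj_eq enum_rank_inj).
Qed.

Definition chromatic_index : nat := ex_minn ex_edge_colourable.

End EdgeColouring.

Definition class1 (G : sgraph) : Prop := chromatic_index G = max_deg G.

Definition class2 (G : sgraph) : Prop := chromatic_index G = (max_deg G).+1.

Definition critical3 (G : sgraph) : Prop :=
  [/\ connected G, max_deg G = 3, chromatic_index G = 4
    & forall e, e \in edges G -> chromatic_index (del_edges [set e]) = 3].

Definition overfull3 (H : sgraph) : Prop :=
  max_deg H = 3 /\ 3 * (#|H| %/ 2) < #|edges H|.

Definition trivial3 (G : sgraph) : Prop :=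
  exists2 H : sgraph, subgraph H G & overfull3 H.

Definition nontrivial_critical3 (G : sgraph) : Prop :=
  critical3 G /\ ~ trivial3 G.

Definition subcubic (G : sgraph) : Prop := max_deg G <= 3.

(* f assigns to every neighbour of x its vertex of the triangle; its values
   elsewhere are irrelevant. *)
Definition blowup (H : sgraph) (x : H) (f : H -> triangle) : sgraph :=
  @glue (del_vertex x) triangle
    (fun a i => (val a \in nbhd x) && (f (val a) == i)).

Definition is_vertex_blowup (G H : sgraph) : Prop :=
  subcubic H /\
  exists (x : H) (f : H -> triangle),
    {in nbhd x &, injective f} /\ iso G (blowup x f).

(* The vertex obtained by identifying u1 and u2 is represented by u1, so the
   G2-part is G2 - u2 and u1 inherits the neighbours of u2 other than v2. *)
Definition hajos (G1 G2 : sgraph) (u1 v1 : G1) (u2 v2 : G2) : sgraph :=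
  @glue (del_edges [set [set u1; v1]]) (del_vertex u2)
    (fun a b => [|| [&& a == u1, adj u2 (val b) & val b != v2]
                  | (a == v1) && (val b == v2)]).

Definition is_hajos_join (G G1 G2 : sgraph) : Prop :=
  exists (u1 v1 : G1) (u2 v2 : G2),
    [/\ adj u1 v1, adj u2 v2 & iso G (hajos u1 v1 u2 v2)].

Definition connectors (D : nat) (H : sgraph) : {set H} :=
  [set h | deg h == D.-1].

(* m matches the connector vertices with the neighbours of y; its values
   elsewhere are irrelevant. *)
Definition meredith (D : nat) (G0 H : sgraph) (y : G0) (m : H -> G0) : sgraph :=
  @glue H (del_vertex y)
    (fun h z => (h \in connectors D H) && (m h == val z)).

Definition is_meredith_extension (D : nat) (G G0 H : sgraph) : Prop :=
  [/\ max_deg G0 = D,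
      max_deg H = D,
      #|connectors D H| = D,
      (forall h : H, h \notin connectors D H -> deg h = D)
    & exists (y : G0) (m : H -> G0),
        [/\ deg y = D,
            {in connectors D H &, injective m},
            m @: connectors D H = nbhd y
          & iso G (meredith D y m)]].

Definition cubic (G : sgraph) : Prop := forall x : G, deg x = 3.

Definition triangle_free (G : sgraph) : Prop :=
  forall x y z : G, ~~ [&& adj x y, adj y z & adj x z].

Definition components (G : sgraph) : {set {set G}} :=
  equivalence_partition (connect adj) [set: G].

Definition contains_cycle (G : sgraph) (C : {set G}) : Prop :=
  exists c : seq G, [/\ ucycle adj c, 2 < size c & {subset c <= C}].

Definition cyclically_edge_connected (k : nat) (G : sgraph) : Prop :=
  forall F : {set {set G}}, F \subset edges G -> #|F| < k ->
  forall C1 C2 : {set del_edges F},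
    C1 \in components (del_edges F) -> C2 \in components (del_edges F) ->
    contains_cycle C1 -> contains_cycle C2 -> C1 = C2.

Definition snark (G : sgraph) : Prop :=
  [/\ cubic G, class2 G, triangle_free G & cyclically_edge_connected 4 G].

(* Main.v *)
(* Let T be the set of vertices of degree 2 of the 3-critical graph G. Vizing's
   adjacency lemma makes T independent without common neighbours, G is bridgeless,
   and nontriviality means |T| >= 2.

   Along a 2-edge-cut with at least two vertices on each side, one side Y only has
   colourings with distinct colours on the cut and the other side X only ones with
   equal colours. Contracting Y, and joining the ends of the cut in Y, gives the two
   critical graphs of a Hajos-join, unless these ends are adjacent; then Y can be
   shrunk, until it is a triangle with a vertex in T and G is a vertex-blowup.

   Otherwise consider a 3-edge-cut with a side Y of at least two vertices, none in T.
   By parity every colouring of Y has three colours on the cut, so contracting Y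
   gives a critical graph, and G is a vertex-blowup (|Y| = 3) or a Meredith-type
   extension of it.

   Otherwise every 3-edge-cut has vertices of T on both sides. As in Lovasz' splitting
   theorem, two vertices of T can then be joined so that this remains true for the
   other vertices of T, whenever |T| >= 2 and |T| <> 3. In the end T is empty,
   or has three vertices, which get a new common neighbour. The result is a
   cubic graph in which every edge cut between two sets of at least two vertices has
   at least four edges, that is, a snark. *)
Require Import Defs.
From mathcomp Require Import all_boot.
From mathcomp Require Import perm zify.

Set Implicit Arguments.
Unset Strict Implicit.
Unset Printing Implicit Defensive.

(** * Edge colourings as functions of two vertices *)

(** Adding edges to [G] destroys criticality, so the splitting argument forgets it: [split_inv]
    keeps only degrees, edge cuts and the adjacency conditions on [T]. Not being 3-colourable passes
    to supergraphs, and a 4-colouring is recovered at the end from a 3-colouring of [G] minus one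
    suitable edge: the edges still missing form a matching, once two of the three edges at a new
    vertex have been coloured in the odd case. Contraction works because three colours leave no
    choice: as soon as a permutation aligns two edges of a cut, the colour of a third one is forced.
    So colourings of the two sides that are both injective on a cut of two or three edges can be
    glued, and the question is only on which side injectivity is automatic. Three vertices of [T]
    are a stop for the pairwise joining, since a 3-edge-cut may separate two of them from the third;
    a common new neighbour raises all 3-edge-cuts at once. *)

Lemma set2_inj (V : finType) (x y u v : V) :
  [set x; y] = [set u; v] -> (x = u /\ y = v) \/ (x = v /\ y = u).
Proof.
move=> E.
have := set21 x y; have := set22 x y; rewrite E !inE => /orP hy /orP hx.
have := set21 u v; have := set22 u v; rewrite -E !inE => /orP hv /orP hu.
by case: hx => /eqP hx; case: hy => /eqP hy; case: hu => /eqP hu;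
   case: hv => /eqP hv; subst; auto.
Qed.

Section Colouring.
Variable V : finType.
Implicit Types (a : rel V) (X : {set V}).

(** Colourings are total functions with irrelevant values off the edges. Properness is required only
    at the vertices of [X], so one can speak of a colouring of all edges meeting [X], cut edges
    included, without forming a subgraph. *)
Definition proper_at k a X (c : V -> V -> 'I_k) :=
  forall x y z, x \in X -> a x y -> a x z -> c x y = c x z -> y = z.

Definition sym_col k (c : V -> V -> 'I_k) := forall x y, c x y = c y x.

Definition kcol k a := exists2 c : V -> V -> 'I_k,
  sym_col c & proper_at a setT c.

Definition dele a x y : rel V := fun u v => a u v && ([set u; v] != [set x; y]).

Definition rdeg a x := #|[set y | a x y]|.

Lemma sym_col_set k (c : V -> V -> 'I_k) x y u v :
  sym_col c -> [set x; y] = [set u; v] -> c x y = c u v.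
Proof. by move=> sc /set2_inj [[-> ->]|[-> ->]]. Qed.

Lemma kcol_sub k a b : subrel a b -> kcol k b -> kcol k a.
Proof.
move=> sab [c sc pc]; exists c => // x y z xX /sab axy /sab axz.
exact: pc xX axy axz.
Qed.

Lemma kcol_widen k l a : k <= l -> kcol k a -> kcol l a.
Proof.
move=> kl [c sc pc]; exists (fun x y => widen_ord kl (c x y)).
  by move=> x y; rewrite sc.
by move=> x y z xX axy axz [] /val_inj; apply: pc.
Qed.

(** By the degree bound the edges of [b] outside [a] form a matching, so a single new colour serves
    all of them. *)
Lemma kcol_succ k a b : symmetric a -> symmetric b -> subrel a b ->
  (forall x, rdeg b x <= (rdeg a x).+1) -> kcol k a -> kcol k.+1 b.
Proof.
move=> sa sb sab dab [c sc pc].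
exists (fun x y => if a x y then widen_ord (leqnSn k) (c x y) else ord_max).
  by move=> x y /=; rewrite sa sc.
move=> x y z _ bxy bxz.
case: ifP => axy; case: ifP => axz.
- by case=> /val_inj; apply: pc.
- by move=> /(congr1 val) /= E; have := ltn_ord (c x y); rewrite E ltnn.
- by move=> /(congr1 val) /= E; have := ltn_ord (c x z); rewrite -E ltnn.
move=> _; apply/eqP; apply: contraT => nyz.
have: [set t | a x t] \subset [set t | b x t] :\: [set y; z].
  apply/subsetP => t; rewrite !inE => axt; rewrite sab // andbT.
  by apply/norP; split; apply: contraTneq axt => ->; rewrite ?axy ?axz.
move/subset_leq_card.
have /setIidPr E: [set y; z] \subset [set t | b x t].
  by apply/subsetP => t; rewrite !inE => /orP[] /eqP ->.
rewrite cardsD E cards2 nyz => le1.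
have := dab x; rewrite /rdeg.
have : #|[set y; z]| <= #|[set t | b x t]| by rewrite -E subset_leq_card ?subsetIl.
rewrite cards2 nyz; lia.
Qed.

Lemma kcol_deg k a x : kcol k a -> rdeg a x <= k.
Proof.
case=> c sc pc.
have inj : {in [set y | a x y] &, injective (c x)}.
  by move=> y z; rewrite !inE => axy axz; apply: pc.
by rewrite /rdeg -(card_in_imset inj) -[leqRHS]card_ord max_card.
Qed.

End Colouring.

Lemma edgesP (G : sgraph) (e : {set G}) :
  reflect (exists x y, adj x y /\ e = [set x; y]) (e \in edges G).
Proof.
rewrite inE; apply: (iffP existsP) => [[x /existsP[y /andP[xy /eqP->]]]|].
  by exists x, y.
by move=> [x [y [xy ->]]]; exists x; apply/existsP; exists y; rewrite xy eqxx.
Qed.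

Definition mk_edge (G : sgraph) (e : {set G}) (He : e \in edges G) : edge G :=
  exist (fun e : {set G} => e \in edges G) e He.

(** The successor provides the default colour [ord0] for pairs that are not edges. *)
Lemma edge_colourableP (G : sgraph) k :
  edge_colourable G k.+1 <-> kcol k.+1 (@adj G).
Proof.
split.
  case/existsP=> c0 /forallP pc.
  pose c (x y : G) := if insub [set x; y] is Some e then c0 e else ord0.
  exists c => [x y|x y z _ axy axz]; first by rewrite /c setUC.
  have E1: [set x; y] \in edges G by apply/edgesP; exists x, y.
  have E2: [set x; z] \in edges G by apply/edgesP; exists x, z.
  rewrite /c !insubT => E; apply/eqP; apply: contraT => nyz.
  have /forallP/(_ (mk_edge E2))/implyP := pc (mk_edge E1).
  rewrite E eqxx => H; apply: H; apply/andP; split.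
    apply: contra_neq nyz => /(congr1 val) /= /set2_inj [[_ //]|[<- -> //]].
  by apply/pred0Pn; exists x => /=; rewrite !inE eqxx.
case=> c sc pc.
pose c0 (e : edge G) : 'I_k.+1 :=
  if [pick p : G * G | adj p.1 p.2 && (val e == [set p.1; p.2])] is Some p
  then c p.1 p.2 else ord0.
have c0E e x y : adj x y -> val e = [set x; y] -> c0 e = c x y.
  move=> axy E; rewrite /c0; case: pickP => [[u v] /= /andP[_ /eqP F]|/(_ (x, y))].
    by apply: sym_col_set; rewrite -?F.
  by rewrite /= axy E eqxx.
apply/existsP; exists [ffun e => c0 e].
apply/forallP => e; apply/forallP => f; apply/implyP=> /andP[nef].
case/pred0Pn => x /= /andP[xe xf]; rewrite !ffunE.
have get (g : edge G) : x \in val g -> exists2 y, adj x y & val g = [set x; y].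
  case: g => g /= /edgesP[u [v [uv ->]]]; rewrite !inE => /orP[]/eqP->.
    by exists v.
  by exists u; rewrite 1?adj_sym 1?setUC.
have [y axy E] := get e xe; have [z axz F] := get f xf.
rewrite (c0E e x y) // (c0E f x z) //; apply: contra nef => /eqP /pc H.
by apply/eqP/val_inj; rewrite E F H.
Qed.

Lemma chromatic_index_le (G : sgraph) k :
  chromatic_index G <= k.+1 <-> kcol k.+1 (@adj G).
Proof.
rewrite /chromatic_index; case: ex_minnP => m cm minm; split => [lem|].
  case: m cm minm lem => [|m] cm minm lem; last first.
    by apply: kcol_widen lem _; apply/edge_colourableP.
  apply/edge_colourableP/existsP; case/existsP: cm => c _.
  exists [ffun e => widen_ord lem (c e)]; apply/forallP=> e.
  by case: (c e).
by move/edge_colourableP; apply: minm.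
Qed.

Lemma max_deg_le_index (G : sgraph) : max_deg G <= chromatic_index G.
Proof.
apply/bigmax_leqP => x _.
case E: (chromatic_index G) => [|k].
  rewrite leqn0 cards_eq0; apply/eqP/setP => y; rewrite !inE.
  apply/negP => axy; move: E; rewrite /chromatic_index.
  case: ex_minnP => m /existsP[c _] _ m0; subst m.
  have H: [set x; y] \in edges G by apply/edgesP; exists x, y.
  by case: (c (mk_edge H)).
by apply: kcol_deg; apply/chromatic_index_le; rewrite E.
Qed.

Lemma del_edge_adj (G : sgraph) (x y : G) :
  @adj (del_edges [set [set x; y]]) =2 dele (@adj G) x y.
Proof. by move=> u v; rewrite /= /del_edges_adj /dele in_set1. Qed.

Lemma critical3_elim (G : sgraph) : critical3 G ->
  [/\ connected G, (forall x : G, deg x <= 3), ~ kcol 3 (@adj G)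
    & forall x y : G, adj x y -> kcol 3 (dele (@adj G) x y)].
Proof.
case=> cG mG iG eG; split=> // [x||x y axy].
- by rewrite -mG; apply: leq_bigmax.
- by move/chromatic_index_le; rewrite iG.
have : [set x; y] \in edges G by apply/edgesP; exists x, y.
move/eG => H; apply: (@kcol_sub _ _ _ (@adj (del_edges [set [set x; y]]))).
  by move=> u v; rewrite del_edge_adj.
by apply/chromatic_index_le; rewrite H.
Qed.

Lemma dele_sym (V : finType) (a : rel V) x y : symmetric a -> symmetric (dele a x y).
Proof. by move=> sa u v; rewrite /dele sa setUC. Qed.

Lemma dele_sub (V : finType) (a : rel V) x y : subrel (dele a x y) a.
Proof. by move=> u v /andP[]. Qed.

Lemma rdeg_dele (V : finType) (a : rel V) x y z :
  rdeg a z <= (rdeg (dele a x y) z).+1.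
Proof.
rewrite /rdeg; pose w := if z == x then y else x.
have: [set t | a z t] \subset w |: [set t | dele a x y z t].
  apply/subsetP=> t; rewrite !inE /dele => -> /=.
  case: eqP => //= ntw; apply/eqP => /set2_inj [[zx ty]|[zy tx]].
    by apply: ntw; rewrite /w zx eqxx.
  apply: ntw; rewrite /w tx; case: eqP => // zx; congruence.
move/subset_leq_card => H; apply: leq_trans H _.
by rewrite cardsU1; case: (_ \notin _).
Qed.

(** A fourth colour on the deleted edge bounds the index of [G] by 4, and a 2-colouring of some
    [G - e] would in the same way give a 3-colouring of [G]. So 3-colourability of each [G - e]
    determines all the indices. *)
Lemma critical3_intro (G : sgraph) : connected G -> (forall x : G, deg x <= 3) ->
  (exists x : G, deg x = 3) -> ~ kcol 3 (@adj G) ->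
  (forall x y : G, adj x y -> kcol 3 (dele (@adj G) x y)) -> critical3 G.
Proof.
move=> cG dG [x0 dx0] nG eG.
have mG : max_deg G = 3.
  apply/eqP; rewrite eqn_leq; apply/andP; split; first exact/bigmax_leqP.
  by rewrite -dx0; apply: leq_bigmax.
have up k x y : adj x y -> kcol k (dele (@adj G) x y) -> kcol k.+1 (@adj G).
  move=> axy; apply: kcol_succ; [exact/dele_sym/adj_sym|exact: adj_sym|exact: dele_sub|].
  by move=> z; apply: rdeg_dele.
split=> //.
  apply/eqP; rewrite eqn_leq; apply/andP; split.
    apply/chromatic_index_le.
    have [y axy] : exists y, adj x0 y.
      have: 0 < deg x0 by rewrite dx0.
      by case/card_gt0P => y; rewrite inE => ?; exists y.
    by apply: (up _ _ _ axy); apply: eG.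
  by rewrite ltnNge; apply/negP => /chromatic_index_le.
move=> e /edgesP[x [y [axy ->]]].
apply/eqP; rewrite eqn_leq; apply/andP; split.
  apply/chromatic_index_le; apply: (kcol_sub _ (eG _ _ axy)) => u v.
  by rewrite del_edge_adj.
rewrite ltnNge; apply/negP => /chromatic_index_le H; apply: nG.
apply: (up _ _ _ axy); apply: (kcol_sub _ H) => u v.
by rewrite del_edge_adj.
Qed.

(** * Edge cuts *)

Section Cuts.
Variables (V : finType) (a : rel V).
Implicit Types (X Y Z : {set V}) (x y : V).

(** Ordered pairs are counted: for a simple graph [cut a X X] is twice the number of edges inside
    [X]. *)
Definition cut X Y := \sum_(x in X) \sum_(y in Y) (a x y : nat).

Definition bdry X := cut X (~: X).

Lemma cutIDl X Y Z : cut X Y = cut (X :&: Z) Y + cut (X :\: Z) Y.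
Proof. by rewrite /cut (big_setID Z). Qed.

Lemma cut1 x Y : cut [set x] Y = #|[set y in Y | a x y]|.
Proof.
rewrite /cut big_set1 -sum1_card big_mkcond [RHS]big_mkcond /=.
by apply: eq_bigr => y _; rewrite !inE; case: (y \in Y); case: (a x y).
Qed.

Lemma cut_gt0P X Y :
  reflect (exists x y, [/\ x \in X, y \in Y & a x y]) (0 < cut X Y).
Proof.
apply: (iffP idP) => [|[x [y [xX yY axy]]]]; last first.
  by rewrite /cut (bigD1 x) //= (bigD1 y) //= axy.
rewrite lt0n sum_nat_eq0 negb_forall => /existsP[x]; rewrite negb_imply.
case/andP=> xX; rewrite sum_nat_eq0 negb_forall => /existsP[y].
rewrite negb_imply => /andP[yY]; case axy: (a x y) => // _.
by exists x, y.
Qed.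

Lemma cut0r X : cut X set0 = 0.
Proof. by rewrite /cut big1 // => x _; rewrite big_set0. Qed.

Lemma rdeg_cut x : rdeg a x = cut [set x] setT.
Proof. by rewrite cut1; apply: eq_card => y; rewrite !inE. Qed.

Hypothesis sa : symmetric a.

Lemma cutC X Y : cut X Y = cut Y X.
Proof.
rewrite /cut exchange_big /=; apply: eq_bigr => y _.
by apply: eq_bigr => x _; rewrite sa.
Qed.

Lemma cutIDr X Y Z : cut X Y = cut X (Y :&: Z) + cut X (Y :\: Z).
Proof. by rewrite cutC (cutIDl _ _ Z) !(cutC _ X). Qed.

Lemma bdryC X : bdry (~: X) = bdry X.
Proof. by rewrite /bdry setCK cutC. Qed.

Lemma rdeg_split x X : rdeg a x = cut [set x] X + cut [set x] (~: X).
Proof. by rewrite rdeg_cut (cutIDr _ _ X) setTI setTD. Qed.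

Lemma rdeg_sum X : \sum_(x in X) rdeg a x = cut X X + bdry X.
Proof.
rewrite /bdry /cut -big_split /=; apply: eq_bigr => x _.
by rewrite (rdeg_split x X) /cut !big_set1.
Qed.

(** All six boundaries are expressed by the six cuts between corners, which turns submodularity and
    parity into linear arithmetic. *)
Lemma cut_corners X Z (A := X :&: Z) (B := X :\: Z) (C := Z :\: X)
    (D := ~: (X :|: Z)) :
  [/\ bdry X = cut A C + cut A D + cut B C + cut B D,
      bdry Z = cut A B + cut A D + cut B C + cut C D,
      bdry A = cut A B + cut A C + cut A D,
      bdry B = cut A B + cut B C + cut B D &
      bdry C = cut A C + cut B C + cut C D /\
      bdry D = cut A D + cut B D + cut C D].
Proof.
have setE (P Q : {set V}) : (forall x, (x \in P) = (x \in Q)) -> P = Q.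
  by move=> H; apply/setP.
have e1 : ~: X :&: Z = C by apply: setE => x; rewrite !inE andbC.
have e2 : ~: X :\: Z = D by apply: setE => x; rewrite !inE negb_or andbC.
have e3 : ~: Z :&: X = B by apply: setE => x; rewrite !inE.
have e4 : ~: Z :\: X = D by apply: setE => x; rewrite !inE negb_or andbC.
have e5 : Z :&: X = A by rewrite setIC.
have bX : bdry X = cut A C + cut A D + cut B C + cut B D.
  rewrite /bdry (cutIDl X _ Z) -/A -/B (cutIDr A (~: X) Z) (cutIDr B (~: X) Z).
  rewrite e1 e2; lia.
have bZ : bdry Z = cut A B + cut A D + cut B C + cut C D.
  rewrite /bdry (cutIDl Z _ X) e5 -/C (cutIDr A (~: Z) X) (cutIDr C (~: Z) X).
  by rewrite e3 e4 (cutC C B); lia.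
have bA : bdry A = cut A B + cut A C + cut A D.
  rewrite /bdry (cutIDr A (~: A) X).
  have -> : ~: A :&: X = B by apply: setE => x; rewrite !inE; case: (x \in X); rewrite ?andbF ?andbT.
  have -> : ~: A :\: X = ~: X by apply: setE => x; rewrite !inE; case: (x \in X).
  by rewrite (cutIDr _ (~: X) Z) e1 e2 addnA.
have bB : bdry B = cut A B + cut B C + cut B D.
  rewrite /bdry (cutIDr B (~: B) X) (cutC A B).
  have -> : ~: B :&: X = A.
    by apply: setE => x; rewrite !inE; case: (x \in X); case: (x \in Z).
  have -> : ~: B :\: X = ~: X.
    by apply: setE => x; rewrite !inE; case: (x \in X); case: (x \in Z).
  by rewrite (cutIDr _ (~: X) Z) e1 e2 addnA.
have bC : bdry C = cut A C + cut B C + cut C D.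
  rewrite /bdry (cutIDr C (~: C) X) (cutC A C) (cutC B C).
  have -> : ~: C :&: X = X.
    by apply: setE => x; rewrite !inE; case: (x \in X); case: (x \in Z).
  have -> : ~: C :\: X = D.
    by apply: setE => x; rewrite !inE; case: (x \in X); case: (x \in Z).
  by rewrite (cutIDr _ X Z) -/A -/B.
have bD : bdry D = cut A D + cut B D + cut C D.
  rewrite /bdry (cutIDr D (~: D) X) (cutC A D) (cutC B D) (cutC C D).
  have -> : ~: D :&: X = X.
    by apply: setE => x; rewrite !inE; case: (x \in X); case: (x \in Z).
  have -> : ~: D :\: X = C.
    by apply: setE => x; rewrite !inE; case: (x \in X); case: (x \in Z).
  by rewrite (cutIDr _ X Z) -/A -/B.
by [].
Qed.

Hypothesis ia : irreflexive a.

Lemma rdeg_splitD1 x X : x \in X ->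
  rdeg a x = cut [set x] (X :\ x) + cut [set x] (~: X).
Proof.
move=> xX; rewrite (rdeg_split x X); congr (_ + _).
by rewrite !cut1; apply: eq_card => y; rewrite !inE; case: eqP => //= ->; rewrite ia andbF.
Qed.

Lemma bdryD1 x X : x \in X ->
  bdry (X :\ x) + cut [set x] (~: X) = bdry X + cut [set x] (X :\ x).
Proof.
move=> xX; rewrite /bdry (cutIDl X _ [set x]).
have -> : X :&: [set x] = [set x] by apply/setIidPr; rewrite sub1set.
rewrite (cutIDr _ (~: (X :\ x)) [set x]).
have -> : ~: (X :\ x) :&: [set x] = [set x].
  by apply/setIidPr; rewrite sub1set !inE eqxx.
have -> : ~: (X :\ x) :\: [set x] = ~: X.
  by apply/setP => y; rewrite !inE; case: eqP => //= ->; rewrite xX.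
by rewrite [cut [set x] (X :\ x)]cutC; lia.
Qed.

Lemma bdryU1 x X : x \notin X ->
  bdry (x |: X) + cut [set x] X = bdry X + cut [set x] (~: (x |: X)).
Proof.
move=> xX; have := @bdryD1 x (x |: X); rewrite setU11 setU1K // => /(_ isT).
by move=> ->.
Qed.

End Cuts.

(* [a] is the critical graph together with the edges added so far, and [T] is
   the set of vertices that still have degree 2. *)
Record split_inv (V : finType) (a : rel V) (T : {set V}) : Prop := SplitInv {
  inv_sym : symmetric a;
  inv_irr : irreflexive a;
  inv_deg : forall x, rdeg a x + (x \in T) = 3;
  inv_cut2 : forall X : {set V}, 1 < #|X| -> 1 < #|~: X| -> 2 < bdry a X;
  inv_cut3 : forall X : {set V}, 1 < #|X| -> 1 < #|~: X| -> bdry a X = 3 ->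
    exists2 t, t \in X & t \in T;
  inv_nbr : forall w t u, t \in T -> u \in T -> a w t -> a w u -> t = u;
  inv_indep : forall t u, t \in T -> u \in T -> ~~ a t u }.

Lemma card_setU_le (U : finType) (A B : {set U}) : #|A :|: B| <= #|A| + #|B|.
Proof. by rewrite cardsU leq_subr. Qed.

Lemma card_set2_le (U : finType) (x y : U) : #|[set x; y]| <= 2.
Proof. by rewrite cards2; case: (_ != _). Qed.

(** * Joining vertices of degree 2 *)

(** On one diagonal both boundaries are even, and one of them is 2. On the other they are odd and
    greater than 1, and add up to at most 6, so both are 3. Adjacent corners add up to 3 plus twice
    their common cut, and 2 + 3 makes this cut 1. *)
Lemma corner_arith ab ac ad bc bd cd :
  ac + ad + bc + bd = 3 -> ab + ad + bc + cd = 3 -> 1 < ab + ac + ad ->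
  1 < ab + bc + bd -> 1 < ac + bc + cd -> 1 < ad + bd + cd ->
  [\/ [/\ ab + ac + ad = 2, ab = 1, ac = 1, ab + bc + bd = 3 & ac + bc + cd = 3],
      [/\ ab + bc + bd = 2, ab = 1, bd = 1, ab + ac + ad = 3 & ad + bd + cd = 3],
      [/\ ac + bc + cd = 2, ac = 1, cd = 1, ab + ac + ad = 3 & ad + bd + cd = 3]
    | [/\ ad + bd + cd = 2, bd = 1, cd = 1, ab + bc + bd = 3 & ac + bc + cd = 3]].
Proof.
move=> *; have [] : ab + ac + ad = 2 \/ ab + bc + bd = 2 \/ ac + bc + cd = 2
  \/ ad + bd + cd = 2 by lia.
  by move=> *; apply: Or41; split; lia.
case=> [*|]; first by apply: Or42; split; lia.
case=> *; first by apply: Or43; split; lia.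
by apply: Or44; split; lia.
Qed.

Section Splitting.
Variables (V : finType) (a : rel V) (T : {set V}).
Hypothesis I : split_inv a T.
Implicit Types (X Y Z K P Q : {set V}) (t u x y : V).

Let sa := inv_sym I.
Let ia := inv_irr I.
Notation h := (bdry a).

Definition tri_cut X := [&& 1 < #|X|, 1 < #|~: X| & h X == 3].

Lemma tri_cutC X : tri_cut (~: X) = tri_cut X.
Proof. by rewrite /tri_cut setCK bdryC // andbCA. Qed.

Lemma bdry_set1 x : h [set x] = rdeg a x.
Proof.
by rewrite (rdeg_splitD1 sa ia (set11 x)) setDv cut0r.
Qed.

Lemma deg_in t : t \in T -> rdeg a t = 2.
Proof. by move=> tT; have := inv_deg I t; rewrite tT; lia. Qed.

Lemma deg_out x : x \notin T -> rdeg a x = 3.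
Proof. by move=> /negPf xT; have := inv_deg I x; rewrite xT; lia. Qed.

Lemma bdry_ge2 X : X != set0 -> ~: X != set0 -> 1 < h X.
Proof.
have one Y : #|Y| = 1 -> 1 < h Y.
  move/eqP/cards1P => [x ->]; rewrite bdry_set1.
  by have := inv_deg I x; case: (x \in T); lia.
rewrite -!card_gt0 => X0 Y0.
case: (ltngtP 1 #|X|) => [X1||/esym/one//]; last lia.
case: (ltngtP 1 #|~: X|) => [Y1||/esym/one]; [|lia|by rewrite bdryC].
by apply: ltnW; apply: (inv_cut2 I).
Qed.

Lemma bdry_le2 X : X != set0 -> 1 < #|~: X| -> h X <= 2 ->
  exists2 t, t \in T & X = [set t].
Proof.
rewrite -card_gt0 => X0 Y1 h2.
case: (ltngtP 1 #|X|) => [X1||/esym/eqP/cards1P[x E]]; last first.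
- exists x => //; apply: contraLR h2 => xT.
  by rewrite E bdry_set1 deg_out.
- lia.
by have := inv_cut2 I X1 Y1; lia.
Qed.

Definition tip A P Q := exists t,
  [/\ t \in T, A = [set t], cut a [set t] P = 1, cut a [set t] Q = 1
    & h P = 3 /\ h Q = 3].

Lemma bdry_even_tip P Q A B : P != set0 -> 1 < #|~: P| -> h P = 2 ->
  cut a P A = 1 -> cut a P B = 1 -> h A = 3 -> h B = 3 -> tip P A B.
Proof.
move=> P0 P1 hP; case: (bdry_le2 P0 P1 _) => [|t tT ->]; first by rewrite hP.
by move=> c1 c2 h1 h2; exists t.
Qed.

(* The four corners of two crossing 3-edge-cuts: [h A + h B] is odd, so the
   corners of one diagonal have even boundary, and these add up to at most 6. *)
Lemma uncross X Z (A := X :&: Z) (B := X :\: Z) (C := Z :\: X)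
    (D := ~: (X :|: Z)) :
  h X = 3 -> h Z = 3 -> A != set0 -> B != set0 -> C != set0 -> D != set0 ->
  [\/ tip A B C, tip B A D, tip C A D | tip D B C].
Proof.
move=> hX hZ A0 B0 C0 D0.
have := cut_corners sa X Z; rewrite -/A -/B -/C -/D hX hZ.
case=> eX eZ eA eB [eC eD].
have dAB : [disjoint A & B].
  by apply/pred0P => x; rewrite /= !inE; case: (x \in X); case: (x \in Z).
have dAC : [disjoint A & C].
  by apply/pred0P => x; rewrite /= !inE; case: (x \in X); case: (x \in Z).
have dBC : [disjoint B & C].
  by apply/pred0P => x; rewrite /= !inE; case: (x \in X); case: (x \in Z).
have dBD : [disjoint B & D].
  by apply/pred0P => x; rewrite /= !inE; case: (x \in X); case: (x \in Z).
have dCD : [disjoint C & D].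
  by apply/pred0P => x; rewrite /= !inE; case: (x \in X); case: (x \in Z).
have dAD : [disjoint A & D].
  by apply/pred0P => x; rewrite /= !inE; case: (x \in X); case: (x \in Z).
have co P Q R : Q != set0 -> R != set0 -> [disjoint P & Q] -> [disjoint P & R] ->
    [disjoint Q & R] -> 1 < #|~: P|.
  rewrite -!card_gt0 => Q0 R0 dPQ dPR dQR.
  apply: (@leq_trans #|Q :|: R|).
    by rewrite cardsU (disjoint_setI0 dQR) cards0 subn0 -[2]addn1 leq_add.
  apply: subset_leq_card; rewrite subUset -!disjoints_subset.
  by rewrite disjoint_sym dPQ disjoint_sym dPR.
have ne P : P != set0 -> 1 < #|~: P| -> 1 < h P.
  by move=> P0 P1; apply: bdry_ge2; rewrite // -card_gt0 (ltnW P1).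
have cA : 1 < #|~: A| by apply: (co _ B C).
have cB : 1 < #|~: B| by apply: (co _ A C) => //; rewrite disjoint_sym.
have cC : 1 < #|~: C| by apply: (co _ A B) => //; rewrite disjoint_sym.
have cD : 1 < #|~: D| by apply: (co _ A B) => //; rewrite disjoint_sym.
have := ne _ A0 cA; have := ne _ B0 cB; have := ne _ C0 cC; have := ne _ D0 cD.
move=> gD gC gB gA.
have cs := cutC sa.
rewrite eA in gA; rewrite eB in gB; rewrite eC in gC; rewrite eD in gD.
case: (corner_arith (esym eX) (esym eZ) gA gB gC gD) => -[e1 e2 e3 e4 e5].
- by apply: Or41; apply: bdry_even_tip; rewrite // ?eA ?eB ?eC.
- by apply: Or42; apply: bdry_even_tip; rewrite // ?(cs B A) ?eA ?eB ?eD.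
- by apply: Or43; apply: bdry_even_tip; rewrite // ?(cs C A) ?eA ?eC ?eD.
by apply: Or44; apply: bdry_even_tip; rewrite // ?(cs D B) ?(cs D C) ?eB ?eC ?eD.
Qed.

Definition inner X t := forall y, a t y -> y \in X.

Lemma innerP X t : reflect (inner X t) (cut a [set t] (~: X) == 0).
Proof.
rewrite -leqn0 leqNgt; apply: (iffP idP) => [/cut_gt0P H y aty|H].
  apply/negPn/negP => yX; apply: H; exists t, y; split=> //; first exact: set11.
  by rewrite inE.
apply/cut_gt0P => -[x [y [/set1P -> + /H]]]; by rewrite inE => /negPf ->.
Qed.

(* Otherwise the vertices of [X] outside [T] would again be bounded by at most
   three edges. *)
Lemma inner_exists X : tri_cut X -> 1 < #|X :&: T| ->
  exists t, [/\ t \in X, t \in T & inner X t].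
Proof.
case/and3P=> X1 Y1 /eqP hX XT1.
have [/existsP[t /andP[/andP[tX tT] /innerP it]]|/existsPn H] :=
  boolP [exists t, (t \in X) && (t \in T) && (cut a [set t] (~: X) == 0)].
  by exists t.
pose L := X :&: T; pose R := X :\: T.
have cutTT : cut a L L = 0.
  apply/eqP; rewrite -leqn0 leqNgt; apply/cut_gt0P => -[x [y []]].
  by rewrite !inE => /andP[_ xT] /andP[_ yT]; apply/negP/(inv_indep I).
(* Every vertex of [L] has degree 2 and, by assumption, an edge leaving [X]. Hence [h R] is 3 + 2
   [#|L|] - 2 [cut a L (~: X)], which is at most 3. *)
have cLX : #|L| <= cut a L (~: X).
  rewrite /cut -sum1_card; apply: leq_sum => t; rewrite inE => /andP[tX tT].
  by have := H t; rewrite tX tT /= /cut big_set1 lt0n.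
have sumL : \sum_(t in L) rdeg a t = 2 * #|L|.
  rewrite (eq_bigr (fun _ => 2)); first by rewrite sum_nat_const mulnC.
  by move=> t; rewrite inE => /andP[_]; apply: deg_in.
have eL : 2 * #|L| = cut a L R + cut a L (~: X).
  rewrite -sumL rdeg_sum // cutTT add0n /bdry (cutIDr sa _ (~: L) X).
  congr (cut a L _ + cut a L _); apply/setP => x; rewrite !inE.
    by case: (x \in X); rewrite ?andbF.
  by case: (x \in X).
have eX : h X = cut a L (~: X) + cut a R (~: X) by rewrite /bdry (cutIDl _ _ _ T).
have eR : h R = cut a R L + cut a R (~: X).
  rewrite /bdry (cutIDr sa _ (~: R) X); congr (cut a R _ + cut a R _).
    by apply/setP => x; rewrite !inE; case: (x \in X); rewrite ?andbF ?andbT ?negbK.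
  by apply/setP => x; rewrite !inE; case: (x \in X); rewrite ?andbF.
have RT t : t \in R -> t \notin T by rewrite inE => /andP[].
rewrite (cutC sa R L) in eR.
have cR : 1 < #|~: R|.
  by apply: leq_trans Y1 _; apply: subset_leq_card; rewrite setCS subsetDl.
have [R1|] := ltnP 1 #|R|.
  have := inv_cut2 I R1 cR => hR.
  have [|t tR tT] := inv_cut3 I R1 cR; first by lia.
  by have := RT t tR; rewrite tT.
rewrite leq_eqVlt ltnS leqn0 cards_eq0 => /orP[/cards1P[w Rw]|/eqP R0]; last first.
  have := eX; rewrite R0 hX; have := eL; rewrite R0 cut0r.
  rewrite /cut big_set0; lia.
have : cut a R L <= 1.
  rewrite Rw cut1; apply/card_le1_eqP => t u; rewrite !inE.
  by move=> /andP[/andP[_ tT] wt] /andP[/andP[_ uT] wu]; exact: (inv_nbr I uT tT wu wt).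
have wT : w \notin T by apply: RT; rewrite Rw set11.
rewrite -/L in XT1; have := deg_out wT; rewrite -bdry_set1 -Rw (cutC sa R L); lia.
Qed.

(** A vertex of degree 2 with an edge leaving [X] has at most one edge into [X], so dropping it does
    not enlarge the boundary, and [inv_cut2] does not let it shrink. *)
Lemma tri_cutD1 X t : tri_cut X -> t \in T -> t \in X -> ~ inner X t ->
  1 < #|X :\ t| -> tri_cut (X :\ t).
Proof.
case/and3P=> X1 Y1 /eqP hX tT tX /innerP c0 Xt1.
have Yt1 : 1 < #|~: (X :\ t)|.
  by apply: leq_trans Y1 _; rewrite subset_leq_card // setCS subsetDl.
apply/and3P; split=> //.
have := bdryD1 sa tX; have := rdeg_splitD1 sa ia tX; rewrite deg_in // hX.
have := inv_cut2 I Xt1 Yt1; lia.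
Qed.

(* Joining [t] and [u] would leave [X] a 3-edge-cut with no vertex of [T]. *)
Definition bad t u := exists2 X, tri_cut X & X :&: T = [set t; u].

(** When [K] is crossed by another 3-edge-cut, the tip found by [uncross] would send an edge out of
    [K] if it lay in [K]; that is what innerness forbids. The bound 2 leaves two vertices of [T]
    outside as soon as [#|T| > 3]. *)
Definition core K := [/\ tri_cut K, #|K :&: T| <= 2
  & forall t, t \in K -> t \in T -> inner K t].

Lemma card_gt1 X x y : x != y -> x \in X -> y \in X -> 1 < #|X|.
Proof.
move=> nxy xX yX; have : [set x; y] \subset X by rewrite subUset !sub1set xX.
by move/subset_leq_card; rewrite cards2 nxy.
Qed.

Lemma rdeg_nbrs x : exists y z, [/\ y != z, a x y & a x z].
Proof.
have : 1 < rdeg a x by have := inv_deg I x; case: (x \in T); lia.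
by case/card_gt1P => y [z [+ + ?]]; rewrite !inE => ? ?; exists y, z.
Qed.

Lemma bad_core t u : t \in T -> u \in T -> t != u -> bad t u -> exists K, core K.
Proof.
move=> tT uT ntu [X tX XT].
have [|w [wX wT iw]] := inner_exists tX; first by rewrite XT cards2 ntu.
have XTE x : x \in X -> x \in T -> x = t \/ x = u.
  move=> xX xT; have : x \in X :&: T by rewrite inE xX.
  by rewrite XT !inE => /orP[]/eqP; auto.
pose v := if w == t then u else t.
have vT : v \in T by rewrite /v; case: ifP.
have nvw : v != w by rewrite /v; case: (eqVneq w t) => [->|]; rewrite eq_sym.
have vX : v \in X.
  have : v \in X :&: T by rewrite XT /v !inE; case: ifP; rewrite eqxx ?orbT.
  by rewrite inE => /andP[].
have XTE' x : x \in X -> x \in T -> x = w \/ x = v.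
  move=> xX xT; rewrite /v; case: (XTE _ wX wT) => ->; case: (XTE _ xX xT) => ->;
  by rewrite ?eqxx ?(eq_sym u) ?(negPf ntu); auto.
case: (innerP X v) => iv.
  exists X; split; rewrite ?XT ?card_set2_le //.
  by move=> x xX xT; case: (XTE' x xX xT) => ->.
have iw' : inner (X :\ v) w.
  move=> y awy; rewrite !inE (iw _ awy) andbT; apply: contraTneq awy => ->.
  exact: (inv_indep I).
exists (X :\ v); split.
- apply: tri_cutD1 => //; have [y [z [nyz awy awz]]] := rdeg_nbrs w.
  by apply: (card_gt1 nyz); apply: iw'.
- apply: leq_trans (_ : #|X :&: T| <= 2); last by rewrite XT; apply: card_set2_le.
  by apply: subset_leq_card; rewrite setSI // subsetDl.
move=> x; rewrite !inE => /andP[nxv xX] xT.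
by case: (XTE' x xX xT) => E; subst x => //; rewrite eqxx in nxv.
Qed.

(* Join some [f] in [core K] to some [e] outside, and uncross [K] with a 3-edge-cut
   [Z] that makes this pair bad. Unless [Z] yields a larger core, the corner outside
   both is a single vertex [l], and then [#|T| = 4]. The same holds for the
   second vertex [g] of [T] in [K], and the two sets [K :\: Z] and [K :\: Y]
   obtained in this way cannot be uncrossed. *)
Lemma core_grow K : (forall t u, t \in T -> u \in T -> t != u -> bad t u) ->
  3 < #|T| -> core K -> exists2 K', core K' & #|K| < #|K'|.
Proof.
move=> badT T4 [tK K2 iK]; have /and3P[K1 KC1 /eqP hK] := tK.
have TE : #|T| = #|K :&: T| + #|~: K :&: T|.
  by rewrite -(cardsID K T) setIC setIC setDE setIC [~: K :&: T]setIC setIC.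
have [||e [eK eT ie]] := @inner_exists (~: K); [by rewrite tri_cutC|lia|].
have eK' : e \notin K by rewrite inE in eK.
have [/existsP[K' /andP[]]|/existsPn noK] := boolP [exists K' : {set V},
  (#|K| < #|K'|) && [&& tri_cut K', #|K' :&: T| <= 2
     & [forall t in K' :&: T, cut a [set t] (~: K') == 0]]].
  move=> lt /and3P[c1 c2 /forall_inP c3]; exists K' => //; split=> // t tK' tT.
  by apply/innerP/c3; rewrite inE tK'.
exfalso.
have maxK K' : core K' -> #|K| < #|K'| -> False.
  case=> c1 c2 c3 lt; have := noK K'; rewrite lt c1 c2 /= => /negP; apply.
  by apply/forall_inP => t; rewrite inE => /andP[tK' tT]; apply/innerP/c3.
have key f : f \in K -> f \in T -> exists Z l, [/\ Z :&: T = [set f; e],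
    l \in T, ~: (K :|: Z) = [set l], cut a [set l] (K :\: Z) = 1
    & cut a [set l] (Z :\: K) = 1 /\ h (K :\: Z) = 3].
  move=> fK fT; have nfe : f != e by apply: contraNneq eK' => <-.
  have [Z tZ ZT] := badT f e fT eT nfe.
  have /and3P[Z1 ZC1 /eqP hZ] := tZ.
  have fZ : f \in Z by have := set21 f e; rewrite -ZT inE => /andP[].
  have eZ : e \in Z by have := set22 f e; rewrite -ZT inE => /andP[].
  have ZTE x : x \in Z -> x \in T -> x = f \/ x = e.
    move=> xZ xT; have : x \in Z :&: T by rewrite inE xZ.
    by rewrite ZT !inE => /orP[]/eqP; auto.
  have [B0|B0] := eqVneq (K :\: Z) set0.
    exfalso; have KZ : K \subset Z by rewrite -setD_eq0 B0.
    have fi : inner Z f by move=> y /(iK _ fK fT); apply: (subsetP KZ).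
    case: (innerP Z e) => [ie2|/(tri_cutD1 tZ eT eZ) H].
      apply: (maxK Z).
        split=> [//||t tZ' tT]; first by rewrite ZT; apply: card_set2_le.
        by case: (ZTE t tZ' tT) => ->.
      by apply: proper_card; rewrite properE KZ; apply/subsetPn; exists e.
    have KZe : K \subset Z :\ e by rewrite subsetD1 KZ.
    have Ze1 : 1 < #|Z :\ e| by apply: leq_trans K1 (subset_leq_card KZe).
    (* If [Z] were [K] with [e] added, both edges at [e] would leave [Z], as [e] is inner to the
       complement of [K]; then [h Z] would be 5. *)
    have [E|NE] := eqVneq (Z :\ e) K.
      have e0 : cut a [set e] K = 0.
        by apply/eqP; have /innerP := ie; rewrite setCK.
      have := rdeg_splitD1 sa ia eZ; rewrite E deg_in // e0 add0n => c2.
      by have := bdryU1 sa eK'; rewrite -E setD1K // hZ E hK e0 -c2.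
    apply: (maxK (Z :\ e)).
      split; [exact: H| |].
        apply: leq_trans (_ : #|Z :&: T| <= 2); last by rewrite ZT; apply: card_set2_le.
        by apply: subset_leq_card; rewrite setSI // subsetDl.
      move=> t; rewrite !inE => /andP[nte tZ'] tT.
      case: (ZTE t tZ' tT) => E; subst t; last by rewrite eqxx in nte.
      by move=> y /(iK _ fK fT); apply: (subsetP KZe).
    by apply: proper_card; rewrite properEneq eq_sym NE KZe.
  have A0 : K :&: Z != set0 by apply/set0Pn; exists f; rewrite inE fK.
  have C0 : Z :\: K != set0 by apply/set0Pn; exists e; rewrite inE eK'.
  have D0 : ~: (K :|: Z) != set0.
    apply/negP => /eqP D0; have : T \subset (K :&: T) :|: [set e].
      apply/subsetP => x xT; rewrite !inE xT andbT.
      have : x \notin ~: (K :|: Z) by rewrite D0 inE.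
      rewrite !inE negbK => /orP[->//|xZ].
      by case: (ZTE x xZ xT) => ->; rewrite ?fK ?eqxx ?orbT.
    move/subset_leq_card => H; have := leq_trans T4 (leq_trans H (card_setU_le _ _)).
    by rewrite cards1 addn1 ltnS ltnNge K2.
  have nin t (P : Prop) Q : t \in K -> t \in T -> Q \subset ~: K -> cut a [set t] Q = 1 -> P.
    move=> tK' tT QK c1; have /cut_gt0P[x [y [/set1P -> yQ ty]]] : 0 < cut a [set t] Q.
      by rewrite c1.
    by have := subsetP QK y yQ; rewrite inE (iK t tK' tT y ty).
  have CK : Z :\: K \subset ~: K by rewrite setDE subsetIr.
  have DK : ~: (K :|: Z) \subset ~: K by rewrite setCS subsetUl.
  (* A tip in [K] would have an edge out of [K]. A tip in [Z :\: K] would be [e], with an edge into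
     [K]. Only the corner outside both sets remains. *)
  case: (uncross hK hZ A0 B0 C0 D0) => -[t [tT E c1 c2 [h1 h2]]].
  - apply: (nin t _ _ _ tT CK c2).
    by have := set11 t; rewrite -E inE => /andP[].
  - apply: (nin t _ _ _ tT DK c2).
    by have := set11 t; rewrite -E inE => /andP[].
  - have [tC tZ'] : t \notin K /\ t \in Z.
      by have := set11 t; rewrite -E inE => /andP[].
    have te : t = e by case: (ZTE t tZ' tT) => // tf; rewrite tf fK in tC.
    have /cut_gt0P[x [y [/set1P -> yQ ty]]] : 0 < cut a [set t] (K :&: Z).
      by rewrite c1.
    by rewrite te in ty; have := ie y ty; rewrite inE; move: yQ; rewrite inE => /andP[->].
  by exists Z, t.
have [f fK fT] := inv_cut3 I K1 KC1 hK.
have [Z [l [ZT lT DE c1 [c2 h1]]]] := key f fK fT.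
have lD : l \in ~: (K :|: Z) by rewrite DE set11.
have [lK lZ] : l \notin K /\ l \notin Z by move: lD; rewrite !inE negb_or => /andP[].
(* A fourth vertex of [T], different from [f], [e] and [l], must lie in [K], since [l] is the only
   vertex outside [K :|: Z] and [Z] contains only [f] and [e] from [T]. *)
have [g [gK gT ngf]] : exists g, [/\ g \in K, g \in T & g != f].
  have /subsetPn[g gT] : ~~ (T \subset [set f; e; l]).
    apply: contraL T4 => /subset_leq_card; rewrite -leqNgt => /leq_trans; apply.
    by apply: leq_trans (card_setU_le _ _) _; rewrite cards1 addn1 ltnS card_set2_le.
  rewrite !inE !negb_or => /andP[/andP[ngf nge] ngl]; exists g; split=> //.
  have : g \notin ~: (K :|: Z) by rewrite DE inE.
  rewrite !inE negbK => /orP[//|gZ].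
  have : g \in Z :&: T by rewrite inE gZ.
  by rewrite ZT !inE (negPf ngf) (negPf nge).
have [Y [l' [YT lT' DE' c1' [c2' h1']]]] := key g gK gT.
have El : l' = l.
  have : l' \in ~: (K :|: Y) by rewrite DE' set11.
  rewrite !inE negb_or => /andP[lK' lY'].
  have : l' \notin Z.
    apply/negP => lZ'; have : l' \in Z :&: T by rewrite inE lZ'.
    rewrite ZT !inE => /orP[]/eqP E; subst l'; first by rewrite fK in lK'.
    by have := set22 g e; rewrite -YT inE (negPf lY').
  by move=> lZ'; apply/set1P; rewrite -DE !inE negb_or lK'.
subst l'.
have fY : f \notin Y.
  apply/negP => fY; have : f \in Y :&: T by rewrite inE fY.
  by rewrite YT !inE eq_sym (negPf ngf) => /eqP E; rewrite -E fK in eK'.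
have gZ : g \notin Z.
  apply/negP => gZ; have : g \in Z :&: T by rewrite inE gZ.
  by rewrite ZT !inE (negPf ngf) => /eqP E; rewrite -E gK in eK'.
have fZ : f \in Z by have := set21 f e; rewrite -ZT inE => /andP[].
have gY : g \in Y by have := set21 g e; rewrite -YT inE => /andP[].
have eZ : e \in Z by have := set22 f e; rewrite -ZT inE => /andP[].
have KTE x : x \in K -> x \in T -> x = f \/ x = g.
  move=> xK xT; have [->|nxf] := eqVneq x f; first by left.
  have [->|nxg] := eqVneq x g; first by right.
  have : [set x; f; g] \subset K :&: T.
    by rewrite !subUset !sub1set !inE xK xT fK fT gK gT.
  move/subset_leq_card; rewrite -setUA cardsU1 !inE negb_or nxf nxg cards2 => C.
  by move: (leq_trans C K2); rewrite eq_sym ngf.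
have nbr P : cut a [set l] P = 1 -> exists2 x, x \in P & a l x.
  move=> cP; have /cut_gt0P[x [y [/set1P -> yP ly]]] : 0 < cut a [set l] P by rewrite cP.
  by exists y.
have [x xB lx] := nbr _ c1; have [x' xB' lx'] := nbr _ c1'.
(* One of the two edges at [l] leads to [Z :\: K], so [l] has only one neighbour in [K]. It
   therefore lies in both [K :\: Z] and [K :\: Y]. *)
have Ex : x' = x.
  have : cut a [set l] K <= 1.
    have := rdeg_split sa l K; rewrite deg_in // (cutIDr sa _ (~: K) Z).
    have -> : ~: K :&: Z = Z :\: K by rewrite setIC setDE.
    by rewrite c2; clear; lia.
  have [xK xK'] : x \in K /\ x' \in K.
    by move: xB xB'; rewrite !inE => /andP[_ ->] /andP[_ ->].
  by rewrite cut1 => /card_le1_eqP; apply; rewrite inE ?xK ?xK' ?lx ?lx'.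
subst x'.
have xT : x \notin T by apply: contraL lx => xT; apply: (inv_indep I).
set B := K :\: Z in h1 xB; set B' := K :\: Y in h1' xB'.
have AT y : y \in B :&: B' -> y \notin T.
  rewrite !inE => /andP[/andP[yZ yK] /andP[yY _]]; apply/negP => yT.
  by case: (KTE y yK yT) => E; subst y; rewrite ?fZ ?gY in yZ yY.
have out : ~: K \subset ~: (B :|: B').
  by rewrite setCS subUset !subsetDl.
(* The corner [B :&: B'] contains no vertex of [T], so with boundary 3 it can only be the vertex
   [x]. A tip next to it would share the neighbour [x] with [l], and hence be [l], which is not in
   [K]. *)
have notip t : t \in K -> t \in T -> cut a [set t] (B :&: B') = 1 ->
    h (B :&: B') = 3 -> False.
  move=> tK' tT ct hA.
  have CA : 1 < #|~: (B :&: B')|.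
    apply: leq_trans KC1 _; apply: subset_leq_card; apply: subset_trans out _.
    by rewrite setCS; apply: subset_trans (subsetIl _ _) (subsetUl _ _).
  have [A1|A1] := ltnP 1 #|B :&: B'|.
    by have [y yA] := inv_cut3 I A1 CA hA; rewrite (negPf (AT _ yA)).
  have xA : x \in B :&: B' by rewrite inE xB.
  have /cut_gt0P[t' [y [/set1P -> yA ty]]] : 0 < cut a [set t] (B :&: B') by rewrite ct.
  have Ey : y = x by move/card_le1_eqP: A1; apply.
  rewrite Ey in ty; have lt : l = t.
    by apply: (inv_nbr I (w := x) lT tT); rewrite sa.
  by rewrite lt tK' in lK.
have A0 : B :&: B' != set0 by apply/set0Pn; exists x; rewrite inE xB.
have B0 : B :\: B' != set0 by apply/set0Pn; exists g; rewrite !inE gY gZ gK.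
have C0 : B' :\: B != set0 by apply/set0Pn; exists f; rewrite !inE fY fZ fK.
have D0 : ~: (B :|: B') != set0.
  by apply/set0Pn; exists e; apply: (subsetP out).
case: (uncross h1 h1' A0 B0 C0 D0) => -[t [tT E ct ct' [hP hQ]]].
- have : x \in B :&: B' by rewrite inE xB.
  by rewrite E => /set1P Ex; rewrite Ex tT in xT.
- apply: (notip t) => //; have := set11 t; rewrite -E !inE.
  by case/andP=> _ /andP[].
- apply: (notip t) => //; have := set11 t; rewrite -E !inE.
  by case/andP=> _ /andP[].
by have := leq_trans KC1 (subset_leq_card out); rewrite E cards1.
Qed.

(** Suppose all pairs are bad. With at least four vertices in [T], [core_grow] would enlarge a core
    forever. With two, the set that makes the pair bad contains all of [T], against [inv_cut3] for
    its complement. With three neither argument applies. *)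
Lemma splittable : 1 < #|T| -> #|T| != 3 ->
  exists t u, [/\ t \in T, u \in T, t != u & ~ bad t u].
Proof.
move=> T1 T3.
have badE t u : reflect (bad t u) [exists X, tri_cut X && (X :&: T == [set t; u])].
  apply: (iffP existsP) => [[X /andP[tX /eqP E]]|[X tX E]]; exists X => //.
  by rewrite tX E eqxx.
have [/existsP[t /existsP[u /and4P[tT uT ntu /badE nb]]]|/existsPn H] :=
    boolP [exists t, exists u, [&& t \in T, u \in T, t != u &
      ~~ [exists X, tri_cut X && (X :&: T == [set t; u])]]].
  by exists t, u.
exfalso; have {}H t u : t \in T -> u \in T -> t != u -> bad t u.
  move=> tT uT ntu; have /existsPn/(_ u) := H t.
  by rewrite tT uT ntu /= negbK => /badE.
have /card_gt1P[t [u [tT uT ntu]]] := T1.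
have [T4|T4] := ltnP 3 #|T|.
  have [K cK] := bad_core tT uT ntu (H t u tT uT ntu).
  have [m] := ubnP (#|V| - #|K|).
  elim: m K cK => // m IH K cK le; have [K' cK' lt] := core_grow H T4 cK.
  apply: (IH K' cK'); have : #|K'| <= #|V| := max_card _.
  by move: le lt; clear; lia.
have [X /and3P[X1 Y1 /eqP hX] XT] := H t u tT uT ntu.
have [||v vX vT] := inv_cut3 I Y1; rewrite ?setCK ?bdryC //.
have : [set t; u] == T.
  by rewrite eqEcard subUset !sub1set tT uT cards2 ntu; lia.
rewrite -XT => /eqP/setP/(_ v); rewrite !inE vT andbT.
by move: vX; rewrite inE => /negPf ->.
Qed.

End Splitting.

(** * Adding edges while the cut conditions persist *)

Definition adde (V : finType) (a : rel V) t u : rel V :=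
  fun x y => a x y || ([set x; y] == [set t; u]).

Lemma adde_sym (V : finType) (a : rel V) t u : symmetric a -> symmetric (adde a t u).
Proof. by move=> sa x y; rewrite /adde sa [[set x; y]]setUC. Qed.

Lemma adde_irr (V : finType) (a : rel V) t u : t != u -> irreflexive a ->
  irreflexive (adde a t u).
Proof.
move=> ntu ia x; rewrite /adde ia; apply: contraNF ntu => /eqP.
by move/set2_inj => -[[<- <-]|[<- <-]].
Qed.

Lemma rdeg_adde (V : finType) (a : rel V) t u x : symmetric a -> t != u -> ~~ a t u ->
  rdeg (adde a t u) x = rdeg a x + ((x == t) || (x == u)).
Proof.
move=> sa ntu natu.
have E v w : [set v; w] = [set t; u] -> rdeg (adde a t u) v = rdeg a v + 1.
  move=> Evw; have nvw : ~~ a v w.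
    by case/set2_inj: Evw => -[-> ->]; rewrite // sa.
  rewrite /rdeg addn1 -[RHS]add1n.
  have -> : [set y | adde a t u v y] = w |: [set y | a v y].
    apply/setP => y; rewrite !inE /adde orbC; congr (_ || _).
    rewrite -Evw; apply/eqP/eqP => [/set2_inj [[_ //]|[<- <- //]]|-> //].
  by rewrite cardsU1 inE nvw.
have [->|nxt] := eqVneq x t; first exact: (E t u).
have [->|nxu] := eqVneq x u; first by apply: (E u t); rewrite setUC.
rewrite addn0; apply: eq_card => y; rewrite !inE /adde.
case: eqP => [/set2_inj [[]|[]] /eqP|_]; last by rewrite orbF.
  by rewrite (negPf nxt).
by rewrite (negPf nxu).
Qed.

Lemma cut_pairs (V : finType) (a : rel V) (X Y : {set V}) :
  cut a X Y = #|[set p : V * V | [&& p.1 \in X, p.2 \in Y & a p.1 p.2]]|.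
Proof.
rewrite /cut pair_big /= -sum1_card big_mkcond [RHS]big_mkcond /=.
by apply: eq_bigr => -[x y] _; rewrite !inE /=; case: (x \in X); case: (y \in Y); case: (a x y).
Qed.

Lemma leq_cut (V : finType) (a b : rel V) (X Y : {set V}) :
  subrel a b -> cut a X Y <= cut b X Y.
Proof.
move=> sab; apply: leq_sum => x _; apply: leq_sum => y _.
by case H: (a x y); rewrite // (sab _ _ H).
Qed.

Lemma ltn_cut (V : finType) (a b : rel V) (X Y : {set V}) x y :
  subrel a b -> x \in X -> y \in Y -> b x y -> ~~ a x y -> cut a X Y < cut b X Y.
Proof.
move=> sab xX yY bxy naxy; rewrite !cut_pairs; apply: proper_card.
apply/properP; split.
  by apply/subsetP => -[u v]; rewrite !inE /= => /and3P[-> -> /sab].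
by exists (x, y); rewrite !inE /= xX yY ?bxy.
Qed.

Section AddEdge.
Variables (V : finType) (a : rel V) (T : {set V}).
Hypothesis I : split_inv a T.

(** Boundaries only grow, and strictly if the new edge crosses. So a boundary of 3 was 3 before,
    with [t] and [u] on the same side; if that side had no other vertex of [T], it would make the
    pair bad. The adjacency conditions survive because both ends of the new edge leave [T]. *)
Lemma split_inv_add t u : t \in T -> u \in T -> t != u -> ~ bad a T t u ->
  split_inv (adde a t u) (T :\: [set t; u]).
Proof.
move=> tT uT ntu nbad.
have sub : subrel a (adde a t u) by move=> x y; rewrite /adde => ->.
have ntu' : ~~ a t u by apply: (inv_indep I).
have bd X : bdry a X <= bdry (adde a t u) X by apply: leq_cut.
have bd' (X : {set V}) x y : [set x; y] = [set t; u] -> x \in X -> y \notin X ->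
    bdry a X < bdry (adde a t u) X.
  move=> E xX yX; apply: (ltn_cut (y := y) sub xX).
  - by rewrite inE.
  - by rewrite /adde E eqxx orbT.
  by case/set2_inj: E => -[-> ->]; rewrite // (inv_sym I).
have nT x y : y \in T :\: [set t; u] -> adde a t u x y -> a x y.
  rewrite inE => /andP[+ _] /orP[//|/eqP E]; case/negP.
  by rewrite -E set22.
split=> //.
- exact/adde_sym/(inv_sym I).
- by apply: adde_irr ntu _; apply: (inv_irr I).
- move=> x; rewrite (rdeg_adde x (inv_sym I)) // -[RHS](inv_deg I x) -addnA.
  congr (_ + _); rewrite !inE negb_or.
  have [->|_] := eqVneq x t; first by rewrite tT.
  by have [->|_] := eqVneq x u; first by rewrite uT.
- by move=> X X1 Y1; apply: leq_trans (inv_cut2 I X1 Y1) (bd X).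
- move=> X X1 Y1 hX.
  have hX' : bdry a X = 3.
    by apply/eqP; rewrite eqn_leq (inv_cut2 I X1 Y1) -hX bd.
  have same : (t \in X) = (u \in X).
    apply/idP/idP => H; apply: contraT => H'.
      by have := bd' X t u erefl H H'; rewrite hX' hX.
    by have := bd' X u t (setUC _ _) H H'; rewrite hX' hX.
  have [/existsP[v /andP[vX vT]]|/existsPn H] :=
    boolP [exists v, (v \in X) && (v \in T :\: [set t; u])]; first by exists v.
  have H' x : x \in X -> x \in T -> x \in [set t; u].
    by move=> xX xT; have := H x; rewrite xX inE xT andbT negbK.
  exfalso; apply: nbad; exists X; first by apply/and3P; split=> //; apply/eqP.
  have tX : t \in X.
    have [x xX xT] := inv_cut3 I X1 Y1 hX'; have := H' x xX xT.
    by rewrite !inE => /orP[]/eqP E; [rewrite -E|rewrite same -E].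
  apply/setP => x; rewrite [LHS]inE; apply/andP/idP => [[xX xT]|]; first exact: H'.
  by rewrite !inE => /orP[]/eqP->; rewrite -?same.
- move=> w v v' vT v'T /(nT _ _ vT) wv /(nT _ _ v'T) wv'.
  by apply: (inv_nbr I) wv wv'; [case/setDP: vT|case/setDP: v'T].
- move=> v v' vT v'T; apply/negP => /(nT _ _ v'T); apply/negP.
  by apply: (inv_indep I); [case/setDP: vT|case/setDP: v'T].
Qed.

End AddEdge.

(** Each step removes two vertices of [T] and keeps its parity. Size 1 is excluded at the start and
    never reached, because size 3 is a stop. *)
Lemma split_inv_complete (V : finType) (a : rel V) (T : {set V}) :
  split_inv a T -> #|T| != 1 -> exists a' T',
  [/\ split_inv a' T', T' \subset T, subrel a a' & #|T'| = if odd #|T| then 3 else 0].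
Proof.
have [m] := ubnP #|T|; elim: m a T => // m IH a T lt I T1.
have [T0|Tn0] := posnP #|T|; first by exists a, T; rewrite T0; split.
have [T3|T3] := eqVneq #|T| 3; first by exists a, T; rewrite T3; split.
have [||t [u [tT uT ntu nb]]] := splittable I; [|by []|].
  by case: #|T| Tn0 T1 => [|[]].
have E : #|T| = (#|T :\: [set t; u]|).+2.
  rewrite -(cardsID [set t; u] T).
  have /setIidPr -> : [set t; u] \subset T by rewrite subUset !sub1set tT.
  by rewrite cards2 ntu.
have [|||a' [T' [I' sT sa' c]]] := IH (adde a t u) (T :\: [set t; u]).
- by move: lt; rewrite E ltnS => /ltnW.
- exact: split_inv_add.
- by move: T3; rewrite E; case: #|T :\: _| => [|[]].
exists a', T'; split=> //.
- by apply: subset_trans sT (subsetDl _ _).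
- by move=> x y axy; apply: sa'; rewrite /adde axy.
by rewrite c E /= negbK.
Qed.

(** * Recognising snarks by their edge cuts *)

Lemma cut_set1_sum (V : finType) (a : rel V) (X Y : {set V}) :
  cut a X Y = \sum_(x in X) cut a [set x] Y.
Proof. by apply: eq_bigr => x _; rewrite /cut big_set1. Qed.

Lemma bdry_del_edges (G : sgraph) (F : {set {set G}}) (X : {set G}) :
  (forall x y, x \in X -> y \notin X -> ~~ @adj (del_edges F) x y) ->
  bdry (@adj G) X <= #|F|.
Proof.
move=> H; rewrite /bdry cut_pairs.
set P := [set p | _].
have inj : {in P &, injective (fun p : G * G => [set p.1; p.2])}.
  move=> [x y] [u v]; rewrite !inE /= => /and3P[xX yX _] /and3P[uX vX _].
  by case/set2_inj => -[Ex Ey]; subst x y; rewrite ?uX in vX yX *.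
rewrite -(card_in_imset inj); apply: subset_leq_card.
apply/subsetP => e /imsetP[[x y]]; rewrite !inE /= => /and3P[xX yX xy] ->.
by have := H x y xX yX; rewrite /= /del_edges_adj xy /= negbK.
Qed.

(** In a cubic graph a triangle is bounded by at most three edges; the order ensures two vertices on
    its other side. Two components with cycles have more than one vertex each, and the boundary of
    one of them consists of deleted edges. *)
Lemma snark_intro (G : sgraph) : cubic G -> class2 G -> 4 < #|G| ->
  (forall X : {set G}, 1 < #|X| -> 1 < #|~: X| -> 3 < bdry (@adj G) X) -> snark G.
Proof.
move=> cG c2 G4 hG; split=> //.
  move=> x y z; apply/and3P => -[xy yz xz].
  have sa := @adj_sym G.
  have ne u v : @adj G u v -> u != v by apply: contraTneq => ->; rewrite adj_irr.
  pose X := [set x; y; z].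
  have cX : #|X| = 3.
    by rewrite /X -setUA cardsU1 !inE negb_or cards2 (ne _ _ xy) (ne _ _ xz) (ne _ _ yz).
  have two u v w : adj u v -> adj u w -> v \in X -> w \in X -> v != w ->
      cut (@adj G) [set u] (~: X) <= 1.
    move=> uv uw vX wX nvw.
    have := rdeg_split sa u X; have -> : rdeg (@adj G) u = 3 by apply: cG.
    suff : 2 <= cut (@adj G) [set u] X by clear; lia.
    rewrite cut1; apply/card_gt1P; exists v, w.
    by rewrite !inE uv uw; move: vX wX; rewrite !inE => -> ->.
  have : bdry (@adj G) X <= 3.
    rewrite /bdry cut_set1_sum -cX -sum1_card; apply: leq_sum => u.
    rewrite !inE -orbA => /or3P[]/eqP->.
    - by apply: (two x y z); rewrite // ?inE ?eqxx ?orbT ?ne.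
    - by apply: (two y x z); rewrite // 1?adj_sym // ?inE ?eqxx ?orbT ?ne.
    - by apply: (two z x y); rewrite // 1?adj_sym // ?inE ?eqxx ?orbT ?ne.
  rewrite leqNgt hG // ?cX //.
  by have := cardsC X; rewrite cX; move: G4; clear; lia.
move=> F FG F4 C1 C2 C1P C2P [c1 [/andP[cy1 u1] s1 sub1]] [c2' [/andP[cy2 u2] s2 sub2]].
have big (C : {set G}) (c : seq G) : uniq c -> 2 < size c -> {subset c <= C} -> 1 < #|C|.
  move=> uc sc /subsetP /subset_leq_card; rewrite (card_uniqP uc).
  by apply: leq_trans; apply: ltnW.
have eqv : {in [set: del_edges F] & &, equivalence_rel (connect (@adj (del_edges F)))}.
  have cs : connect_sym (@adj (del_edges F)) by apply: sym_connect_sym; apply: adj_sym.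
  by move=> x y z _ _ _; split=> // xy; apply: (same_connect cs).
have /and3P[_ /trivIsetP tI _] := equivalence_partitionP eqv.
apply/eqP; apply: contraT => nC; have dis := tI _ _ C1P C2P nC.
have : bdry (@adj G) C1 <= #|F|.
  apply: bdry_del_edges => x y xC yC; apply: contra yC => xy.
  case/imsetP: C1P xC => x0 _ ->; rewrite !inE /= => /connect_trans; apply.
  exact: connect1.
have C12 : (C2 : {set G}) \subset ~: C1 by rewrite -disjoints_subset disjoint_sym.
rewrite leqNgt => /negP; case; apply: leq_trans F4 _; apply: hG.
  exact: big u1 s1 sub1.
by apply: leq_trans (subset_leq_card C12); apply: big u2 s2 sub2.
Qed.

(** * Completion to a snark *)

Lemma card_invol_even (V : finType) (f : V -> V) (A : {set V}) :
  (forall x, x \in A -> [/\ f x \in A, f (f x) = x & f x != x]) -> ~~ odd #|A|.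
Proof.
have [m] := ubnP #|A|; elim: m A => // m IH A lt fA.
have [->|/set0Pn[x xA]] := eqVneq A set0; first by rewrite cards0.
have [fxA ffx nfx] := fA x xA.
have E : #|A| = (#|A :\: [set x; f x]|).+2.
  rewrite -(cardsID [set x; f x] A).
  have /setIidPr -> : [set x; f x] \subset A by rewrite subUset !sub1set xA.
  by rewrite cards2 eq_sym nfx.
rewrite E /= negbK; apply: IH; first by move: lt; rewrite E ltnS => /ltnW.
move=> y; rewrite !inE negb_or => /andP[/andP[nyx nyfx] yA].
have [fyA ffy nfy] := fA y yA; split=> //.
rewrite fyA andbT; apply/norP; split.
  by apply: contra nyfx => /eqP <-; rewrite ffy.
by apply: contra nyx => /eqP E'; rewrite -ffy E' ffx.
Qed.

Lemma cut_even (V : finType) (a : rel V) (X : {set V}) :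
  symmetric a -> irreflexive a -> ~~ odd (cut a X X).
Proof.
move=> sa ia; rewrite cut_pairs; apply: (@card_invol_even _ (fun p => (p.2, p.1))).
move=> [x y]; rewrite !inE /= => /and3P[xX yX axy]; split=> //.
  by rewrite xX yX sa.
by apply: contraTneq axy => -[_ ->]; rewrite ia.
Qed.

Lemma inv_parity (V : finType) (a : rel V) (T : {set V}) :
  split_inv a T -> odd #|V| = odd #|T|.
Proof.
move=> I; have ev := cut_even setT (inv_sym I) (inv_irr I).
have : \sum_(x in [set: V]) (rdeg a x + (x \in T)) = 3 * #|V|.
  rewrite (eq_bigr (fun _ => 3)) => [|x _]; last exact: inv_deg I x.
  by rewrite sum_nat_const cardsT mulnC.
rewrite big_split /= rdeg_sum ?(inv_sym I) //; last exact: inv_sym I.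
have -> : bdry a setT = 0 by rewrite /bdry setCT cut0r.
have -> : \sum_(x in [set: V]) (x \in T : nat) = #|T|.
  rewrite -sum1_card big_mkcond [RHS]big_mkcond /=.
  by apply: eq_bigr => x _; rewrite inE; case: (x \in T).
by rewrite addn0 => /(congr1 odd); rewrite oddD (negPf ev) oddM.
Qed.

Lemma rdeg_dele_out (V : finType) (a : rel V) x y z :
  z != x -> z != y -> rdeg (dele a x y) z = rdeg a z.
Proof.
move=> nzx nzy; apply: eq_card => t; rewrite !inE /dele andbC.
by case: eqP => // /set2_inj [] [E]; rewrite E eqxx in nzx nzy.
Qed.

Lemma rdeg_dele_in (V : finType) (a : rel V) x y :
  a x y -> (rdeg (dele a x y) x).+1 = rdeg a x.
Proof.
move=> axy; rewrite /rdeg [RHS](cardsD1 y) inE axy add1n; congr _.+1.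
apply: eq_card => t; rewrite !inE /dele andbC; congr (_ && _); congr negb.
by apply/eqP/eqP => [/set2_inj [[]|[<- <-]]|->].
Qed.

Lemma free_colour (V : finType) (a : rel V) k (c : V -> V -> 'I_k) x (B : {set 'I_k}) :
  rdeg a x + #|B| < k -> exists2 g, g \notin B & forall y, a x y -> c x y != g.
Proof.
move=> lt; pose U := [set c x y | y in [set y | a x y]] :|: B.
have : #|U| < k.
  apply: leq_ltn_trans lt; apply: leq_trans (card_setU_le _ _) _.
  by rewrite leq_add2r leq_imset_card.
have [/existsP[g gU]|/existsPn H] := boolP [exists g, g \notin U].
  move=> _; exists g; first by apply: contra gU; rewrite inE orbC => ->.
  move=> y axy; apply: contraNneq gU => <-; rewrite inE; apply/orP; left.
  by apply/imsetP; exists y; rewrite ?inE.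
have -> : U = setT by apply/setP => g; rewrite [RHS]inE; have := H g; rewrite negbK.
by rewrite cardsT card_ord ltnn.
Qed.

(** * A graph with one additional vertex *)

Section OptGraph.
Variables (V : finType) (a : rel V) (N : {set V}).
Hypotheses (sa : symmetric a) (ia : irreflexive a).

(** [None] has two uses: as the common neighbour given to the last three vertices of [T], and as the
    vertex to which one side of a cut is contracted. *)
Definition opt_rel : rel (option V) := fun u v =>
  match u, v with
  | Some x, Some y => a x y
  | Some x, None | None, Some x => x \in N
  | None, None => false
  end.

Lemma opt_sym : symmetric opt_rel.
Proof. by move=> [x|] [y|] //=. Qed.

Lemma opt_irr : irreflexive opt_rel.
Proof. by move=> [x|] //=. Qed.

Definition opt_graph : sgraph := SGraph opt_sym opt_irr.

Lemma some_inj : injective (@Some V).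
Proof. by move=> x y []. Qed.

Lemma mem_some (A : {set V}) x : (Some x \in Some @: A) = (x \in A).
Proof. exact: (mem_imset _ _ some_inj). Qed.

Lemma rdeg_opt_some x : rdeg opt_rel (Some x) = rdeg a x + (x \in N).
Proof.
rewrite /rdeg -(card_imset (mem [set y | a x y]) some_inj).
rewrite (cardsD1 None) inE /= addnC; congr (_ + _); apply: eq_card => -[y|].
  by rewrite !inE /= mem_some inE.
by rewrite !inE; apply/esym/imsetP => -[].
Qed.

Lemma rdeg_opt_none : rdeg opt_rel None = #|N|.
Proof.
rewrite /rdeg -(card_imset _ some_inj); apply: eq_card => -[y|].
  by rewrite inE mem_some.
by rewrite inE /=; apply/esym/imsetP => -[].
Qed.

Lemma cut_opt_some (X Y : {set V}) :
  cut opt_rel (Some @: X) (Some @: Y) = cut a X Y.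
Proof.
rewrite /cut big_imset /= => [|x y _ _ []//]; apply: eq_bigr => x _.
by rewrite big_imset //= => y z _ _ [].
Qed.

Lemma bdry_opt (X : {set V}) :
  bdry opt_rel (Some @: X) = bdry a X + #|X :&: N|.
Proof.
rewrite /bdry (cutIDr opt_sym _ _ (Some @: setT)).
have -> : ~: (Some @: X) :&: Some @: [set: V] = Some @: (~: X).
  apply/setP => -[x|]; first by rewrite !inE !mem_some !inE andbT.
  rewrite !inE; have E A : (None \in Some @: (A : {set V})) = false.
    by apply/imsetP => -[].
  by rewrite !E.
have -> : ~: (Some @: X) :\: Some @: [set: V] = [set None].
  apply/setP => -[x|]; first by rewrite !inE mem_some inE.
  rewrite !inE; have E A : (None \in Some @: (A : {set V})) = false.
    by apply/imsetP => -[].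
  by rewrite !E.
rewrite cut_opt_some; congr (_ + _); rewrite (cutC opt_sym) cut1.
rewrite -(card_imset _ some_inj); apply: eq_card => -[x|].
  by rewrite !inE !mem_some inE.
by rewrite !inE andbF; apply/esym/imsetP => -[].
Qed.

Lemma some_preimset (X : {set option V}) : None \notin X ->
  X = Some @: (Some @^-1: X).
Proof.
move=> nX; apply/setP => -[x|]; first by rewrite mem_some inE.
by rewrite (negPf nX); apply/esym/imsetP => -[].
Qed.

End OptGraph.

(** [F] consists of the edges of [S] that are not images of edges of [G]. The last clause is what
    yields [F != set0] when the order stays the same. *)
Lemma iso_del_edges (G S : sgraph) (f : G -> S) : bijective f ->
  (forall x y, adj x y -> adj (f x) (f y)) ->
  exists F : {set {set S}}, [/\ F \subset edges S, iso G (del_edges F) &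
    forall x y : G, adj (f x) (f y) -> ~~ adj x y -> F != set0].
Proof.
move=> bf hf; have injf := bij_inj bf.
pose F := [set e in edges S | [forall x, forall y, adj x y ==> (e != [set f x; f y])]].
have FE x y : adj (f x) (f y) -> ([set f x; f y] \in F) = ~~ adj x y.
  move=> axy; rewrite inE; have -> : [set f x; f y] \in edges S.
    by apply/edgesP; exists (f x), (f y).
  apply/forallP/idP => [/(_ x)/forallP/(_ y)|nxy u].
    by rewrite eqxx implybF.
  apply/forallP => v; apply/implyP => uv; apply: contra nxy => /eqP.
  by move/set2_inj => -[[/injf -> /injf -> //]|[/injf -> /injf ->]]; rewrite adj_sym.
exists F; split.
- by apply/subsetP => e; rewrite inE => /andP[].
- exists f => // x y; rewrite /= /del_edges_adj.
  case H: (adj (f x) (f y)) => /=; first by rewrite FE // negbK.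
  by apply/esym; apply/negP => /hf; rewrite H.
by move=> x y axy nxy; apply/set0Pn; exists [set f x; f y]; rewrite FE.
Qed.

Lemma class2_cubic (S : sgraph) : 0 < #|S| -> cubic S -> ~ kcol 3 (@adj S) ->
  kcol 4 (@adj S) -> class2 S.
Proof.
case/card_gt0P => x0 _ cS n3 k4; rewrite /class2.
have -> : max_deg S = 3.
  apply/eqP; rewrite eqn_leq; apply/andP; split.
    by apply/bigmax_leqP => x _; rewrite cS.
  by rewrite -(cS x0); apply: leq_bigmax.
apply/eqP; rewrite eqn_leq; apply/andP; split; first exact/chromatic_index_le.
by rewrite ltnNge; apply/negP => /chromatic_index_le.
Qed.

Definition deg2 (G : sgraph) : {set G} := [set x | deg x == 2].

Section Completion.
Variable G : sgraph.
Hypothesis critG : critical3 G.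
Hypothesis I : split_inv (@adj G) (deg2 G).
Hypothesis T2 : 1 < #|deg2 G|.
Let T := deg2 G.

Lemma deg2_edge t : t \in T -> exists2 w, adj t w & w \notin T.
Proof.
move=> tT; have [y [_ [_ ty _]]] := rdeg_nbrs I t; exists y => //.
by apply: contraL ty => yT; apply: (inv_indep I).
Qed.

(** A neighbour of a vertex of [T] has no second neighbour in [T]. The edge [wz] is the one to be
    deleted before colouring: as it avoids [T], it can share the fourth colour with the edges added
    at [T]. *)
Lemma deg3_edge : exists w z : G, [/\ adj w z, w \notin T & z \notin T].
Proof.
have /card_gt1P[t [_ [tT _ _]]] := T2; have [w tw wT] := deg2_edge tT.
have [y [z [nyz wy wz]]] := rdeg_nbrs I w.
have [yT|yT] := boolP (y \in T); last by exists w, y.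
exists w, z; split=> //; apply: contra nyz => zT.
by apply/eqP; apply: (inv_nbr I) wy wz.
Qed.

(** Two vertices of [T] and their four neighbours are six different vertices, since [T] is
    independent without common neighbours. *)
Lemma card_gt4 : 4 < #|G|.
Proof.
have /card_gt1P[t [u [tT uT ntu]]] := T2.
have [y [z [nyz ty tz]]] := rdeg_nbrs I t.
have [v [w [nvw uv uw]]] := rdeg_nbrs I u.
have nT p q : p \in T -> adj p q -> q \notin T.
  by move=> pT pq; apply: contraL pq => qT; apply: (inv_indep I).
have diff p q : adj t p -> adj u q -> p != q.
  move=> tp uq; apply: contraNneq ntu => E; subst q.
  by apply/eqP; apply: (inv_nbr I) (_ : adj p t) (_ : adj p u); rewrite // adj_sym.
have neT p q : p \in T -> q \notin T -> p != q by move=> pT; apply: contraNneq => <-.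
pose s := [:: t; u; y; z; v; w].
have us : uniq s.
  have [yT zT vT wT] : [/\ y \notin T, z \notin T, v \notin T & w \notin T].
    by split; [apply: nT ty|apply: nT tz|apply: nT uv|apply: nT uw].
  rewrite /= !inE !negb_or ntu nyz nvw !(neT t) ?(neT u) //.
  by rewrite (diff y v) ?(diff y w) ?(diff z v) ?(diff z w).
have : #|s| <= #|G| by apply: max_card.
by rewrite (card_uniqP us) /=; apply: leq_trans.
Qed.

Lemma completion_even : ~~ odd #|G| ->
  exists (S : sgraph) (F : {set {set S}}),
    [/\ snark S, #|S| = #|G|, F \subset edges S, F != set0 & iso G (del_edges F)].
Proof.
move=> evG; have [_ _ n3 e3] := critical3_elim critG.
have oT : odd #|T| = false by rewrite -(inv_parity I) (negPf evG).
have [|a [T' [I' _ sub]]] := split_inv_complete I; first by case: #|_| T2 => [|[]].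
rewrite oT => /eqP; rewrite cards_eq0 => /eqP T0; rewrite {}T0 in I'.
pose S := SGraph (inv_sym I') (inv_irr I').
have cS : cubic S by move=> x; have := inv_deg I' x; rewrite inE addn0.
have [F [FS iG nF]] := @iso_del_edges G S id (inv_bij (fun=> erefl)) sub.
exists S, F; split=> //.
  apply: snark_intro => //; last 2 first.
  - exact: card_gt4.
  - move=> X X1 Y1; rewrite ltn_neqAle (inv_cut2 I') // andbT eq_sym.
    by apply/eqP => hX; have [x _] := inv_cut3 I' X1 Y1 hX; rewrite inE.
  apply: class2_cubic => //.
  - exact: leq_trans card_gt4.
  - by move/(kcol_sub sub).
  have [w [z [wz wT zT]]] := deg3_edge.
  (* In [G - wz] exactly [w], [z] and the vertices of [T] have degree 2, so [wz] and the added edges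
     form a matching. *)
  apply: kcol_succ (e3 w z wz).
  - exact/dele_sym/adj_sym.
  - exact: (inv_sym I').
  - by move=> x y /dele_sub; apply: sub.
  move=> x; have -> : rdeg (@adj S) x = 3 by apply: cS.
  have := inv_deg I x; have [xT|xT] := boolP (x \in deg2 G).
    rewrite rdeg_dele_out; first by rewrite addn1 => ->.
      by apply: contraNneq wT => <-.
    by apply: contraNneq zT => <-.
  by rewrite addn0 => <-; apply: rdeg_dele.
have /card_gt1P[t [_ [tT _ _]]] := T2.
have [y ty nty] : exists2 y, a t y & ~~ adj t y.
  have : rdeg (@adj G) t < rdeg a t.
    by have := cS t; have := inv_deg I t; rewrite tT /deg /rdeg /nbhd addn1 => -[->] ->.
  rewrite /rdeg ltnNge => H.
  have /subsetPn[y] : ~~ ([set y | a t y] \subset [set y | adj t y]).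
    by apply: contra H; apply: subset_leq_card.
  by rewrite !inE => ay ny; exists y.
exact: nF ty nty.
Qed.

Lemma completion_odd : odd #|G| ->
  exists (S : sgraph) (v : S) (F : {set {set del_vertex v}}),
    [/\ snark S, #|S| = #|G| + 1, F \subset edges (del_vertex v) & iso G (del_edges F)].
Proof.
move=> odG; have [_ _ n3 e3] := critical3_elim critG.
have oT : odd #|T| by rewrite -(inv_parity I).
have [|a [T' [I' sT sub]]] := split_inv_complete I; first by case: #|_| T2 => [|[]].
rewrite oT => T3.
pose S := opt_graph T' (inv_sym I') (inv_irr I').
have cS : cubic S.
  move=> [x|]; last by rewrite -T3 -(rdeg_opt_none a).
  by rewrite -(inv_deg I' x) -rdeg_opt_some.
have cardS : #|S| = #|G| + 1 by rewrite card_option addn1.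
pose f (x : G) : del_vertex (None : S) := exist _ (Some x) isT.
have bf : bijective f.
  apply: inj_card_bij => [x y /(congr1 val) [] //|].
  by rewrite card_sig (eq_card (B := predC1 None)) // cardC1 card_option.
have [F [FS iG _]] := @iso_del_edges G (del_vertex (None : S)) f bf sub.
exists S, None, F; split=> //.
have G4 := card_gt4.
apply: snark_intro => //; last 2 first.
- by rewrite cardS addn1 ltnW.
- have main (X : {set option G}) : None \notin X -> 1 < #|X| -> 1 < #|~: X| -> 3 < bdry (@adj S) X.
    move=> /some_preimset; set Y := _ @^-1: X => EX.
    have cX : #|X| = #|Y| by rewrite EX card_imset //; apply: some_inj.
    move=> X1 X1'; rewrite EX (bdry_opt _ (inv_sym I')).
    have cC : #|~: X| = (#|~: Y|).+1.
      have := cardsC X; have := cardsC Y; rewrite cardS cX; clear; lia.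
    rewrite cX in X1; rewrite cC ltnS in X1'.
    have [Y1|Y1] := ltnP 1 #|~: Y|.
      have := inv_cut2 I' X1 Y1; rewrite leq_eqVlt => /orP[/eqP hY|h4].
        have [t tY tT'] := inv_cut3 I' X1 Y1 (esym hY).
        rewrite -hY -addn1 leq_add2l card_gt0; apply/set0Pn; exists t.
        by rewrite inE tY.
      exact: leq_trans h4 (leq_addr _ _).
    (* The other side consists of [None] and one vertex [y]. The edges between are those at [y]
       other than a possible [y None], and those from [None] to [T'] without [y]: 2 + 2 or 3 + 3. *)
    have /cards1P[y Ey] : #|~: Y| == 1 by rewrite eqn_leq Y1.
    rewrite -(bdryC (inv_sym I')) Ey (bdry_set1 I').
    have -> : Y :&: T' = T' :\ y.
      by rewrite setDE -Ey setCK setIC.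
    have := inv_deg I' y; have := cardsD1 y T'; rewrite T3.
    by case: (y \in T'); clear; lia.
  move=> X X1 Y1; have [NX|NX] := boolP (None \in X); last exact: main.
  rewrite -(bdryC (@adj_sym S)); apply: main; rewrite ?setCK //.
  by rewrite inE NX.
apply: class2_cubic => //; first by rewrite cardS addn1.
  case=> c sc pc; apply: n3; exists (fun x y => c (Some x) (Some y)) => [x y|]; first exact: sc.
  move=> x y z _ /sub xy /sub xz E.
  have : Some y = Some z :> S by apply: (pc (Some x)).
  by case.
(* The fourth colour can serve only one edge at [None], the one to [t1]; those to [t2] and [t3] must
   take old colours. Deleting the edge [t2 w] as well leaves two free colours at [t2], one of which
   differs from the colour free at [t3]. The fourth colour then also goes to [t2 w]. *)
have /card_gt2P[t1 [t2 [t3 [[_ t2T' t3T'] [_ n23 _]]]]] : 2 < #|T'| by rewrite T3.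
have t2T := subsetP sT _ t2T'; have t3T := subsetP sT _ t3T'.
have [w tw wT] := deg2_edge t2T.
have [c sc pc] := e3 t2 w tw.
pose b := dele (@adj G) t2 w.
have b2 : rdeg b t2 = 1 by have := rdeg_dele_in tw; have := inv_deg I t2; rewrite t2T addn1 => -[->] [].
have nw x : x \in T -> x != w by move=> xT; apply: contraNneq wT => <-.
have b3 x : x \in T -> x != t2 -> rdeg b x = 2.
  move=> xT nx; rewrite /b rdeg_dele_out ?nw //.
  by have := inv_deg I x; rewrite xT addn1 => -[].
have [g3 _ hg3] : exists2 g, g \notin set0 & forall y, b t3 y -> c t3 y != g.
  by apply: free_colour; rewrite cards0 b3 // eq_sym.
have [g2 g23 hg2] : exists2 g, g \notin [set g3] & forall y, b t2 y -> c t2 y != g.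
  by apply: free_colour; rewrite cards1 b2.
rewrite inE in g23.
have sb : symmetric b by apply/dele_sym/adj_sym.
have n32 : (t3 == t2) = false by rewrite eq_sym (negPf n23).
have kb : kcol 3 (opt_rel b [set t2; t3]).
  pose g x := if x == t2 then g2 else g3.
  pose c' (u v : option G) := match u, v with
    | Some x, Some y => c x y
    | Some x, None | None, Some x => g x
    | None, None => g2 end.
  have hg x y : x \in [set t2; t3] -> b x y -> c x y != g x.
    rewrite /g !inE => /orP[]/eqP -> bxy; first by rewrite eqxx; apply: hg2.
    by rewrite n32; apply: hg3.
  exists c' => [[x|] [y|] //=|[x|] [y|] [z|] _ //=].
  - by move=> bxy bxz /(pc x) -> .
  - by move=> bxy /hg - /(_ _ bxy) /eqP.
  - by move=> /hg H bxz E; have /eqP := H _ bxz; rewrite E.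
  rewrite /g !inE => /orP[]/eqP -> /orP[]/eqP ->; rewrite ?eqxx //.
    by rewrite n32 => E; rewrite E eqxx in g23.
  by rewrite n32 => E; rewrite E eqxx in g23.
apply: kcol_succ kb.
- exact: opt_sym.
- exact: opt_sym (inv_sym I').
- move=> [x|] [y|] //=; first by move/dele_sub; apply: sub.
    by rewrite !inE => /orP[]/eqP->.
  by rewrite !inE => /orP[]/eqP->.
move=> x; have -> : rdeg (@adj S) x = 3 by apply: cS.
case: x => [x|]; last by rewrite rdeg_opt_none cards2 n23.
rewrite rdeg_opt_some ltnS !inE.
have [->|nx2] := eqVneq x t2; first by rewrite b2.
have [xT|xT] := boolP (x \in T); first by rewrite b3.
by have := inv_deg I x; rewrite (negPf xT) addn0 => E; have := rdeg_dele (@adj G) t2 w x; rewrite E ltnS => H; apply: leq_trans H (leq_addr _ _).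
Qed.

End Completion.

(** * Critical graphs *)

Section Recolour.
Variables (V : finType) (a : rel V) (k : nat).
Hypothesis sa : symmetric a.
Implicit Types (c : V -> V -> 'I_k) (X : {set V}).

Definition recol c x y g := fun u v => if [set u; v] == [set x; y] then g else c u v.

Lemma recol_sym c x y g : sym_col c -> sym_col (recol c x y g).
Proof. by move=> sc u v; rewrite /recol sc setUC. Qed.

Lemma recol_out c x y g u v : u != x -> u != y -> recol c x y g u v = c u v.
Proof.
move=> ux uy; rewrite /recol; case: eqP => // /set2_inj [] [E];
by rewrite E eqxx in ux uy.
Qed.

Lemma recol_in c x y g : recol c x y g x y = g.
Proof. by rewrite /recol eqxx. Qed.

Lemma recol_proper c x y g X : sym_col c -> proper_at (dele a x y) X c ->
  (x \in X -> forall z, dele a x y x z -> c x z != g) ->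
  (y \in X -> forall z, dele a x y y z -> c y z != g) ->
  proper_at a X (recol c x y g).
Proof.
move=> sc pc fx fy u v w uX auv auw; rewrite /recol.
have free z : [set u; z] <> [set x; y] -> a u z -> u = x \/ u = y -> c u z != g.
  move=> nE auz; have duz : dele a x y u z by rewrite /dele auz; apply/eqP.
  by case=> E; subst u; [apply: fx|apply: fy].
case: eqP => Ev; case: eqP => Ew.
- by move=> _; move: Ew; rewrite -Ev => /set2_inj [[]|[-> ->]].
- move=> E; have H : u = x \/ u = y by case/set2_inj: Ev => -[->]; auto.
  by have := free w Ew auw H; rewrite -E eqxx.
- move=> E; have H : u = x \/ u = y by case/set2_inj: Ew => -[->]; auto.
  by have := free v Ev auv H; rewrite E eqxx.
by apply: pc => //; rewrite /dele ?auv ?auw; apply/eqP.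
Qed.

Lemma proper_perm c X (p : {perm 'I_k}) : proper_at a X c ->
  proper_at a X (fun x y => p (c x y)).
Proof. by move=> pc x y z xX axy axz /perm_inj; apply: pc. Qed.

Lemma glue_colour c1 c2 X : sym_col c1 -> sym_col c2 ->
  proper_at a X c1 -> proper_at a (~: X) c2 ->
  (forall x y, x \in X -> y \notin X -> a x y -> c1 x y = c2 x y) -> kcol k a.
Proof.
move=> s1 s2 p1 p2 agree.
exists (fun x y => if (x \in X) || (y \in X) then c1 x y else c2 x y).
  by move=> x y; rewrite orbC s1 s2.
move=> x y z _ axy axz; have [xX|xX] := boolP (x \in X); first exact: p1.
have E t : a x t -> (if t \in X then c1 x t else c2 x t) = c2 x t.
  by case: ifP => // tX axt; rewrite s1 s2 agree // sa.
by rewrite /= !E //; apply: p2 => //; rewrite inE.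
Qed.

Lemma perm_pair (i j i' j' : 'I_k) : i != j -> i' != j' ->
  exists p : {perm 'I_k}, p i = i' /\ p j = j'.
Proof.
move=> nij nij'; pose q := tperm i i'; have qi : q i = i' by rewrite tpermL.
have nq : q j != i' by rewrite -qi (inj_eq perm_inj) eq_sym.
exists (q * tperm (q j) j')%g; rewrite !permM qi tpermL; split=> //.
by rewrite tpermD // eq_sym.
Qed.

Definition bicol c g d : rel V := fun x y => a x y && ((c x y == g) || (c x y == d)).

(** The colours are exchanged at the vertices connected to [x0] by edges of colour [g] or [d]. An
    edge leaving this set has neither colour, so its two ends agree about its new colour. *)
Lemma kempe c g d x0 : sym_col c -> proper_at a setT c ->
  exists c', [/\ sym_col c', proper_at a setT c' & forall x y, a x y ->
    c' x y = if connect (bicol c g d) x0 x then tperm g d (c x y) else c x y].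
Proof.
move=> sc pc; set r := bicol c g d; pose K x := connect r x0 x.
have sr : symmetric r by move=> x y; rewrite /r /bicol sa sc.
pose c' x y := if K x || K y then tperm g d (c x y) else c x y.
have c'E x y : a x y -> c' x y = if K x then tperm g d (c x y) else c x y.
  rewrite /c' => axy; case Kx: (K x) => //=; case Ky: (K y) => //.
  rewrite tpermD // eq_sym; apply: contraFneq Kx => E.
    by apply: connect_trans Ky (connect1 _); rewrite sr /r /bicol axy E eqxx.
  by apply: connect_trans Ky (connect1 _); rewrite sr /r /bicol axy E eqxx orbT.
exists c'; split=> //; first by move=> x y; rewrite /c' orbC sc.
move=> x y z xT axy axz; rewrite !c'E //; case: ifP => _; last exact: pc.
by move/perm_inj; apply: pc.
Qed.

End Recolour.

Section Ends.
Variables (V : finType) (r : rel V).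
Hypotheses (sr : symmetric r) (r2 : forall x, rdeg r x <= 2).

Lemma path_pred x p v : path r x p -> v \in p -> exists2 u, u \in x :: p & r v u.
Proof.
move=> + vp; case/splitPr: vp => p1 p2; rewrite cat_path => /andP[_ /andP[ru _]].
exists (last x p1); last by rewrite sr.
by rewrite -cat_cons mem_cat mem_last.
Qed.

Lemma path_succ x p v : path r x p -> uniq (x :: p) -> v \in p -> v != last x p ->
  exists u w, [/\ u \in x :: p, w \in x :: p, u != w, r v u & r v w].
Proof.
move=> + + vp; case/splitPr: vp => p1 [|s p2].
  by rewrite last_cat /= eqxx.
rewrite cat_path => /andP[_ /and3P[ru rs _]].
rewrite -cat_cons cat_uniq => /and3P[_ ho _] _.
exists (last x p1), s; split=> //.
- by rewrite mem_cat mem_last.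
- by rewrite mem_cat !inE eqxx !orbT.
- apply: contraNneq ho => <-; apply/hasP; exists (last x p1) => //=.
    by rewrite !inE eqxx orbT.
  exact: mem_last.
by rewrite sr.
Qed.

Lemma rdeg_le1 x y z : rdeg r x <= 1 -> r x y -> r x z -> y = z.
Proof. by move=> /card_le1_eqP H xy xz; apply: H; rewrite inE. Qed.

Lemma rdeg_le2 x y z w : r x y -> r x z -> y != z -> r x w -> w = y \/ w = z.
Proof.
move=> xy xz nyz xw; have [->|nwy] := eqVneq w y; first by left.
have [->|nwz] := eqVneq w z; first by right.
have := r2 x; rewrite leqNgt => /negP; case; apply/card_gt2P.
exists w, y, z; split; first by rewrite !inE.
by rewrite nwy nyz eq_sym nwz.
Qed.

(* A path joining two vertices of degree one is a whole component. *)
Lemma connect_ends w t u : rdeg r w <= 1 -> rdeg r t <= 1 -> rdeg r u <= 1 ->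
  w != t -> w != u -> t != u -> connect r w t -> connect r w u -> False.
Proof.
move=> w1 t1 u1 nwt nwu ntu /connectP[p0 pp0 Et].
case: (shortenP pp0) Et => p pp up _ Et {p0 pp0}.
have clo x y : r x y -> x \in w :: p -> y \in w :: p.
  move=> rxy; rewrite inE => /orP[/eqP Ex|xp].
    subst x; case: p pp up Et => [|s p] /=; first by move=> _ _ E; rewrite E eqxx in nwt.
    by case/andP=> ws _ _ _; rewrite (rdeg_le1 w1 rxy ws) !inE eqxx orbT.
  have [Ex|nx] := eqVneq x (last w p).
    have [v vp rxv] := path_pred pp xp; rewrite -Et in Ex; subst x.
    by rewrite (rdeg_le1 t1 rxy rxv).
  have [v [v' [vp v'p nvv' rxv rxv']]] := path_succ pp up xp nx.
  by case: (rdeg_le2 rxv rxv' nvv' rxy) => ->.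
have cs : connect_sym r by apply: sym_connect_sym.
have cl : closed r (mem (w :: p)) by apply: intro_closed.
move=> /(closed_connect cl); rewrite !inE eqxx /= => /esym /orP[/eqP E|up'].
  by rewrite E eqxx in nwu.
have nu : u != last w p by rewrite -Et eq_sym.
have [v [v' [_ _ nvv' ruv ruv']]] := path_succ pp up up' nu.
by rewrite (rdeg_le1 u1 ruv ruv') eqxx in nvv'.
Qed.

End Ends.

Lemma third_colour (p q x y : 'I_3) : p != q -> x != p -> x != q -> y != p ->
  y != q -> x = y.
Proof.
move=> pq xp xq yp yq; apply/eqP; apply: contraT => nxy.
have : uniq [:: p; q; x; y].
  by rewrite /= !inE !negb_or pq nxy eq_sym xp eq_sym yp eq_sym xq eq_sym yq.
move/card_uniqP => /= E; have := max_card (mem [:: p; q; x; y]).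
by rewrite E card_ord.
Qed.

Section Critical.
Variable G : sgraph.
Hypothesis critG : critical3 G.
Let sa := @adj_sym G.
Let ia := @adj_irr G.
Notation h := (bdry (@adj G)).
Notation T := (deg2 G).

Lemma connected_cut (H : sgraph) (X : {set H}) : connected H -> X != set0 -> ~: X != set0 ->
  exists x y, [/\ x \in X, y \notin X & adj x y].
Proof.
move=> [_ cH] /set0Pn[x xX] /set0Pn[y]; rewrite inE => yX.
have [/existsP[u /existsP[v /and3P[]]]|/existsPn N] :=
    boolP [exists u, exists v, [&& u \in X, v \notin X & @adj H u v]].
  by exists u, v.
have cl : closed (@adj H) (mem X).
  apply: intro_closed; first exact/sym_connect_sym/adj_sym.
  move=> u v uv uX; have /existsPn/(_ v) := N u.
  by rewrite uv (uX : u \in X) andbT negbK.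
have E : (x \in X) = (y \in X) := closed_connect cl (cH x y).
by rewrite xX (negPf yX) in E.
Qed.

(** A bridge [xy] could be restored in a colouring of [G - xy]: some colour [g] is free at [x], some
    [d] at [y], and exchanging [g] and [d] on one side makes the same colour free at both ends. *)
Lemma crit_bdry_ge2 X : X != set0 -> ~: X != set0 -> 1 < h X.
Proof.
move=> X0 Y0; have [cG d3 n3 e3] := critical3_elim critG.
have [x [y [xX yX xy]]] := connected_cut cG X0 Y0.
have h0 : 0 < h X by apply/cut_gt0P; exists x, y; rewrite inE.
rewrite ltn_neqAle h0 andbT; apply/eqP => h1; apply: n3.
have only u v : u \in X -> v \notin X -> adj u v -> u = x /\ v = y.
  move=> uX vX uv; have : (u, v) = (x, y).
    have := eq_leq (esym h1); rewrite /bdry cut_pairs => /card_le1_eqP; apply.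
      by rewrite !inE /= ?uX ?vX ?uv ?xX ?yX ?xy.
    by rewrite !inE /= ?uX ?vX ?uv ?xX ?yX ?xy.
  by case.
have [c sc pc] := e3 x y xy.
have dx z w : adj z w -> rdeg (dele (@adj G) z w) z < 3.
  by move=> zw; rewrite (rdeg_dele_in zw); apply: d3.
have [g _ fg] : exists2 g, g \notin set0 & forall z, dele (@adj G) x y x z -> c x z != g.
  by apply: free_colour; rewrite cards0 addn0 dx.
have E : dele (@adj G) x y =2 dele (@adj G) y x.
  by move=> u v; rewrite /dele [[set x; y]]setUC.
have [d _ fd] : exists2 d, d \notin set0 & forall z, dele (@adj G) x y y z -> c y z != d.
  apply: free_colour; rewrite cards0 addn0.
  suff -> : rdeg (dele (@adj G) x y) y = rdeg (dele (@adj G) y x) y by rewrite dx // adj_sym.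
  by apply: eq_card => z; rewrite !inE E.
have pX Z : proper_at (dele (@adj G) x y) Z c by move=> u v w _; apply: pc.
apply: (glue_colour sa (X := X) (c1 := recol c x y g)
   (c2 := fun u v => tperm g d (recol c x y d u v))).
- exact: recol_sym.
- by move=> u v; rewrite recol_sym.
- by apply: recol_proper => // yX'; rewrite yX' in yX.
- apply: (@proper_perm _ _ _ _ _ (tperm g d)); apply: recol_proper => //.
  by rewrite inE xX.
by move=> u v uX vX /(only _ _ uX vX) [-> ->]; rewrite !recol_in tpermR.
Qed.

Lemma crit_card_gt1 : 1 < #|G|.
Proof.
have [_ mG _ _] := critG.
have [x dx] : exists x : G, deg x != 0.
  apply/existsP; apply: contraT; rewrite negb_exists => /forallP H.
  have : max_deg G <= 0 by apply/bigmax_leqP => x _; have := H x; rewrite negbK => /eqP ->.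
  by rewrite mG.
move: dx; rewrite -lt0n => /card_gt0P[y]; rewrite inE => xy.
rewrite -cardsT; apply: (@card_gt1 _ _ x y); rewrite ?inE //.
by apply: contraTneq xy => ->; rewrite adj_irr.
Qed.

Lemma crit_deg (x : G) : rdeg (@adj G) x + (x \in T) = 3.
Proof.
have [_ d3 _ _] := critical3_elim critG.
have d2 : 1 < rdeg (@adj G) x.
  rewrite (rdeg_splitD1 sa ia (set11 x)) setDv cut0r add0n; apply: crit_bdry_ge2.
    by apply/set0Pn; exists x; rewrite inE.
  by rewrite -card_gt0; have := cardsC [set x]; rewrite cards1; have := crit_card_gt1; clear; lia.
have := d3 x; rewrite inE /deg -/(rdeg (@adj G) x); move: d2; clear; lia.
Qed.

Lemma crit_deg2 (x : G) : x \in T -> rdeg (@adj G) x = 2.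
Proof. by move=> xT; have := crit_deg x; rewrite xT addn1 => -[]. Qed.

Lemma crit_deg3 (x : G) : x \notin T -> rdeg (@adj G) x = 3.
Proof. by move=> /negPf xT; have := crit_deg x; rewrite xT addn0. Qed.

Lemma no_free (x y : G) (c : G -> G -> 'I_3) g : adj x y -> sym_col c ->
  proper_at (dele (@adj G) x y) setT c ->
  (forall z, dele (@adj G) x y x z -> c x z != g) ->
  (forall z, dele (@adj G) x y y z -> c y z != g) -> False.
Proof.
have [_ _ n3 _] := critical3_elim critG.
move=> xy sc pc fx fy; apply: n3; exists (recol c x y g); first exact: recol_sym.
exact: recol_proper.
Qed.

(** In [G - tu] only one edge is left at each end, so at most two of the three colours are blocked
    for [tu]. *)
Lemma crit_indep (t u : G) : t \in T -> u \in T -> ~~ adj t u.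
Proof.
move=> tT uT; apply/negP => tu; have [_ _ _ e3] := critical3_elim critG.
have [c sc pc] := e3 t u tu.
pose B := [set c u z | z in [set z | dele (@adj G) t u u z]].
have E : dele (@adj G) t u =2 dele (@adj G) u t.
  by move=> v w; rewrite /dele [[set t; u]]setUC.
have [g gB fg] : exists2 g, g \notin B & forall z, dele (@adj G) t u t z -> c t z != g.
  apply: free_colour; have := rdeg_dele_in tu; rewrite crit_deg2 // => -[->].
  rewrite add1n !ltnS.
  apply: leq_trans (leq_imset_card _ _) _.
  have ut : adj u t by rewrite adj_sym.
  have := rdeg_dele_in ut; rewrite crit_deg2 // /rdeg => -[<-].
  by apply: eq_leq; apply: eq_card => z; rewrite !inE E.
apply: (no_free tu sc pc fg) => z uz; apply: contraNneq gB => <-.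
by apply/imsetP; exists z; rewrite ?inE.
Qed.

(* Colour [G] without the edge [w t]. The colour missing at [w] is the one of the
   edge at [t] and of the other edge at [u], while a third colour [q] occurs at [w]
   but not at [t] and [u]. So [w], [t] and [u] are all ends of paths in two
   colours, and a Kempe change at [t] or at [u] allows to colour [w t]. *)
Lemma crit_nbr (w t u : G) : t \in T -> u \in T -> adj w t -> adj w u -> t = u.
Proof.
move=> tT uT wt wu; apply/eqP; apply: contraT => ntu; exfalso.
have [_ _ _ e3] := critical3_elim critG.
have wT : w \notin T by apply: contraL wt => wT; apply: crit_indep.
have other x y : x \in T -> adj x y -> exists z, [/\ adj x z, z != y &
    forall v, adj x v -> v = y \/ v = z].
  move=> xT xy; have := crit_deg2 xT; rewrite /rdeg (cardsD1 y) inE xy => -[].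
  move=> /eqP/cards1P[z /setP Ez]; have := Ez z; rewrite !inE eqxx => /andP[nzy xz].
  exists z; split=> // v xv; have := Ez v; rewrite !inE xv andbT.
  by case: (eqVneq v y) => [|_ /esym/eqP]; auto.
have [tw uw] : adj t w /\ adj u w by rewrite !(adj_sym _ w).
have [y1 [ty1 ny1 ny1']] := other t w tT tw.
have [y2 [uy2 ny2 ny2']] := other u w uT uw.
have [z [wz nzt nzu]] : exists z, [/\ adj w z, z != t & z != u].
  have nut : u != t by rewrite eq_sym.
  have := crit_deg3 wT; rewrite /rdeg (cardsD1 t) inE wt (cardsD1 u) !inE nut wu.
  move=> [] /eqP/cards1P[z /setP/(_ z)]; rewrite !inE eqxx.
  by case/and3P=> ? ? ?; exists z.
have nbrw v : adj w v -> [\/ v = t, v = u | v = z].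
  move=> wv; have [->|n1] := eqVneq v t; first by constructor 1.
  have [->|n2] := eqVneq v u; first by constructor 2.
  have [->|n3] := eqVneq v z; first by constructor 3.
  have : [set v; t; u; z] \subset [set x | adj w x].
    by rewrite !subUset !sub1set !inE wv wt wu wz.
  move/subset_leq_card; rewrite -/(rdeg (@adj G) w) crit_deg3 // -setUA.
  by rewrite -!setUA !cardsU1 !inE !negb_or n1 n2 n3 ntu cards1 eq_sym nzt eq_sym nzu.
have ne (x y : G) : adj x y -> x != y by apply: contraTneq => ->; rewrite adj_irr.
set b := dele (@adj G) w t.
have sb : symmetric b by exact: dele_sym.
have bE x y : b x y = adj x y && ([set x; y] != [set w; t]) by [].
have nset x y : x != w -> x != t -> [set x; y] != [set w; t].
  move=> n1 n2; apply/eqP => /set2_inj [] [E _]; by rewrite E eqxx in n1 n2.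
have ntw := ne _ _ tw; have nuw := ne _ _ uw.
have nut : u != t by rewrite eq_sym.
have b1 v : b t v -> v = y1.
  rewrite bE => /andP[/ny1' [->|//]]; by rewrite setUC eqxx.
have b2 v : b w v -> v = u \/ v = z.
  by rewrite bE => /andP[/nbrw [->|->|->]]; rewrite ?eqxx; auto.
have b3 : b t y1 by rewrite bE ty1 setUC nset // eq_sym ne.
have b4 : b w u by rewrite bE wu setUC nset.
have b5 : b w z by rewrite bE wz setUC nset // eq_sym ne.
have b6 : b u y2 by rewrite bE uy2 nset.
have b7 : b u w by rewrite sb.
(* Some colour is missing at [w], where two edges are left. It must occur at [t], hence on [t y1],
   the only edge left there. *)
have Q1 (c : G -> G -> 'I_3) : sym_col c -> proper_at b setT c -> c t y1 != c w u /\ c t y1 != c w z.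
  move=> sc pc; have [g gB _] : exists2 g, g \notin [set c w u; c w z] &
      forall v, (fun _ _ : G => false) w v -> c w v != g.
    apply: (@free_colour _ (fun _ _ => false) 3 c w); rewrite /rdeg.
    have -> : [set y : G | false] = set0 by apply/setP => y; rewrite !inE.
    by rewrite cards0 ltnS card_set2_le.
  move: gB; rewrite !inE negb_or => /andP[g1 g2].
  have ng : c t y1 = g.
    apply/eqP; apply: contraT => n; exfalso.
    apply: (no_free wt sc pc (g := g)) => v; last by move/b1 => ->.
    by case/b2 => ->; rewrite eq_sym.
  by rewrite ng.
(* Otherwise the colour of [t y1] is free at [w] and at [u]; recolouring [w u] with it contradicts
   [Q1]. *)
have Q2 (c : G -> G -> 'I_3) : sym_col c -> proper_at b setT c -> c u y2 != c w z.
  move=> sc pc; apply/eqP => E; have [q1 q2] := Q1 c sc pc.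
  pose c' := recol c w u (c t y1).
  have sc' : sym_col c' by apply: recol_sym.
  have pc' : proper_at b setT c'.
    apply: recol_proper => //.
    - by move=> p q s _ /dele_sub bpq /dele_sub bps; apply: pc.
    - move=> _ v /andP[/b2 [->|->]]; first by rewrite eqxx.
      by move=> _; rewrite eq_sym.
    - move=> _ v /andP[]; rewrite bE => /andP[/ny2' [->|->] _].
        by rewrite setUC eqxx.
      by move=> _; rewrite E eq_sym.
  by have [+ _] := Q1 c' sc' pc'; rewrite /c' recol_in recol_out // eqxx.
have [c sc pc] := e3 w t wt.
have [q1 q2] := Q1 c sc pc; have q3 := Q2 c sc pc.
have q4 : c w u != c w z by apply/eqP => /(pc w u z (in_setT _) b4 b5) E; rewrite E eqxx in nzu.
have q5 : c u y2 != c w u.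
  rewrite (sc w u); apply/eqP => /(pc u y2 w (in_setT _) b6 b7) E.
  by rewrite E eqxx in ny2.
have Eg : c t y1 = c u y2 by apply: (third_colour q4).
set q := c w z in q2 q3 q4; set g := c t y1 in q1 q2 Eg.
pose r := bicol b c q g.
have sr : symmetric r by move=> x y; rewrite /r /bicol sb sc.
have r2 x : rdeg r x <= 2.
  apply: leq_trans (card_set2_le q g).
  have inj : {in [set y | r x y] &, injective (c x)}.
    by move=> y y'; rewrite !inE => /andP[xy _] /andP[xy' _]; apply: pc.
  rewrite /rdeg -(card_in_imset inj); apply: subset_leq_card.
  by apply/subsetP => d /imsetP[y]; rewrite !inE => /andP[_ e] ->.
have le1 x y : (forall v, r x v -> v = y) -> rdeg r x <= 1.
  by move=> H; apply/card_le1_eqP => v v'; rewrite !inE => /H -> /H ->.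
have rt : rdeg r t <= 1 by apply: (le1 t y1) => v /andP[/b1].
have rw : rdeg r w <= 1.
  apply: (le1 w z) => v /andP[/b2 [->|->] //]; rewrite (negPf q4) eq_sym.
  by rewrite (negPf q1).
have ru : rdeg r u <= 1.
  apply: (le1 u y2) => v /andP[]; rewrite bE => /andP[/ny2' [->|->] _] //.
  by rewrite sc (negPf q4) eq_sym (negPf q1).
have cs : connect_sym r by apply: sym_connect_sym.
have cwt : connect r w t.
  rewrite cs; apply: contraT => nc.
  have [c' [sc' pc' c'E]] := kempe sb q g t sc pc.
  have [_] := Q1 c' sc' pc'; rewrite !c'E // -/r connect0 (negPf nc).
  by rewrite -/g tpermR eqxx.
have cwu : connect r w u.
  rewrite cs; apply: contraT => nc.
  have [c' [sc' pc' c'E]] := kempe sb q g u sc pc.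
  have := Q2 c' sc' pc'; rewrite !c'E // -/r connect0 (negPf nc).
  by rewrite -Eg tpermR eqxx.
by apply: (connect_ends sr r2 rw rt ru _ _ ntu cwt cwu); rewrite eq_sym.
Qed.

End Critical.

(** Colour [g] induces a perfect matching of [A], that is, an involution without fixed points. *)
Lemma matched_even (V : finType) (b : rel V) k (c : V -> V -> 'I_k) (A : {set V}) g :
  symmetric b -> irreflexive b -> sym_col c -> proper_at b A c ->
  (forall v, v \in A -> exists u, [/\ u \in A, b v u & c v u = g]) -> ~~ odd #|A|.
Proof.
move=> sb ib sc pc mt.
pose f v := odflt v [pick u | [&& u \in A, b v u & c v u == g]].
have fE v u : v \in A -> b v u -> c v u = g -> f v = u.
  move=> vA vu cvu; rewrite /f; case: pickP => [u' /and3P[_ vu' /eqP E]|N] /=.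
    by apply: (pc v) => //; rewrite E.
  have [w [wA vw cvw]] := mt v vA.
  by have := N w; rewrite wA vw cvw eqxx.
apply: (@card_invol_even _ f) => v vA; have [u [uA vu cvu]] := mt v vA.
rewrite (fE v u) //; split=> //; first by apply: fE; rewrite // 1?sb // sc.
by apply: contraTneq vu => ->; rewrite ib.
Qed.

(** Pigeonhole with three colours; [B] collects colours known to be absent at [v]. *)
Lemma all_colours (V : finType) (b : rel V) (c : V -> V -> 'I_3) v (B : {set 'I_3}) d :
  (forall y z, b v y -> b v z -> c v y = c v z -> y = z) ->
  (forall y, b v y -> c v y \notin B) -> 2 < rdeg b v + #|B| -> d \notin B ->
  exists2 u, b v u & c v u = d.
Proof.
move=> inj nB lt dB.
have [/existsP[u /andP[vu /eqP E]]|/existsPn N] := boolP [exists u, b v u && (c v u == d)].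
  by exists u.
exfalso; pose C := [set c v z | z in [set z | b v z]].
have cC : #|C| = rdeg b v by apply: card_in_imset => y z; rewrite !inE; apply: inj.
have dis : [disjoint C & B].
  apply/pred0P => e /=; apply/negP => /andP[/imsetP[z]]; rewrite inE => vz ->.
  by apply/negP/nB.
have : C :|: B \subset [set~ d].
  apply/subsetP => e; rewrite !inE => /orP[/imsetP[z]|eB].
    by rewrite inE => vz ->; have := N z; rewrite vz.
  by apply: contraNneq dB => <-.
move/subset_leq_card; rewrite cardsC1 card_ord cardsU (disjoint_setI0 dis) cards0 subn0 cC.
by rewrite leqNgt lt.
Qed.

Lemma handshake (G : sgraph) : \sum_(x : G) deg x = 2 * #|edges G|.
Proof.
have -> : \sum_(x : G) deg x = cut (@adj G) setT setT.
  rewrite cut_set1_sum; apply: eq_big => [x|x _]; first by rewrite inE.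
  by rewrite -rdeg_cut.
rewrite cut_pairs -sum1_card mulnC -sum_nat_const.
rewrite (partition_big (fun p : G * G => [set p.1; p.2]) (mem (edges G))) /=; last first.
  by move=> [x y]; rewrite !inE /= => xy; apply/existsP; exists x; apply/existsP; exists y; rewrite xy eqxx.
apply: eq_bigr => e /edgesP[x [y [xy ->]]]; rewrite sum1_card.
have nxy : x != y by apply: contraTneq xy => ->; rewrite adj_irr.
rewrite -[RHS](_ : #|[set (x, y); (y, x)]| = 2); last by rewrite cards2 xpair_eqE negb_and nxy.
apply: eq_card => -[u v]; rewrite !inE /=; apply/andP/orP.
  by case=> _ /eqP /= /set2_inj [[-> ->]|[-> ->]]; rewrite eqxx; auto.
case=> /eqP [-> ->]; rewrite !inE /=; first by rewrite xy eqxx.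
by rewrite adj_sym xy setUC eqxx.
Qed.

(** * Overfull subgraphs and the number of vertices of degree 2 *)

Section Overfull.
Variable G : sgraph.
Hypothesis critG : critical3 G.
Notation T := (deg2 G).

Lemma crit_deg_sum (X : {set G}) :
  \sum_(x in X) rdeg (@adj G) x + #|X :&: T| = 3 * #|X|.
Proof.
rewrite -sum1_card big_mkcond -[in RHS]sum1_card big_distrr /= [X in _ + X]big_mkcond /=.
rewrite [RHS]big_mkcond -big_split; apply: eq_bigr => x _ /=; rewrite !inE.
by case: (x \in X); rewrite //= muln1 -(crit_deg critG x) inE; case: (_ == 2).
Qed.

Lemma crit_handshake : 2 * #|edges G| + #|T| = 3 * #|G|.
Proof.
rewrite -handshake -cardsT -crit_deg_sum setTI; congr (_ + _).
by apply: eq_big => x; rewrite // inE.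
Qed.

(** An overfull subgraph on [Y] needs at least 3 [#|Y|] - 1 edge ends inside [Y]. But at least two
    of the possible 3 [#|Y|] are lost: to the boundary if [Y] is a proper subset, to [T] if it is
    everything. *)
Lemma crit_nontrivial : 1 < #|T| -> nontrivial_critical3 G.
Proof.
move=> T2; split=> // -[H [f injf hf] [_ ov]].
pose Y := f @: [set: H].
have cY : #|Y| = #|H| by rewrite card_imset // cardsT.
have le : 2 * #|edges H| <= cut (@adj G) Y Y.
  rewrite -handshake cut_set1_sum /Y big_imset /=; last by move=> x y _ _; apply: injf.
  have -> : \sum_(x : H) deg x = \sum_(x in [set: H]) deg x.
    by apply: eq_bigl => x; rewrite inE.
  apply: leq_sum => x _; rewrite cut1 /deg -(card_imset _ injf).
  apply: subset_leq_card; apply/subsetP => z /imsetP[y xy ->].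
  by rewrite inE imset_f ?inE // hf //; move: xy; rewrite inE.
have := rdeg_sum (@adj_sym G) Y; have := crit_deg_sum Y => eY eY'.
have [Y0|Yn0] := eqVneq Y set0.
  by move: le ov; rewrite Y0 cut0r; clear; lia.
have [YT|YnT] := eqVneq (~: Y) set0.
  have EY : Y = setT by rewrite -[Y]setCK YT setC0.
  by move: eY eY' le ov T2; rewrite EY setTI -cY EY; clear; lia.
have := crit_bdry_ge2 critG Yn0 YnT.
by move: eY eY' le ov; rewrite -cY; clear; lia.
Qed.

(** With one vertex of degree 2, [G] itself is overfull by counting. If [G] were cubic, colour
    [G - xy]: a colour free at [x] occurs at [y] and at all other vertices, so it matches all
    vertices but [x], and the order is odd, impossible for a cubic graph. *)
Lemma nontrivial_deg2 : ~ trivial3 G -> 1 < #|T|.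
Proof.
move=> ntG; have [cG d3 n3 e3] := critical3_elim critG.
have sa := @adj_sym G; have ia := @adj_irr G.
have hs := crit_handshake.
have [|T1] := ltnP 1 #|T|; first by [].
exfalso; case: (ltngtP #|T| 1) T1 => // [T0|T1] _; last first.
  apply: ntG; exists G; first by exists id.
  split; first by case: critG.
  by move: hs; rewrite T1; clear; lia.
move: T0; rewrite ltnS leqn0 cards_eq0 => /eqP T0.
have dx (z : G) : rdeg (@adj G) z = 3 by apply: (crit_deg3 critG); rewrite T0 inE.
have /card_gt0P[x _] := ltnW (crit_card_gt1 critG).
have [y xy] : exists y, adj x y.
  have : 0 < rdeg (@adj G) x by rewrite dx.
  by case/card_gt0P => y; rewrite inE; exists y.
have [c sc pc] := e3 x y xy; set b := dele (@adj G) x y in pc.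
have sb : symmetric b by apply: dele_sym.
have ib : irreflexive b by move=> z; rewrite /b /dele ia.
have [g _ fg] : exists2 g, g \notin set0 & forall z, b x z -> c x z != g.
  by apply: free_colour; rewrite cards0 addn0 (rdeg_dele_in xy) dx.
have [y1 yy1 cy1] : exists2 y1, b y y1 & c y y1 = g.
  have [/existsP[z /andP[yz /eqP E]]|/existsPn N] := boolP [exists z, b y z && (c y z == g)].
    by exists z.
  exfalso; apply: (no_free critG xy sc pc fg) => z yz.
  by have := N z; rewrite -/b in yz *; rewrite yz.
have ev : ~~ odd #|[set~ x]|.
  apply: (matched_even (g := g) sb ib sc) => [u v w _|v]; first exact: pc.
  rewrite !inE => nvx; suff [u vu cvu] : exists2 u, b v u & c v u = g.
    exists u; split=> //; rewrite !inE; apply: contraTneq vu => ux; subst u.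
    apply/negP => vx; have xv : b x v by rewrite sb.
    by have := fg v xv; rewrite sc cvu eqxx.
  have [->|nvy] := eqVneq v y; first by exists y1.
  apply: (all_colours (B := set0)); rewrite ?inE //.
  - by move=> p q; apply: pc.
  - by move=> z; rewrite inE.
  by rewrite cards0 /b rdeg_dele_out // dx.
move: ev hs; rewrite cardsC1 T0 cards0.
by have := crit_card_gt1 critG; clear; lia.
Qed.

End Overfull.

(** * Contracting one side of a cut *)

Lemma iso_sym G H : iso G H -> iso H G.
Proof.
case=> f [g fK gK] hf; exists g; first by exists f.
by move=> x y; rewrite -hf !gK.
Qed.

Lemma iso_glue (G A B : sgraph) (r : A -> B -> bool) (iA : A -> G) (iB : B -> G) :
  injective iA -> injective iB -> (forall x y, iA x != iB y) ->
  (forall z, (exists x, z = iA x) \/ (exists y, z = iB y)) ->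
  (forall x y, adj (iA x) (iA y) = adj x y) ->
  (forall x y, adj (iB x) (iB y) = adj x y) ->
  (forall x y, adj (iA x) (iB y) = r x y) -> iso G (glue r).
Proof.
move=> injA injB dis cov hA hB hr; apply: iso_sym.
pose f (u : glue r) := match u with inl x => iA x | inr y => iB y end.
exists f; last first.
  by move=> [x|x] [y|y] /=; rewrite ?hA ?hB ?hr // adj_sym hr.
apply: inj_card_bij.
  move=> [x|x] [y|y] /= => [/injA -> //|E|E|/injB -> //].
    by have := dis x y; rewrite E eqxx.
  by have := dis y x; rewrite E eqxx.
rewrite -[leqRHS](@card_imset _ _ f) //.
  by apply: subset_leq_card; apply/subsetP => z _; apply/imsetP;
   case: (cov z) => -[x ->]; [exists (inl x)|exists (inr x)].
move=> [x|x] [y|y] /= => [/injA -> //|E|E|/injB -> //].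
  by have := dis x y; rewrite E eqxx.
by have := dis y x; rewrite E eqxx.
Qed.

Section Contract.
Variables (V : finType) (a : rel V) (X : {set V}).
Notation VX := {x | x \in X}.

Definition sub_rel : rel VX := fun u v => a (val u) (val v).

Definition attach : {set VX} := [set u | [exists y, (y \notin X) && a (val u) y]].

(* [None] is the vertex to which the complement of [X] is contracted. *)
Definition contract_rel := opt_rel sub_rel attach.

Lemma attachP (u : VX) :
  reflect (exists2 y, y \notin X & a (val u) y) (u \in attach).
Proof.
rewrite inE; apply: (iffP existsP) => [[y /andP[]]|[y yX uy]]; first by exists y.
by exists y; rewrite yX.
Qed.

Definition proj (x : V) : option VX := insub x.

Lemma proj_in x : x \in X -> exists2 u : VX, proj x = Some u & val u = x.
Proof. by move=> xX; rewrite /proj; case: insubP => [u _ <-|/negP //]; exists u. Qed.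

Lemma proj_out x : x \notin X -> proj x = None.
Proof. by move=> xX; apply: insubN. Qed.

Lemma proj_val (u : VX) : proj (val u) = Some u.
Proof. exact: valK. Qed.

Lemma proj_inj x y : x \in X -> proj x = proj y -> x = y.
Proof.
move=> /proj_in [u -> <-]; rewrite /proj; case: insubP => // v _ <- [->] //.
Qed.

Lemma contract_adj x y : symmetric a -> (x \in X) || (y \in X) -> a x y ->
  contract_rel (proj x) (proj y).
Proof.
move=> sa; have [/proj_in[u -> <-]|xX] := boolP (x \in X);
  have [/proj_in[v -> <-]|yX] := boolP (y \in X) => //= _ axy.
- by rewrite (proj_out yX); apply/attachP; exists y.
- by rewrite (proj_out xX); apply/attachP; exists x; rewrite // sa.
Qed.

(** No vertex of [X] has two edges across the cut, so contracting the other side creates no parallel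
    edges and preserves degrees in [X]. *)
Definition thin := forall x y z, x \in X -> y \notin X -> z \notin X ->
  a x y -> a x z -> y = z.

(** Ends in [X] are compared instead of edges. Together with [thin] this says that the cut edges
    have different colours, as they must at a contracted vertex. *)
Definition rainbow k (c : V -> V -> 'I_k) := forall x x' y y',
  x \in X -> x' \in X -> y \notin X -> y' \notin X -> a x y -> a x' y' ->
  c x y = c x' y' -> x = x'.

Hypothesis sa : symmetric a.

Lemma contract_colour k : thin -> kcol k contract_rel ->
  exists c : V -> V -> 'I_k, [/\ sym_col c, proper_at a X c & rainbow c].
Proof.
move=> th [c sc pc]; exists (fun x y => c (proj x) (proj y)); split.
- by move=> x y; apply: sc.
- move=> x y z xX axy axz E.
  have Epr : proj y = proj z.
    by apply: (pc (proj x)) => //; apply: contract_adj; rewrite ?xX.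
  have [yX|yX] := boolP (y \in X); first exact: proj_inj.
  have [zX|zX] := boolP (z \in X); first by apply/esym/proj_inj.
  exact: (th x).
move=> x x' y y' xX x'X yX y'X axy ax'y' E; apply: proj_inj => //.
apply: (pc None) => //.
- by rewrite -(proj_out yX); apply: contract_adj; rewrite ?xX ?orbT // sa.
- by rewrite -(proj_out y'X); apply: contract_adj; rewrite ?x'X ?orbT // sa.
by move: E; rewrite (proj_out yX) (proj_out y'X) !(sc None).
Qed.

Lemma colour_contract k (c : V -> V -> 'I_k.+1) : sym_col c -> proper_at a X c ->
  rainbow c -> kcol k.+1 contract_rel.
Proof.
move=> sc pc rc; pose out (x : V) := odflt x [pick y | (y \notin X) && a x y].
have outP (u : VX) : u \in attach -> out (val u) \notin X /\ a (val u) (out (val u)).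
  case/attachP => y yX uy; rewrite /out; case: pickP => [z /andP[]//|/(_ y)].
  by rewrite yX uy.
pose c' (u v : option VX) := match u, v with
  | Some x, Some y => c (val x) (val y)
  | Some x, None | None, Some x => c (val x) (out (val x))
  | None, None => ord0 end.
exists c' => [[x|] [y|] //=|[x|] [y|] [z|] _ //=].
- by move=> xy xz /(pc _ _ _ (valP x) xy xz) /val_inj ->.
- move=> xy /outP[oX xo] /(pc _ _ _ (valP x) xy xo) E.
  by rewrite -E (valP y) in oX.
- move=> /outP[oX xo] xy /(pc _ _ _ (valP x) xo xy) E.
  by rewrite E (valP z) in oX.
move=> /outP[oy yo] /outP[oz zo] E; congr Some; apply: val_inj.
exact: rc (valP y) (valP z) oy oz yo zo E.
Qed.

Lemma sub_rel_deg (u : VX) : rdeg sub_rel u = cut a [set val u] X.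
Proof.
rewrite cut1 /rdeg -(card_imset _ val_inj); apply: eq_card => y.
apply/imsetP/idP => [[v]|]; rewrite !inE; first by move=> uv ->; rewrite (valP v).
by case/andP=> yX uy; exists (exist _ y yX); rewrite // inE.
Qed.

Lemma thin_cut1 x : thin -> x \in X -> cut a [set x] (~: X) <= 1.
Proof.
move=> th xX; rewrite cut1; apply/card_le1_eqP => y z; rewrite !inE.
by move=> /andP[yX xy] /andP[zX xz]; apply: (th x).
Qed.

Lemma attach_cut (u : VX) : (u \in attach) = (0 < cut a [set val u] (~: X)).
Proof.
apply/attachP/cut_gt0P => [[y yX uy]|[_ [y [/set1P -> yX uy]]]].
  by exists (val u), y; rewrite set11 inE yX.
by exists y; rewrite // inE in yX.
Qed.

Lemma contract_deg_some (u : VX) : thin -> rdeg contract_rel (Some u) = rdeg a (val u).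
Proof.
move=> th; rewrite rdeg_opt_some (rdeg_split sa _ X) sub_rel_deg attach_cut.
by have := thin_cut1 th (valP u); case: (cut _ _ (~: X)) => [|[]].
Qed.

Lemma contract_deg_none : thin -> rdeg contract_rel None = bdry a X.
Proof.
move=> th; rewrite rdeg_opt_none /bdry cut_set1_sum -(card_imset _ val_inj) -sum1_card.
rewrite big_mkcond [RHS]big_mkcond /=; apply: eq_bigr => x _.
have [xX|xX] := boolP (x \in X); last first.
  by case: imsetP => // -[u _ E]; rewrite E (valP u) in xX.
rewrite -[x]/(val (exist (fun x => x \in X) x xX)) mem_imset; last exact: val_inj.
rewrite attach_cut; have := thin_cut1 th xX.
by rewrite /=; case: (cut _ _ (~: X)) => [|[]].
Qed.

End Contract.

Lemma connected_intro (H : sgraph) : 0 < #|H| ->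
  (forall X : {set H}, X != set0 -> ~: X != set0 ->
    exists x y, [/\ x \in X, y \notin X & adj x y]) -> connected H.
Proof.
move=> H0 cutH; split=> // x; pose X := [set y | connect adj x y].
have [XT y|XT] := eqVneq (~: X) set0.
  have : y \notin ~: X by rewrite XT inE.
  by rewrite !inE negbK.
have [|u [v []]] := cutH X _ XT; first by apply/set0Pn; exists x; rewrite inE connect0.
by rewrite !inE => xu /negP xv uv; case: xv; apply: connect_trans xu (connect1 uv).
Qed.

Lemma sub_rel_sym (V : finType) (a : rel V) (X : {set V}) :
  symmetric a -> symmetric (@sub_rel V a X).
Proof. by move=> sa u v; apply: sa. Qed.

Lemma sub_rel_irr (V : finType) (a : rel V) (X : {set V}) :
  irreflexive a -> irreflexive (@sub_rel V a X).
Proof. by move=> ia u; apply: ia. Qed.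

Definition induced (G : sgraph) (X : {set G}) : sgraph :=
  SGraph (@sub_rel_sym _ _ X (@adj_sym G)) (@sub_rel_irr _ _ X (@adj_irr G)).

Definition contract_graph (G : sgraph) (X : {set G}) : sgraph :=
  opt_graph (attach (@adj G) X) (@sub_rel_sym _ _ X (@adj_sym G))
    (@sub_rel_irr _ _ X (@adj_irr G)).

Lemma card_contract_graph (G : sgraph) (X : {set G}) :
  #|contract_graph X| = #|X|.+1.
Proof. by rewrite card_option card_sig. Qed.

Section RainbowC.
Variables (V : finType) (a : rel V) (X : {set V}) (k : nat) (c : V -> V -> 'I_k).
Hypotheses (sa : symmetric a) (sc : sym_col c).

Lemma rainbowC : thin a (~: X) -> rainbow a (~: X) c -> rainbow a X c.
Proof.
move=> th rc x x' y y' xX x'X yX y'X xy x'y' E.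
have Ey : y = y'.
  apply: (rc y y' x x'); rewrite ?inE ?xX ?x'X ?yX ?y'X // 1?sa //.
  by rewrite (sc y) (sc y').
by subst y'; apply: (th y); rewrite ?inE ?negbK // sa.
Qed.

End RainbowC.

Definition crossings (V : finType) (a : rel V) (X : {set V}) : {set V * V} :=
  [set p | [&& p.1 \in X, p.2 \in ~: X & a p.1 p.2]].

Lemma bdry_crossings (V : finType) (a : rel V) (X : {set V}) :
  bdry a X = #|crossings a X|.
Proof. by rewrite /bdry cut_pairs. Qed.

Lemma crossingsP (V : finType) (a : rel V) (X : {set V}) x y :
  reflect [/\ x \in X, y \notin X & a x y] ((x, y) \in crossings a X).
Proof. by rewrite !inE /=; apply: and3P. Qed.

(** Permute the colours so that the two sides agree on two cut edges; any further cut edge must have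
    the third colour on both sides. *)
Lemma glue_rainbow (V : finType) (a : rel V) (X : {set V}) (c1 c2 : V -> V -> 'I_3) :
  symmetric a -> thin a X -> thin a (~: X) -> 1 < bdry a X ->
  sym_col c1 -> proper_at a X c1 -> rainbow a X c1 ->
  sym_col c2 -> proper_at a (~: X) c2 -> rainbow a (~: X) c2 -> kcol 3 a.
Proof.
move=> sa th th' h2 s1 p1 r1 s2 p2 /(rainbowC sa s2 th') r2.
move: h2; rewrite bdry_crossings => /card_gt1P[[x y] [[u v] []]].
move=> /crossingsP[xX yX xy] /crossingsP[uX vX uv] npq.
have nxu : x != u.
  apply: contra npq => /eqP E; subst u.
  by rewrite (th x y v).
have n1 : c1 x y != c1 u v by apply: contraNneq nxu => /r1 ->.
have n2 : c2 x y != c2 u v by apply: contraNneq nxu => /r2 ->.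
have [p [px pu]] := perm_pair n2 n1.
apply: (glue_colour sa (X := X) (c1 := c1) (c2 := fun x y => p (c2 x y))) => //.
- by move=> w z; rewrite s2.
- exact: proper_perm.
move=> w z wX zX wz.
have [E|nwx] := eqVneq w x; first by subst w; rewrite (th x z y) // px.
have [E|nwu] := eqVneq w u; first by subst w; rewrite (th u z v) // pu.
apply: (third_colour n1).
- by apply: contraNneq nwx => /r1 ->.
- by apply: contraNneq nwu => /r1 ->.
- by rewrite -px (inj_eq perm_inj); apply: contraNneq nwx => /r2 ->.
- by rewrite -pu (inj_eq perm_inj); apply: contraNneq nwu => /r2 ->.
Qed.

Lemma proper_dele (V : finType) (a : rel V) k (c : V -> V -> 'I_k) x y (Y : {set V}) :
  proper_at (dele a x y) setT c -> x \notin Y -> y \notin Y -> proper_at a Y c.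
Proof.
move=> pc xY yY u v w uY uv uw.
have ne z : [set u; z] != [set x; y].
  by apply/eqP => /set2_inj [] [E _]; rewrite -E uY in xY yY.
by apply: pc; rewrite ?inE // /dele ?uv ?uw ne.
Qed.

(** Such a side behaves like a single vertex: any of its colourings fits, up to a permutation, a
    colouring of the graph in which it is contracted. *)
Definition always_rainbow (G : sgraph) (Y : {set G}) := forall c : G -> G -> 'I_3,
  sym_col c -> proper_at (@adj G) Y c -> rainbow (@adj G) Y c.

Section ContractCritical.
Variable G : sgraph.
Hypothesis critG : critical3 G.
Variable X : {set G}.
Hypotheses (thX : thin (@adj G) X) (thY : thin (@adj G) (~: X)).
Hypotheses (h2 : 1 < bdry (@adj G) X) (h3 : bdry (@adj G) X <= 3).
Hypothesis always : always_rainbow (~: X).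
Notation T := (deg2 G).
Let sa := @adj_sym G.
Notation K := (contract_graph X).

Lemma cut_inner_edge : exists x w, [/\ x \in X, w \in X, adj x w & w \notin T].
Proof.
move: h2; rewrite bdry_crossings => /ltnW/card_gt0P[[x y] /crossingsP[xX yX xy]].
have c2 : 1 < rdeg (@adj G) x by have := crit_deg critG x; case: (_ \in T); lia.
have [w wX xw] : exists2 w, w \in X & adj x w.
  case/card_gt1P: c2 => u [v [+ + nuv]]; rewrite !inE => xu xv.
  have [uX|uX] := boolP (u \in X); first by exists u.
  have [vX|vX] := boolP (v \in X); first by exists v.
  by rewrite (thX xX uX vX xu xv) eqxx in nuv.
have [wT|wT] := boolP (w \in T); last by exists x, w.
exists w, x; rewrite adj_sym; split=> //.
by apply: contraL xw => xT; apply: (crit_indep critG).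
Qed.

(** Deleting an edge inside [X] yields a colouring of the other side, which is rainbow there; it
    could be glued to a colouring of the contraction. *)
Lemma contract_not3 : ~ kcol 3 (@adj K).
Proof.
have [_ _ n3 e3] := critical3_elim critG.
move=> /(contract_colour sa thX) [c [sc pc rc]]; apply: n3.
have [x [w [xX wX xw _]]] := cut_inner_edge.
have [c2 s2 p2] := e3 x w xw.
have p2' : proper_at (@adj G) (~: X) c2 by apply: (proper_dele p2); rewrite inE ?xX ?wX.
exact: (glue_rainbow sa thX thY h2 sc pc rc s2 p2' (always s2 p2')).
Qed.

Lemma contract_connected : connected K.
Proof.
have [cG _ _ _] := critical3_elim critG.
apply: connected_intro; first by rewrite card_contract_graph.
have [x0 x0X] : exists x0, x0 \notin X.
  move: h2; rewrite bdry_crossings => /ltnW/card_gt0P[[x y] /crossingsP[_ yX _]].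
  by exists y.
have main (P : {set K}) : None \notin P -> P != set0 ->
    exists x y, [/\ x \in P, y \notin P & @adj K x y].
  move=> NP /set0Pn[[u|] uP]; last by rewrite uP in NP.
  pose Z := [set x : G | proj X x \in P].
  have [||x [y []]] := @connected_cut G Z cG.
  - by apply/set0Pn; exists (val u); rewrite inE proj_val.
  - by apply/set0Pn; exists x0; rewrite !inE proj_out.
  rewrite !inE => xP yP xy; exists (proj X x), (proj X y); split=> //.
  apply: contract_adj => //; apply/orP; left.
  by apply: contraT => xX; rewrite proj_out // (negPf NP) in xP.
move=> P P0 P0'; have [NP|NP] := boolP (None \in P); last exact: main.
have [|x [y []]] := main (~: P) _ P0'; first by rewrite inE NP.
by rewrite !inE negbK => xP yP xy; exists y, x; rewrite adj_sym.
Qed.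

(** An inclusion is enough to hand a colouring of [G - xy] over to the contraction with one edge
    deleted. *)
Lemma contract_dele (u v : K) : @adj K u v -> exists x y : G,
  [/\ adj x y, x \in X & subrel (dele (@adj K) u v) (@contract_rel _ (dele (@adj G) x y) X)].
Proof.
have main (x : {x | x \in X}) (v' : K) : @adj K (Some x) v' -> exists p q : G,
    [/\ adj p q, p \in X &
      subrel (dele (@adj K) (Some x) v') (@contract_rel _ (dele (@adj G) p q) X)].
  case: v' => [y|] /= xy.
    exists (val x), (val y); split=> //; first exact: valP.
    have out p z : z \notin X -> [set p; z] != [set val x; val y].
      by move=> zX; apply/eqP => /set2_inj [] [_ E]; rewrite E ?(valP x) ?(valP y) in zX.
    move=> [p|] [q|] /andP[/= pq ne] //.
    - rewrite /sub_rel /dele [adj _ _]pq; apply: contra ne => /eqP /set2_inj.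
      by move=> [] [/val_inj -> /val_inj ->]; rewrite // setUC.
    - case/attachP: pq => z zX pz; apply/attachP; exists z => //.
      by rewrite /dele pz out.
    case/attachP: pq => z zX pz; apply/attachP; exists z => //.
    by rewrite /dele pz out.
  case/attachP: xy => y yX xy; exists (val x), y; split=> //; first exact: valP.
  have out (p : {x | x \in X}) z : p != x -> [set val p; z] != [set val x; y].
    move=> npx; apply/eqP => /set2_inj [] [E _].
      by rewrite (val_inj E) eqxx in npx.
    by rewrite -E (valP p) in yX.
  move=> [p|] [q|] /andP[/= pq ne] //.
  - rewrite /sub_rel /dele [adj _ _]pq; apply: contra yX => /eqP /set2_inj.
    by move=> [] [E1 E2]; [rewrite -E2|rewrite -E1]; apply: valP.
  - case/attachP: pq => z zX pz; apply/attachP; exists z => //.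
    by rewrite /dele pz out //; apply: contraNneq ne => ->.
  case/attachP: pq => z zX pz; apply/attachP; exists z => //.
  by rewrite /dele pz out //; apply: contraNneq ne => ->; rewrite setUC.
case: u v => [x|] [y|] uv; [exact: main|exact: main| |by []].
have vu : @adj K (Some y) None by rewrite adj_sym.
have [p [q [pq pX sub]]] := main _ _ vu; exists p, q; split=> // s t.
by rewrite /dele [[set None; _]]setUC; apply: sub.
Qed.

Hypothesis cross : forall x y : G, x \in X -> y \notin X -> adj x y ->
  forall c : G -> G -> 'I_3, sym_col c -> proper_at (dele (@adj G) x y) setT c ->
  rainbow (dele (@adj G) x y) X c.

(** If an inner edge is deleted, the other side is still properly coloured and hence rainbow. For a
    deleted cut edge this is left to [cross]: of a 2-edge-cut only one edge remains, and for a
    3-edge-cut parity decides. *)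
Lemma contract_critical : critical3 K.
Proof.
have [_ d3 n3 e3] := critical3_elim critG.
have dS (u : {x | x \in X}) : deg (Some u : K) = rdeg (@adj G) (val u).
  exact: contract_deg_some.
apply: critical3_intro.
- exact: contract_connected.
- case=> [u|]; first by rewrite dS; apply: d3.
  by rewrite /deg -/(rdeg _ _) [rdeg _ _](contract_deg_none thX).
- have [_ [w [_ wX _ wT]]] := cut_inner_edge.
  by exists (Some (exist _ w wX)); rewrite dS /= (crit_deg3 critG).
- exact: contract_not3.
move=> u v /contract_dele [x [y [xy xX sub]]]; apply: (kcol_sub sub).
have [c sc pc] := e3 x y xy; have sd := dele_sym x y sa.
apply: (colour_contract sc); first by move=> p q r _; apply: pc; rewrite inE.
have [yX|yX] := boolP (y \in X); last exact: cross.
have pY : proper_at (@adj G) (~: X) c by apply: (proper_dele pc); rewrite inE ?xX ?yX.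
have rX := rainbowC sa sc thY (always sc pY).
by move=> p p' q q' pX p'X qX q'X /dele_sub pq /dele_sub pq'; apply: rX.
Qed.

Lemma contract_deg2 : #|deg2 K| = #|X :&: T| + (bdry (@adj G) X == 2).
Proof.
rewrite (cardsD1 None) addnC; congr (_ + _); last first.
  by rewrite inE /deg -/(rdeg _ _) [rdeg _ _](contract_deg_none thX).
pose U : {set {x | x \in X}} := [set u | Some u \in deg2 K].
have UE u : (u \in U) = (val u \in T).
  by rewrite !inE /deg -!/(rdeg _ _) [rdeg _ (Some u)](contract_deg_some sa u thX).
have -> : deg2 K :\ None = Some @: U.
  apply/setP => -[u|]; first by rewrite mem_some !inE.
  by rewrite !inE; apply/esym/imsetP => -[].
have -> : X :&: T = val @: U.
  apply/setP => x; rewrite inE; apply/andP/imsetP => [[xX xT]|[u uU ->]].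
    by exists (exist _ x xX); rewrite // UE.
  by rewrite (valP u) -UE.
by rewrite !card_imset //; [apply: val_inj|apply: some_inj].
Qed.

End ContractCritical.

Section DelContract.
Variables (G : sgraph) (X : {set G}) (x0 : G).
Notation K := (contract_graph X).

(** The default [x0] is never taken, since [val u] is not [None]. *)
Definition emb (u : del_vertex (None : K)) : G := oapp val x0 (val u).

Lemma proj_emb u : proj X (emb u) = val u.
Proof. by case: u => [[u|] //= pu]; rewrite proj_val. Qed.

Lemma emb_inj : injective emb.
Proof. by move=> u v E; apply: val_inj; rewrite /= -!proj_emb E. Qed.

Lemma emb_in u : emb u \in X.
Proof. by case: u => [[u|] //= pu]; apply: valP. Qed.

Lemma emb_onto x : x \in X -> exists u, x = emb u.
Proof. by move=> xX; exists (exist _ (Some (exist _ x xX)) isT). Qed.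

Lemma emb_adj u v : adj (emb u) (emb v) = adj u v.
Proof. by case: u v => [[u|] // pu] [[v|] // pv]. Qed.

Lemma emb_attach u :
  reflect (exists2 y, y \notin X & adj (emb u) y) (val u \in nbhd (None : K)).
Proof. by case: u => [[u|] // pu]; rewrite inE; apply: attachP. Qed.

End DelContract.

Section Blowup.
Variables (G : sgraph) (X : {set G}).
Hypotheses (thX : thin (@adj G) X) (thY : thin (@adj G) (~: X)).
Hypothesis cY : #|~: X| = 3.
Hypothesis clique : forall x y, x \notin X -> y \notin X -> x != y -> adj x y.
Notation K := (contract_graph X).

(** Contracting a triangle whose outgoing edges form a matching undoes a vertex-blowup. A triangle
    vertex without outgoing edge is allowed, which covers 2-edge-cuts. *)
Lemma blowup_contract : subcubic K -> is_vertex_blowup G K.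
Proof.
move=> sK; split=> //.
have /card_gt0P[x0 _] : 0 < #|~: X| by rewrite cY.
pose iB (i : triangle) : G := enum_val (cast_ord (esym cY) i).
have iBX i : iB i \notin X by have := enum_valP (cast_ord (esym cY) i); rewrite inE.
have iB_inj : injective iB by move=> i j /enum_val_inj /cast_ord_inj.
have iB_onto y : y \notin X -> exists i, y = iB i.
  move=> yX; have yX' : y \in ~: X by rewrite inE.
  exists (cast_ord cY (enum_rank_in yX' y)).
  by rewrite /iB cast_ordK enum_rankK_in.
pose f (u : K) : triangle :=
  if u is Some x then odflt ord0 [pick i | adj (val x) (iB i)] else ord0.
have fE x i : adj (val x) (iB i) -> f (Some x) = i.
  move=> xi; rewrite /f; case: pickP => [j xj|/(_ i)] /=; last by rewrite xi.
  by apply: iB_inj; apply: (thX (valP x)).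
exists None, f; split.
  move=> [x|] [y|]; rewrite !inE // => xN yN.
  have /attachP[p /iB_onto[i ->] xp] : x \in attach (@adj G) X := xN.
  have /attachP[q /iB_onto[j ->] yq] : y \in attach (@adj G) X := yN.
  rewrite (fE _ _ xp) (fE _ _ yq) => ij; subst j; congr Some; apply: val_inj.
  apply: (thY (x := iB i)); rewrite ?inE ?negbK ?(valP x) ?(valP y) //.
    by rewrite adj_sym.
  by rewrite adj_sym.
apply: (iso_glue (iA := emb x0) (iB := iB)) => //.
- exact: emb_inj.
- move=> u i; apply/eqP => E; have := iBX i; rewrite -E.
  by rewrite (emb_in x0 u).
- move=> z; have [/(emb_onto x0)[u ->]|/iB_onto[i ->]] := boolP (z \in X).
    by left; exists u.
  by right; exists i.
- exact: emb_adj.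
- move=> i j; have [->|nij] := eqVneq i j; first by rewrite adj_irr /= eqxx.
  by rewrite clique // ?(inj_eq iB_inj) //= nij.
case=> [[x|] // px] i.
change (adj (val x) (iB i) = (Some x \in nbhd (None : K)) && (f (Some x) == i)).
rewrite inE; apply/idP/andP => [xi|[/attachP]].
  rewrite (fE _ _ xi) eqxx; split=> //; apply/attachP.
  by exists (iB i).
by move=> [y /iB_onto[j ->] xj]; rewrite (fE _ _ xj) => /eqP <-.
Qed.

End Blowup.

(** * Colour patterns on 2-edge-cuts *)

Section CutEdges.
Variable G : sgraph.
Hypothesis critG : critical3 G.
Notation T := (deg2 G).
Let sa := @adj_sym G.
Let ia := @adj_irr G.
Notation h := (bdry (@adj G)).
Implicit Types X Y : {set G}.

(** If [x] had both cut edges, moving it to the other side would leave a boundary of at most one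
    edge. *)
Lemma two_cut_thin X : 1 < #|X| -> ~: X != set0 -> h X = 2 -> thin (@adj G) X.
Proof.
move=> X1 Y0 hX x y z xX yX zX xy xz; apply/eqP; apply: contraT => nyz.
have c2 : 1 < cut (@adj G) [set x] (~: X).
  by rewrite cut1; apply/card_gt1P; exists y, z; rewrite !inE yX zX.
have := bdryD1 sa xX; have := rdeg_splitD1 sa ia xX; have := crit_deg critG x.
have : 1 < h (X :\ x).
  apply: (crit_bdry_ge2 critG).
    by rewrite -card_gt0; move: X1; rewrite (cardsD1 x) xX.
  by apply/set0Pn; exists x; rewrite !inE eqxx.
rewrite hX; move: c2; clear; lia.
Qed.

Lemma thin_dele_cross X x y : x \in X -> y \notin X -> adj x y -> h X = 2 ->
  forall c : G -> G -> 'I_3, rainbow (dele (@adj G) x y) X c.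
Proof.
move=> xX yX xy hX c u u' v v' uX u'X vX v'X /andP[uv nuv] /andP[u'v' nu'v'] _.
apply/eqP; apply: contraT => nuu'.
have : [set (x, y); (u, v); (u', v')] \subset crossings (@adj G) X.
  by rewrite !subUset !sub1set; apply/andP; split; [apply/andP; split|]; apply/crossingsP.
move/subset_leq_card; rewrite -bdry_crossings hX -setUA cardsU1 cards2 !inE.
have ne p q : [set p; q] != [set x; y] -> (x, y) != (p, q).
  by apply: contra_neq => -[-> ->].
by rewrite negb_or !ne // xpair_eqE negb_and nuu'.
Qed.

Definition two_cut X := [/\ 1 < #|X|, 1 < #|~: X| & h X = 2].

Lemma two_cutC X : two_cut X -> two_cut (~: X).
Proof. by case=> ? ? ?; split; rewrite ?setCK // bdryC. Qed.

Lemma two_cut_thins X : two_cut X -> thin (@adj G) X /\ thin (@adj G) (~: X).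
Proof.
have ne Y : 1 < #|Y| -> Y != set0 by rewrite -card_gt0; apply: ltnW.
move=> tX; have [X1 Y1 hX] := tX; split; apply: two_cut_thin; rewrite ?setCK ?bdryC //.
  exact: ne.
exact: ne.
Qed.

Lemma two_cut_edges X : two_cut X -> exists a1 a2 b1 b2, [/\ a1 \in X, b1 \in X,
  a2 \notin X, b2 \notin X & [/\ adj a1 a2, adj b1 b2, a1 != b1, a2 != b2 &
  forall x y, x \in X -> y \notin X -> adj x y -> x = a1 /\ y = a2 \/ x = b1 /\ y = b2]].
Proof.
move=> tX; have [thX thY] := two_cut_thins tX; have [_ _] := tX.
rewrite bdry_crossings => /eqP/cards2P[[a1 a2] [[b1 b2] [nab E]]].
have /crossingsP[a1X a2X aa] : (a1, a2) \in crossings (@adj G) X by rewrite E set21.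
have /crossingsP[b1X b2X bb] : (b1, b2) \in crossings (@adj G) X by rewrite E set22.
exists a1, a2, b1, b2; split=> //; split=> //.
- by apply: contra_neq nab => e; subst b1; rewrite (thX a1 a2 b2).
- apply: contra_neq nab => e; subst b2.
  by rewrite (thY a2 a1 b1) // ?inE ?negbK // adj_sym.
move=> x y xX yX xy; have : (x, y) \in crossings (@adj G) X by apply/crossingsP.
by rewrite E !inE => /orP[]/eqP[-> ->]; auto.
Qed.

Lemma inner_edge X : thin (@adj G) X -> 0 < h X ->
  exists x w, [/\ x \in X, w \in X & adj x w].
Proof.
move=> thX; rewrite bdry_crossings => /card_gt0P[[x y] /crossingsP[xX yX xy]].
have /card_gt1P[u [v [+ + nuv]]] : 1 < rdeg (@adj G) x.
  by have := crit_deg critG x; case: (_ \in T); clear; lia.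
rewrite !inE => xu xv.
have [uX|uX] := boolP (u \in X); first by exists x, u.
have [vX|vX] := boolP (v \in X); first by exists x, v.
by rewrite (thX x u v) ?eqxx in nuv.
Qed.

(** An edge deleted inside the other side meets no vertex of [X], so the colouring obtained is
    proper at [X]. *)
Lemma side_colour X : thin (@adj G) (~: X) -> 0 < h X ->
  exists2 c : G -> G -> 'I_3, sym_col c & proper_at (@adj G) X c.
Proof.
have [_ _ _ e3] := critical3_elim critG.
move=> thY h0; have [|x [w [xX wX xw]]] := inner_edge thY; first by rewrite bdryC.
have [c sc pc] := e3 x w xw; exists c => //; apply: (proper_dele pc).
  by move: xX; rewrite inE.
by move: wX; rewrite inE.
Qed.

Lemma two_cut_mono X (c1 c2 : G -> G -> 'I_3) x x' y y' : two_cut X ->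
  sym_col c1 -> proper_at (@adj G) X c1 -> sym_col c2 -> proper_at (@adj G) (~: X) c2 ->
  x \in X -> x' \in X -> y \notin X -> y' \notin X -> adj x y -> adj x' y' ->
  x != x' -> c1 x y = c1 x' y' -> c2 x y != c2 x' y'.
Proof.
move=> tX s1 p1 s2 p2 xX x'X yX y'X xy x'y' nxx' E1; apply/eqP => E2.
have [_ _ n3 _] := critical3_elim critG; apply: n3.
have [a1 [a2 [b1 [b2 [_ _ _ _ [_ _ _ _ only]]]]]] := two_cut_edges tX.
pose p := tperm (c2 x y) (c1 x y).
apply: (glue_colour sa (X := X) (c1 := c1) (c2 := fun x y => p (c2 x y))) => //.
- by move=> u v; rewrite s2.
- exact: proper_perm.
have px : c1 x y = p (c2 x y) by rewrite tpermL.
have px' : c1 x' y' = p (c2 x' y') by rewrite -E2 -E1.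
move=> u v uX vX uv.
have [[e1 e2]|[e1 e2]] := only _ _ xX yX xy; have [[e3 e4]|[e3 e4]] := only _ _ x'X y'X x'y';
  have [[e5 e6]|[e5 e6]] := only _ _ uX vX uv; subst; rewrite ?eqxx // in nxx' *.
Qed.

(** The colours on the cut are either equal or different, and two sides with the same pattern can be
    glued after a permutation. So the patterns possible on one side are impossible on the other; as
    both sides are colourable, one of them always has different colours. *)
Lemma two_cut_always X : two_cut X -> always_rainbow X \/ always_rainbow (~: X).
Proof.
move=> tX; have [thX thY] := two_cut_thins tX; have [_ _ hX] := tX.
have [_ _ n3 _] := critical3_elim critG.
have [|c1 s1 p1] := side_colour thY; first by rewrite hX.
have [a1 [a2 [b1 [b2 [a1X b1X a2X b2X [aa bb nab1 nab2 only]]]]]] := two_cut_edges tX.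
have rX c : c a1 a2 != c b1 b2 -> rainbow (@adj G) X (c : G -> G -> 'I_3).
  move=> ne x x' y y' xX x'X yX y'X xy x'y' E.
  have [[e1 e2]|[e1 e2]] := only _ _ xX yX xy; have [[e3 e4]|[e3 e4]] := only _ _ x'X y'X x'y'; subst => //.
    by rewrite E eqxx in ne.
  by rewrite E eqxx in ne.
have rY c : sym_col c -> c a1 a2 != c b1 b2 -> rainbow (@adj G) (~: X) (c : G -> G -> 'I_3).
  move=> sc ne; apply: rainbowC => //; first by rewrite setCK.
  by rewrite setCK; apply: rX.
have [E1|N1] := eqVneq (c1 a1 a2) (c1 b1 b2).
  right=> c sc pc; apply: rY => //.
  exact: (two_cut_mono tX s1 p1 sc pc).
left=> c sc pc; apply: (rX c); apply/eqP => E.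
have [||c2 s2 p2] := @side_colour (~: X); [by rewrite setCK|by rewrite bdryC // hX|].
have N2 := two_cut_mono tX sc pc s2 p2 a1X b1X a2X b2X aa bb nab1 E.
apply: n3; apply: (glue_rainbow sa thX thY _ s1 p1 (rX _ N1) s2 p2 (rY _ s2 N2)).
by rewrite hX.
Qed.

Lemma two_cut_contract X : two_cut X -> always_rainbow (~: X) ->
  critical3 (contract_graph X) /\ #|deg2 (contract_graph X)| = #|X :&: T|.+1.
Proof.
move=> tX al; have [thX thY] := two_cut_thins tX; have [_ _ hX] := tX.
split; last by rewrite contract_deg2 // hX addn1.
apply: contract_critical; rewrite ?hX // => x y xX yX xy c _ _.
exact: thin_dele_cross.
Qed.

End CutEdges.

Definition close_graph (G : sgraph) (Y : {set G}) (p q : {x | x \in Y}) (npq : p != q) : sgraph :=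
  SGraph (adde_sym p q (@sub_rel_sym _ _ Y (@adj_sym G)))
    (adde_irr npq (@sub_rel_irr _ _ Y (@adj_irr G))).

(** * Cuts of size two *)

Section Hajos.
Variable G : sgraph.
Hypothesis critG : critical3 G.
Notation T := (deg2 G).
Let sa := @adj_sym G.
Variables (X : {set G}) (a1 a2 b1 b2 : G).
Hypothesis tX : two_cut X.
Hypotheses (a1X : a1 \in X) (b1X : b1 \in X) (a2X : a2 \notin X) (b2X : b2 \notin X).
Hypotheses (aa : adj a1 a2) (bb : adj b1 b2) (nab1 : a1 != b1) (nab2 : a2 != b2).
Hypothesis only : forall x y, x \in X -> y \notin X -> adj x y ->
  x = a1 /\ y = a2 \/ x = b1 /\ y = b2.
Hypothesis always : always_rainbow (~: X).
Hypothesis nadj : ~~ adj a2 b2.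
Notation Y := (~: X).

Let thX := (two_cut_thins critG tX).1.
Let thY := (two_cut_thins critG tX).2.

Lemma a2Y : a2 \in Y. Proof. by rewrite inE. Qed.
Lemma b2Y : b2 \in Y. Proof. by rewrite inE. Qed.

Let p : {x | x \in Y} := exist _ a2 a2Y.
Let q : {x | x \in Y} := exist _ b2 b2Y.
Lemma npq : p != q. Proof. exact: nab2. Qed.

Notation J := (close_graph npq).

Lemma mono_side (c : G -> G -> 'I_3) : sym_col c -> proper_at (@adj G) X c ->
  c a1 a2 = c b1 b2.
Proof.
move=> sc pc; apply/eqP; apply: contraT => ne.
have [_ _ n3 _] := critical3_elim critG; have [_ _ hX] := tX.
have [||c2 s2 p2] := @side_colour G critG Y; [by rewrite setCK|by rewrite bdryC // hX|].
have rc : rainbow (@adj G) X c.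
  move=> x x' y y' xX x'X yX y'X xy x'y' E.
  have [[e1 e2]|[e1 e2]] := only xX yX xy; have [[e3 e4]|[e3 e4]] := only x'X y'X x'y';
    subst => //; by rewrite E eqxx in ne.
exfalso; apply: n3; apply: (glue_rainbow sa thX thY _ sc pc rc s2 p2 (always s2 p2)).
by rewrite hX.
Qed.

Lemma not_mono (c : G -> G -> 'I_3) : sym_col c -> proper_at (@adj G) Y c ->
  c a2 a1 <> c b2 b1.
Proof.
move=> sc pc E; have := nab2; rewrite (always sc pc _ _ _ _ _ _ E) ?eqxx //.
all: by rewrite ?inE ?negbK // adj_sym.
Qed.

Lemma close_adj u v : @adj J u v = adj (val u) (val v) || ([set u; v] == [set p; q]).
Proof. by []. Qed.

Lemma close_deg (u : J) : deg u = rdeg (@adj G) (val u).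
Proof.
rewrite /deg -/(rdeg (@adj J) u) [rdeg _ _](rdeg_adde u _ npq) //; last exact: sub_rel_sym.
rewrite sub_rel_deg (rdeg_split sa (val u) Y); congr (_ + _).
have uY : val u \in Y := valP u.
have := thin_cut1 thY uY; rewrite setCK => c1.
have -> : (u == p) || (u == q) = (0 < cut (@adj G) [set val u] X).
  apply/orP/cut_gt0P => [[/eqP->|/eqP->]|[x [y [/set1P -> yX uy]]]].
  - by exists a2, a1; rewrite set11 adj_sym.
  - by exists b2, b1; rewrite set11 adj_sym.
  have uX : val u \notin X by rewrite inE in uY.
  have yu : adj y (val u) by rewrite adj_sym.
  by case: (only yX uX yu) => -[_ E]; [left|right]; rewrite -val_eqE /= E.
by case: (cut _ _ X) c1 => [|[]].
Qed.

Lemma close_deg2 : #|deg2 J| = #|Y :&: T|.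
Proof.
rewrite -(card_imset _ val_inj); apply: eq_card => x; rewrite inE.
apply/imsetP/andP => [[u + ->]|[xY xT]].
  rewrite inE close_deg => uT; split; first exact: valP.
  by rewrite inE.
exists (exist _ x xY) => //; rewrite inE close_deg.
by move: xT; rewrite inE.
Qed.

Lemma close_connected : connected J.
Proof.
have [cG _ _ _] := critical3_elim critG.
apply: connected_intro; first by apply/card_gt0P; exists p.
have main (P : {set J}) : p \notin P -> q \notin P -> P != set0 ->
    exists x y, [/\ x \in P, y \notin P & @adj J x y].
  move=> pP qP /set0Pn[u uP]; pose Z := val @: P.
  have ZY x : x \in Z -> x \in Y by case/imsetP => v _ ->; apply: valP.
  have [||x [y [/imsetP[v vP ->] yZ vy]]] := @connected_cut G Z cG.
  - by apply/set0Pn; exists (val u); apply: imset_f.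
  - apply/set0Pn; exists a1; rewrite inE; apply/negP => /ZY.
    by rewrite inE a1X.
  have [yX|yX] := boolP (y \in X).
    have yv : adj y (val v) by rewrite adj_sym.
    have vX : val v \notin X by have := valP v; rewrite inE.
    have pv : v != p by apply: contraNneq pP => E; move: vP; rewrite E.
    have qv : v != q by apply: contraNneq qP => E; move: vP; rewrite E.
    case: (only yX vX yv) => -[_ E]; first by rewrite -val_eqE /= E eqxx in pv.
    by rewrite -val_eqE /= E eqxx in qv.
  have yY : y \in Y by rewrite inE.
  exists v, (exist _ y yY); split=> //; last by rewrite close_adj vy.
  by apply: contra yZ => yP; apply/imsetP; exists (exist _ y yY).
have pq : @adj J p q by rewrite close_adj eqxx orbT.
move=> P P0 P0'; have [pP|pP] := boolP (p \in P); have [qP|qP] := boolP (q \in P).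
- have [|||x [y []]] := main (~: P); rewrite ?inE ?pP ?qP //.
  by rewrite negbK => xP yP xy; exists y, x; rewrite adj_sym.
- by exists p, q.
- by exists q, p; rewrite adj_sym.
exact: main.
Qed.

(** Give both cut edges the colour of [pq]. As [a2] and [b2] are not adjacent, [pq] is a new edge
    and its colour is on no other edge at its ends, so this would be a colouring of [Y] with equal
    colours on the cut. *)
Lemma close_not3 : ~ kcol 3 (@adj J).
Proof.
case=> c' sc pc.
pose c (x y : G) := match proj Y x, proj Y y with
  | Some u, Some v => c' u v | _, _ => c' p q end.
have sc' : sym_col c.
  by move=> x y; rewrite /c; case: (proj _ x) => [u|]; case: (proj _ y) => [v|].
have cin u v : c (val u) (val v) = c' u v by rewrite /c !proj_val.
have cout x y : y \notin Y -> c x y = c' p q.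
  by move=> yY; rewrite /c (proj_out yY); case: (proj _ x).
apply: (not_mono (c := c)) => //; last by rewrite !cout // inE negbK.
have mixed x y z : x \in Y -> adj x y -> adj x z -> y \notin Y -> z \in Y -> c x y <> c x z.
  move=> xY xy xz yY zY; rewrite cout //.
  have [u _ E] := proj_in xY; have [w _ Ew] := proj_in zY; rewrite -E -Ew cin.
  have yX : y \in X by move: yY; rewrite inE negbK.
  have xX : x \notin X by rewrite inE in xY.
  have yx : adj y x by rewrite adj_sym.
  have auw : @adj J u w by rewrite close_adj E Ew xz.
  case: (only yX xX yx) => -[_ Ex].
    have Eu : u = p by apply: val_inj; rewrite E Ex.
    rewrite Eu in auw *.
    move=> /(pc p q w (in_setT _)) Eq; suff Eqw : q = w.
      by move: nadj; rewrite -Ex -[b2]/(val q) Eqw Ew xz.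
    by apply: Eq auw; rewrite close_adj eqxx orbT.
  have Eu : u = q by apply: val_inj; rewrite E Ex.
  rewrite Eu in auw *.
  rewrite sc => /(pc q p w (in_setT _)) Eq; suff Eqw : p = w.
    by move: nadj; rewrite adj_sym -Ex -[a2]/(val p) Eqw Ew xz.
  by apply: Eq auw; rewrite close_adj setUC eqxx orbT.
move=> x y z xY xy xz E.
have [yY|yY] := boolP (y \in Y); have [zY|zY] := boolP (z \in Y).
- have [u _ Eu] := proj_in xY; have [v _ Ev] := proj_in yY; have [w _ Ew] := proj_in zY.
  move: E xy xz; rewrite -Eu -Ev -Ew !cin => E uv uw; congr val.
  by apply: (pc u) => //; rewrite close_adj ?uv ?uw.
- by case: (mixed x z y xY xz xy zY yY).
- by case: (mixed x y z xY xy xz yY zY).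
by apply: (thY xY).
Qed.

(** For [pq] itself, restrict a colouring of [G - a1a2]. For another edge, colour [G] without it:
    [X] is unaffected, so the two cut edges have the same colour, and [pq] can take it. *)
Lemma close_dele (u v : J) : adj u v -> kcol 3 (dele (@adj J) u v).
Proof.
have [_ _ _ e3] := critical3_elim critG.
have uX (w : {x | x \in Y}) : val w \notin X by have := valP w; rewrite inE.
rewrite close_adj; have [/eqP E _|nE] := boolP ([set u; v] == [set p; q]).
  have [c sc pc] := e3 _ _ aa; exists (fun x y => c (val x) (val y)).
    by move=> x y; apply: sc.
  have sub (x y : J) : dele (@adj J) u v x y -> dele (@adj G) a1 a2 (val x) (val y).
    rewrite /dele close_adj E => /andP[/orP[xy|/eqP ->]]; last by rewrite eqxx.
    rewrite xy => _; apply/eqP => /set2_inj [] [F1 F2].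
      by have := uX x; rewrite F1 a1X.
    by have := uX y; rewrite F2 a1X.
  move=> x y z _ /sub xy /sub xz /pc H; apply: val_inj; exact: H.
rewrite orbF => uv; have [c sc pc] := e3 _ _ uv.
have g : c a1 a2 = c b1 b2 by apply: mono_side => //; apply: (proper_dele pc).
have out (x y : G) : y \in X -> adj x y -> dele (@adj G) (val u) (val v) x y.
  move=> yX xy; rewrite /dele xy; apply/eqP => /set2_inj [] [_ F].
    by have := uX v; rewrite -F yX.
  by have := uX u; rewrite -F yX.
pose c' (x y : J) := c (val x) (val y).
have sub (x y : J) : dele (dele (@adj J) u v) p q x y ->
    dele (@adj G) (val u) (val v) (val x) (val y).
  rewrite /dele close_adj => /andP[/andP[/orP[xy|->//] ne] _].
  rewrite xy; apply: contra ne => /eqP /set2_inj.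
  by case=> -[/val_inj -> /val_inj ->]; rewrite // setUC.
exists (recol c' p q (c a1 a2)); first by apply: recol_sym => x y; apply: sc.
apply: recol_proper.
- by move=> x y; apply: sc.
- by move=> x y z _ /sub xy /sub xz /pc H; apply: val_inj; apply: H.
- move=> _ z /sub pz; apply/eqP; rewrite sc => /pc H.
  by have := uX z; rewrite H ?a1X ?inE // out // adj_sym.
move=> _ z /sub qz; apply/eqP; rewrite g sc => /pc H.
by have := uX z; rewrite H ?b1X ?inE // out // adj_sym.
Qed.

Lemma close_critical : critical3 J.
Proof.
have [_ d3 _ _] := critical3_elim critG.
apply: critical3_intro.
- exact: close_connected.
- by move=> u; rewrite close_deg; apply: d3.
- have [|x [w [xY wY xw]]] := inner_edge critG thY.
    by have [_ _ hX] := tX; rewrite bdryC // hX.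
  have [xT|xT] := boolP (x \in T); last first.
    by exists (exist _ x xY); rewrite close_deg /= (crit_deg3 critG).
  exists (exist _ w wY); rewrite close_deg /= (crit_deg3 critG) //.
  by apply: contraL xw => wT; apply: (crit_indep critG).
- exact: close_not3.
exact: close_dele.
Qed.

Lemma close_hajos : is_hajos_join G J (contract_graph X).
Proof.
set K := contract_graph X.
pose v2 : K := Some (exist _ b1 b1X).
(* The identified vertex is [a2], alias [None]: it inherits the edge to [a1], the only neighbour of
   [None] other than [b1]. The edge added by the join is [b2 b1]. *)
exists p, q, (None : K), v2; split.
- by rewrite close_adj eqxx orbT.
- by apply/attachP; exists b2.
have cross (u : {x | x \in Y}) (w : del_vertex (None : K)) :
    adj (val u) (emb a1 w) -> emb a1 w = a1 /\ u = p \/ emb a1 w = b1 /\ u = q.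
  have uX : val u \notin X by have := valP u; rewrite inE.
  rewrite adj_sym => /(only (emb_in a1 w) uX) [] [-> E]; [left|right]; split=> //;
  exact: val_inj.
have embE w : (val w == v2) = (emb a1 w == b1).
  rewrite -[val w](proj_emb a1) -[v2](proj_val (exist _ b1 b1X)).
  apply/eqP/eqP => [/(proj_inj (emb_in a1 w)) //|-> //].
apply: (@iso_glue G (@del_edges J [set [set p; q]]) (del_vertex (None : K)) _
  (fun u : {x | x \in Y} => val u) (emb a1)).
- exact: val_inj.
- exact: emb_inj.
- move=> u w; apply/eqP => E; have := valP u; rewrite E inE.
  by rewrite (emb_in a1 w).
- move=> z; have [/(emb_onto a1)[u ->]|zX] := boolP (z \in X); first by right; exists u.
  have zY : z \in Y by rewrite inE.
  by left; exists (exist _ z zY).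
- move=> u v; rewrite del_edge_adj /dele close_adj.
  case: eqP => [/set2_inj E|_]; last by rewrite orbF andbT.
  rewrite andbF; apply/negbTE; case: E => -[-> ->] //.
  by rewrite adj_sym.
- exact: emb_adj.
move=> u w.
change (adj (val u) (emb a1 w) = [|| [&& u == p, @adj K None (val w) & val w != v2]
  | (u == q) && (val w == v2)]).
rewrite embE; apply/idP/orP.
  move=> uw; have wN : @adj K None (val w).
    have := emb_attach a1 w; rewrite inE => /rwP [H _]; apply: H.
    exists (val u); last by rewrite adj_sym.
    by have := valP u; rewrite inE.
  case: (cross _ _ uw) => -[-> ->]; [left|right]; rewrite ?eqxx // wN.
  by rewrite nab1.
have a2N : adj (val p) a1 by rewrite adj_sym.
have b2N : adj (val q) b1 by rewrite adj_sym.
case=> [/and3P[/eqP -> wN nb]|/andP[/eqP -> /eqP -> //]].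
have /(emb_attach a1) [y yX wy] : val w \in nbhd (None : K) by rewrite inE.
case: (only (emb_in a1 w) yX wy) => -[E _]; first by rewrite E.
by rewrite E eqxx in nb.
Qed.

End Hajos.

Lemma colour_avoid (B : {set 'I_3}) : #|B| < 3 -> exists d, d \notin B.
Proof.
move=> lt; apply/existsP; apply: contraT; rewrite negb_exists => /forallP H.
have BT : B = setT by apply/setP => d; rewrite [RHS]inE; have := H d; rewrite negbK.
by move: lt; rewrite BT cardsT card_ord.
Qed.

Section TwoCutCase.
Variable G : sgraph.
Hypothesis critG : critical3 G.
Notation T := (deg2 G).
Hypothesis T2 : 1 < #|T|.
Let sa := @adj_sym G.
Let ia := @adj_irr G.
Notation h := (bdry (@adj G)).

Definition blowup_concl := exists H : sgraph,
  [/\ nontrivial_critical3 H, #|H| + 2 = #|G| & is_vertex_blowup G H].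

Definition hajos_concl := exists G1 G2 : sgraph,
  [/\ critical3 G1 /\ #|G1| < #|G|, critical3 G2 /\ #|G2| < #|G|,
      nontrivial_critical3 G1 \/ nontrivial_critical3 G2 & is_hajos_join G G1 G2].

Lemma blowup_conclP (X : {set G}) : thin (@adj G) X -> thin (@adj G) (~: X) ->
  #|~: X| = 3 -> (forall x y, x \notin X -> y \notin X -> x != y -> adj x y) ->
  critical3 (contract_graph X) -> 1 < #|deg2 (contract_graph X)| -> blowup_concl.
Proof.
move=> thX thY cY cl cK K2; exists (contract_graph X); split.
- exact: crit_nontrivial.
- by rewrite card_contract_graph -(cardsC X) cY addn2 addn3.
apply: blowup_contract => //; have [_ mK _ _] := cK.
by rewrite /subcubic mK.
Qed.

Lemma deg2_split (X : {set G}) : #|T| = #|X :&: T| + #|~: X :&: T|.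
Proof. by rewrite -(cardsID X T) setDE ![T :&: _]setIC. Qed.

(* With [always_rainbow Y], [Z] is a smaller cut of the same kind as [Y]. *)
Lemma two_cut_shrink (X : {set G}) a1 a2 b1 b2 (Y := ~: X) (Z := Y :\ a2 :\ b2) :
  two_cut X -> a1 \in X -> b1 \in X -> a2 \notin X -> b2 \notin X ->
  adj a1 a2 -> adj b1 b2 -> a2 != b2 ->
  (forall x y, x \in X -> y \notin X -> adj x y -> x = a1 /\ y = a2 \/ x = b1 /\ y = b2) ->
  adj a2 b2 ->
  [/\ Z != set0, h Z = 2, a2 \notin T, b2 \notin T &
      cut (@adj G) [set a2] Z = 1 /\ cut (@adj G) [set b2] Z = 1].
Proof.
move=> tX a1X b1X a2X b2X aa bb nab only ab.
have [thX thY] := two_cut_thins critG tX; have [_ _ hX] := tX.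
have hY : h Y = 2 by rewrite bdryC.
have a2Y : a2 \in Y by rewrite inE.
have b2Y : b2 \in Y by rewrite inE.
have out v u : v \in Y -> u \in X -> adj v u -> cut (@adj G) [set v] (~: Y) = 1.
  move=> vY uX vu; apply/eqP; rewrite eqn_leq thin_cut1 //.
  by apply/cut_gt0P; exists v, u; rewrite set11 !inE negbK uX.
have ca : cut (@adj G) [set a2] (~: Y) = 1 by apply: (out _ a1); rewrite // adj_sym.
have cb : cut (@adj G) [set b2] (~: Y) = 1 by apply: (out _ b1); rewrite // adj_sym.
have one v u : adj v u -> cut (@adj G) [set v] [set u] = 1.
  move=> vu; rewrite cut1; apply/eqP/cards1P; exists u; apply/setP => w; rewrite !inE.
  by case: eqP => // ->.
have b2Y' : b2 \in Y :\ a2 by rewrite !inE eq_sym nab.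
have cb' : cut (@adj G) [set b2] (~: (Y :\ a2)) = 2.
  rewrite (cutIDr sa _ _ [set a2]).
  have -> : ~: (Y :\ a2) :&: [set a2] = [set a2].
    by apply/setIidPr; rewrite sub1set !inE eqxx.
  have -> : ~: (Y :\ a2) :\: [set a2] = ~: Y.
    by apply/setP => y; rewrite !inE; case: eqP => //= ->; rewrite a2X.
  by rewrite one ?cb // adj_sym.
have ca' : cut (@adj G) [set a2] (Y :\ a2) = (cut (@adj G) [set a2] Z).+1.
  rewrite (cutIDr sa _ _ [set b2]).
  have -> : (Y :\ a2) :&: [set b2] = [set b2] by apply/setIidPr; rewrite sub1set.
  by rewrite one.
have e1 := bdryD1 sa a2Y; have e2 := bdryD1 sa b2Y'.
have d1 := rdeg_splitD1 sa ia a2Y; have d2 := rdeg_splitD1 sa ia b2Y'.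
rewrite -/Z in e2 d2; rewrite ca hY ca' in e1; rewrite cb' in e2 d2.
rewrite ca ca' in d1.
have nTT : ~~ ((a2 \in T) && (b2 \in T)).
  by apply/andP => -[aT bT]; move: ab; apply/negP/(crit_indep critG).
have da := crit_deg critG a2; have db := crit_deg critG b2.
have Z0 : Z != set0.
  apply: contraNneq nTT => Z0; have hZ : h Z = 0 by rewrite Z0 /bdry cutC // cut0r.
  move: e1 e2 d1 d2 da db; rewrite hZ.
  by case: (a2 \in T); case: (b2 \in T); clear; lia.
have hZ : 1 < h Z.
  apply: (crit_bdry_ge2 critG Z0); apply/set0Pn; exists b2.
  by rewrite !inE eqxx.
move: e1 e2 d1 d2 da db hZ.
by case: (a2 \in T); case: (b2 \in T); clear -Z0 => *; split=> //; lia.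
Qed.

(** Suppose both edges leaving [Z] have colour [s]. Colour both edges between [X] and [Y] with [p]
    and the edge [a2 b2] with the third colour [r]. This is proper at [Y] but equal on its cut. *)
Lemma always_shrink (X : {set G}) a1 a2 b1 b2 (Y := ~: X) (Z := Y :\ a2 :\ b2) :
  two_cut X -> a1 \in X -> b1 \in X -> a2 \notin X -> b2 \notin X ->
  adj a1 a2 -> adj b1 b2 -> a2 != b2 ->
  (forall x y, x \in X -> y \notin X -> adj x y -> x = a1 /\ y = a2 \/ x = b1 /\ y = b2) ->
  adj a2 b2 -> cut (@adj G) [set a2] Z = 1 -> cut (@adj G) [set b2] Z = 1 ->
  always_rainbow Y -> always_rainbow Z.
Proof.
move=> tX a1X b1X a2X b2X aa bb nab only ab ca cb alY c sc pc x x' y y' xZ x'Z yZ y'Z xy x'y' E.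
have [thX thY] := two_cut_thins critG tX.
have uniq v u w : cut (@adj G) [set v] Z = 1 -> u \in Z -> w \in Z -> adj v u -> adj v w -> u = w.
  by rewrite cut1 => /eq_leq/card_le1_eqP H uZ wZ vu vw; apply: H; rewrite inE ?uZ ?wZ.
have ZX u : u \in Z -> [/\ u \notin X, u != a2 & u != b2].
  by rewrite !inE => /and3P[].
have end2 u v : u \in Z -> v \notin Z -> adj u v -> v = a2 \/ v = b2.
  move=> /ZX[uX ua ub] vZ uv; have [->|na] := eqVneq v a2; first by left.
  have [->|nb] := eqVneq v b2; first by right.
  have vX : v \in X by move: vZ; rewrite !inE na nb negbK.
  have vu : adj v u by rewrite adj_sym.
  by case: (only v u vX uX vu) => -[_ e]; [rewrite e eqxx in ua|rewrite e eqxx in ub].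
apply/eqP; apply: contraT => nxx'; exfalso.
have key z z' : z \in Z -> z' \in Z -> adj a2 z -> adj b2 z' -> c z a2 = c z' b2 -> False.
  move=> zZ z'Z az bz Ez; set s := c z a2 in Ez.
  have [p] : exists d, d \notin [set s] by apply: colour_avoid; rewrite cards1.
  have [r] : exists d, d \notin [set s; p] by apply: colour_avoid; rewrite ltnS card_set2_le.
  rewrite !inE negb_or => /andP[rs rp] ps.
  pose c' (u v : G) := if [set u; v] == [set a2; b2] then r
    else if (u \in X) || (v \in X) then p else c u v.
  have sc' : sym_col c' by move=> u v; rewrite /c' setUC orbC sc.
  have nX v : v \in X -> v != a2 /\ v != b2.
    by move=> vX; split; apply: contraTneq vX => ->.
  have cX u v : v \in X -> c' u v = p.
    move=> vX; rewrite /c' vX orbT; case: eqP => // /set2_inj e.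
    by have [n1 n2] := nX v vX; case: e => -[_ e]; rewrite e eqxx in n1 n2.
  have cZ u v : u \notin X -> v \in Z -> c' u v = c u v.
    move=> uX /ZX[vX va vb]; rewrite /c' (negPf uX) (negPf vX); case: eqP => // /set2_inj e.
    by case: e => -[_ e]; rewrite e eqxx in va vb.
  have ce (e e' w : G) : [set e; e'] = [set a2; b2] -> cut (@adj G) [set e] Z = 1 -> e \in Y ->
      w \in Z -> adj e w -> c w e = s ->
      forall u, adj e u -> [\/ u \in X /\ c' e u = p, u = e' /\ c' e u = r | u = w /\ c' e u = s].
    move=> ee' ce eY wZ ew cwe u eu.
    have [uX|uX] := boolP (u \in X); first by constructor 1; rewrite cX.
    have [->|nu] := eqVneq u e'; first by constructor 2; rewrite /c' ee' eqxx.
    have nue : u != e by apply: contraTneq eu => ->; rewrite adj_irr.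
    have uZ : u \in Z.
      rewrite !inE uX andbT; case/set2_inj: ee' => -[e1 e2]; subst e e';
      by rewrite ?nu ?nue.
    have Eu : u = w by apply: (uniq e).
    constructor 3; split=> //; rewrite cZ //; last by move: eY; rewrite inE.
    by rewrite Eu sc.
  have pe (e e' w : G) : [set e; e'] = [set a2; b2] -> cut (@adj G) [set e] Z = 1 -> e \in Y ->
      w \in Z -> adj e w -> c w e = s ->
      forall u v, adj e u -> adj e v -> c' e u = c' e v -> u = v.
    move=> ee' ce' eY wZ ew cwe u v eu ev.
    have thu := ce e e' w ee' ce' eY wZ ew cwe u eu.
    have thv := ce e e' w ee' ce' eY wZ ew cwe v ev.
    case: thu => -[h1 ->]; case: thv => -[h2 ->]; rewrite ?h1 ?h2 // => Ec.
    - by apply: (thY e) => //; rewrite inE negbK.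
    - by rewrite Ec eqxx in rp.
    - by rewrite Ec eqxx in ps.
    - by rewrite Ec eqxx in rp.
    - by rewrite Ec eqxx in rs.
    - by rewrite Ec eqxx in ps.
    - by rewrite Ec eqxx in rs.
  have pc' : proper_at (@adj G) Y c'.
    move=> u v w uY uv uw.
    have [Eu|nua] := eqVneq u a2; first by subst u; apply: (pe a2 b2 z).
    have [Eu|nub] := eqVneq u b2.
      by subst u; apply: (pe b2 a2 z') => //; rewrite setUC.
    have uX : u \notin X by rewrite inE in uY.
    have uZ : u \in Z by rewrite !inE nua nub.
    have cu t : adj u t -> c' u t = c u t.
      move=> ut; have tu : adj t u by rewrite adj_sym.
      have tX' : t \notin X.
        apply/negP => tX'; case: (only t u tX' uX tu) => -[_ e].
          by rewrite e eqxx in nua.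
        by rewrite e eqxx in nub.
      by rewrite sc' (cZ t u tX' uZ) sc.
    by rewrite !cu //; apply: pc.
  have := nab; rewrite (alY c' sc' pc' a2 b2 a1 b1) ?eqxx ?inE ?negbK ?cX //.
  - by rewrite adj_sym.
  - by rewrite adj_sym.
have xa : adj y x by rewrite adj_sym.
have x'a : adj y' x' by rewrite adj_sym.
case: (end2 _ _ xZ yZ xy) => ey; case: (end2 _ _ x'Z y'Z x'y') => ey'; subst y y'.
- by rewrite (uniq a2 x x') ?eqxx in nxx'.
- exact: (key x x').
- by apply: (key x' x) => //; rewrite E.
by rewrite (uniq b2 x x') ?eqxx in nxx'.
Qed.

Lemma two_cut_concl (X : {set G}) : two_cut X -> always_rainbow (~: X) ->
  blowup_concl \/ hajos_concl.
Proof.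
have [m] := ubnP #|~: X|; elim: m X => // m IH X lt tX al.
have [thX thY] := two_cut_thins critG tX; have [X1 Y1 hX] := tX.
have [cK dK] := two_cut_contract critG tX al.
have [a1 [a2 [b1 [b2 [a1X b1X a2X b2X [aa bb nab1 nab2 only]]]]]] := two_cut_edges critG tX.
have cardG : #|G| = #|X| + #|~: X| by rewrite cardsC.
have [ab|nadj] := boolP (adj a2 b2); last first.
  right; exists (close_graph (npq a2X b2X nab2)), (contract_graph X).
  have cJ := close_critical critG tX a1X b1X a2X b2X aa bb nab2 only al nadj.
  have dJ := close_deg2 critG tX a1X b1X a2X b2X aa bb nab2 only nadj.
  split.
  - split; first exact: cJ.
    apply: (@leq_ltn_trans #|~: X|); first by rewrite card_sig.
    by rewrite cardG; move: X1; clear; lia.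
  - by split; first exact: cK; rewrite card_contract_graph cardG; move: Y1; clear; lia.
  (* [J] keeps the vertices of [T] in [Y], while [K] has those in [X] and also [None]. If [J] has at
     most one, then [X] contains another one and [K] has two. *)
  - have [YT|YT] := ltnP 1 #|~: X :&: T|.
      by left; apply: crit_nontrivial cJ _; rewrite dJ.
    right; apply: crit_nontrivial cK _; rewrite dK.
    by have := deg2_split X; move: T2 YT; clear; lia.
  exact: (close_hajos b1X a2X b2X aa bb nab1 nab2 only nadj).
have [Z0 hZ aT bT [ca cb]] := two_cut_shrink tX a1X b1X a2X b2X aa bb nab2 only ab.
have alZ := always_shrink tX a1X b1X a2X b2X aa bb nab2 only ab ca cb al.
set Z := _ :\ b2 in Z0 hZ ca cb alZ.
have cZ : #|~: X| = #|Z| + 2.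
  rewrite (cardsD1 a2) (cardsD1 b2 (_ :\ a2)) !inE a2X b2X eq_sym nab2.
  by rewrite !add1n addn2.
have [Z1|Z1] := ltnP 1 #|Z|.
  apply: (IH (~: Z)); rewrite ?setCK //.
    by move: lt; rewrite cZ; clear; lia.
  apply: two_cutC; split=> //.
  apply: leq_trans X1 (subset_leq_card _); apply/subsetP => x xX.
  by rewrite !inE xX /= !andbF.
(* Here [a2], [b2] and [z] form a triangle in which only [z] can be in [T]. Contracting it gives
   [None] of degree 2 in place of [z], so at least two vertices of degree 2 remain. *)
have /cards1P[z Ez] : #|Z| == 1 by rewrite eqn_leq Z1 card_gt0.
left; apply: (blowup_conclP thX thY) => //; first by rewrite cZ Ez cards1.
  have adjz e : cut (@adj G) [set e] Z = 1 -> adj e z.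
    move=> ce; have /cut_gt0P[u [v [/set1P -> vZ ev]]] : 0 < cut (@adj G) [set e] Z by rewrite ce.
    by move: vZ; rewrite Ez => /set1P <-.
  have az := adjz _ ca; have bz := adjz _ cb.
  have cases x : x \notin X -> [\/ x = a2, x = b2 | x = z].
    move=> xX; have [->|na] := eqVneq x a2; first by constructor 1.
    have [->|nb] := eqVneq x b2; first by constructor 2.
    have : x \in Z by rewrite !inE na nb.
    by rewrite Ez => /set1P ->; constructor 3.
  move=> x y /cases cx /cases cy.
  by case: cx => ->; case: cy => ->; rewrite ?eqxx // adj_sym.
rewrite dK ltnS; have := deg2_split X.
have : #|~: X :&: T| <= 1.
  rewrite -(cards1 z) -Ez; apply: subset_leq_card; apply/subsetP => x.
  rewrite !inE => /andP[xX xT].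
  rewrite xX andbT; apply/andP; split.
    by apply: contraTneq xT => ->; move: bT; rewrite inE.
  by apply: contraTneq xT => ->; move: aT; rewrite inE.
by move: T2; clear; lia.
Qed.

End TwoCutCase.

(** * Cuts of size three *)

Section ThreeCut.
Variable G : sgraph.
Hypothesis critG : critical3 G.
Notation T := (deg2 G).
Hypothesis T2 : 1 < #|T|.
Let sa := @adj_sym G.
Let ia := @adj_irr G.
Notation h := (bdry (@adj G)).
Hypothesis no2 : forall Z : {set G}, ~ two_cut Z.
Variable X : {set G}.
Notation Y := (~: X).
Hypotheses (X1 : 1 < #|X|) (Y1 : 1 < #|Y|) (hX : h X = 3).
Hypothesis YT : forall y, y \notin X -> y \notin T.

Lemma TX : T \subset X.
Proof. by apply/subsetP => t; apply: contraTT => /YT. Qed.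

(** Moving [v] across leaves a boundary of at most 2, and without 2-edge-cuts only one vertex can
    then remain in [Z]. Such a two-vertex side is later refuted by the number of vertices of [T] in
    [X], or by a degree in [Y]. *)
Lemma two_out_single (Z : {set G}) v y z : 1 < #|Z| -> 1 < #|~: Z| -> h Z = 3 ->
  v \in Z -> y \notin Z -> z \notin Z -> adj v y -> adj v z -> y != z ->
  v \notin T /\ exists w, Z :\ v = [set w].
Proof.
move=> Z1 W1 hZ vZ yZ zZ vy vz nyz.
have c2 : 1 < cut (@adj G) [set v] (~: Z).
  by rewrite cut1; apply/card_gt1P; exists y, z; rewrite !inE yZ zZ.
have Zv : Z :\ v != set0 by rewrite -card_gt0; move: Z1; rewrite (cardsD1 v) vZ.
have W1' : 1 < #|~: (Z :\ v)|.
  by apply: leq_trans W1 (subset_leq_card _); rewrite setCS subsetDl.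
have g2 : 1 < h (Z :\ v).
  by apply: (crit_bdry_ge2 critG) => //; rewrite -card_gt0 ltnW.
have := bdryD1 sa vZ; have := rdeg_splitD1 sa ia vZ; have := crit_deg critG v.
rewrite hZ => e1 e2 e3.
have [vT h2] : v \notin T /\ h (Z :\ v) = 2.
  by move: e1 e2 e3 c2 g2; case: (v \in T); clear => *; split=> //; lia.
split=> //; apply/cards1P; rewrite eqn_leq card_gt0 Zv andbT leqNgt.
by apply/negP => Z1'; apply: (no2 (Z := Z :\ v)).
Qed.

Lemma three_thinX : thin (@adj G) X.
Proof.
move=> v y z vX yX zX vy vz; apply/eqP; apply: contraT => nyz.
have [vT [w E]] := two_out_single X1 Y1 hX vX yX zX vy vz nyz.
have : T \subset [set w].
  rewrite -E; apply/subsetP => t tT; rewrite !inE (subsetP TX t tT) andbT.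
  by apply: contraNneq vT => <-.
by move/subset_leq_card; rewrite cards1 leqNgt T2.
Qed.

Lemma three_thinY : thin (@adj G) Y.
Proof.
move=> v y z vY yY zY vy vz; apply/eqP; apply: contraT => nyz.
have [||vT [w E]] := two_out_single Y1 _ _ vY yY zY vy vz nyz; rewrite ?setCK ?bdryC //.
have : w \in Y :\ v by rewrite E set11.
rewrite !inE => /andP[nwv wX]; have wT := YT wX.
have c2 : 1 < cut (@adj G) [set v] (~: Y).
  by rewrite cut1; apply/card_gt1P; exists y, z; rewrite !inE in yY zY *; rewrite yY zY.
have := bdryD1 sa vY; have := rdeg_splitD1 sa ia vY; have := crit_deg3 critG wT.
have -> : rdeg (@adj G) w = h (Y :\ v).
  rewrite E /bdry (rdeg_splitD1 sa ia (set11 w)) setDv cut0r //.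
rewrite (crit_deg3 critG vT) bdryC // hX; move: c2; clear; lia.
Qed.

Lemma odd_side : odd #|Y|.
Proof.
have := rdeg_sum sa Y; have := crit_deg_sum critG Y.
have -> : Y :&: T = set0.
  by apply/setP => y; rewrite !inE; apply/negP => /andP[/YT yT]; rewrite inE in yT; apply/negP.
rewrite cards0 addn0 => -> /(congr1 odd); rewrite oddM oddD bdryC // hX.
by have := cut_even Y sa ia; case: (odd (cut _ _ _)) => // _ /=.
Qed.

Lemma odd_matched (b : rel G) (c : G -> G -> 'I_3) d : symmetric b -> subrel b (@adj G) ->
  sym_col c -> proper_at b Y c ->
  (forall v, v \in Y -> exists u, [/\ u \in Y, b v u & c v u = d]) -> False.
Proof.
move=> sb sub sc pc mt; have := odd_side; apply/negP.
apply: (matched_even sb _ sc pc mt) => x; apply/negP => /sub.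
by rewrite ia.
Qed.

(* If two of the cut edges had the same colour, then some colour would be used on
   no cut edge, and its class would match the odd set [Y] within itself. *)
Lemma three_always : always_rainbow Y.
Proof.
move=> c sc pc x x' y y' xY x'Y yY y'Y xy x'y' E; apply/eqP; apply: contraT => nxx'.
exfalso; pose P := crossings (@adj G) Y.
have cP : #|P| = 3 by rewrite -bdry_crossings bdryC.
have p1 : (x, y) \in P by apply/crossingsP.
have p2 : (x', y') \in P by apply/crossingsP.
have np : (x', y') != (x, y) by rewrite xpair_eqE negb_and eq_sym nxx'.
have : #|P :\ (x, y) :\ (x', y')| = 1.
  by move: cP; rewrite (cardsD1 (x, y)) p1 (cardsD1 (x', y')) in_setD1 np p2 => -[].
move/eqP/cards1P => [[u v] EP].
have [d] : exists d, d \notin [set c x y; c u v] by apply: colour_avoid; rewrite ltnS card_set2_le.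
rewrite !inE negb_or => /andP[d1 d2].
apply: (@odd_matched (@adj G) c d) => // w wY.
have wT : w \notin T by apply: YT; rewrite inE in wY.
have [||||s ws cs] := @all_colours _ (@adj G) c w set0 d.
- by move=> s t; apply: pc.
- by move=> s; rewrite inE.
- by rewrite (crit_deg3 critG wT).
- by rewrite inE.
exists s; split=> //; apply: contraT => sY.
have : (w, s) \in P by apply/crossingsP.
have [[e1 e2] _|n1] := eqVneq (w, s) (x, y); first by rewrite -cs e1 e2 eqxx in d1.
have [[e1 e2] _|n2] := eqVneq (w, s) (x', y'); first by rewrite -cs e1 e2 -E eqxx in d1.
move=> wsP; have : (w, s) \in P :\ (x, y) :\ (x', y') by rewrite in_setD1 n2 in_setD1 n1.
by rewrite EP => /set1P[e1 e2]; rewrite -cs e1 e2 eqxx in d2.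
Qed.

(** Suppose the two remaining cut edges had the same colour. At [y] only one colour [al] is missing;
    a colour [d] different from both occurs at every vertex of [Y] and on no cut edge, so it would
    match the odd set [Y] within itself. *)
Lemma three_cross x y : x \in X -> y \notin X -> adj x y ->
  forall c : G -> G -> 'I_3, sym_col c -> proper_at (dele (@adj G) x y) setT c ->
  rainbow (dele (@adj G) x y) X c.
Proof.
move=> xX yX xy c sc pc u u' v v' uX u'X vX v'X /andP[uv nuv] /andP[u'v' nu'v'] E.
apply/eqP; apply: contraT => nuu'; exfalso; set b := dele (@adj G) x y in pc.
have sb : symmetric b by apply: dele_sym.
have ne p q : [set p; q] != [set x; y] -> (p, q) != (x, y).
  by apply: contra_neq => -[-> ->].
have EP : [set (x, y); (u, v); (u', v')] = crossings (@adj G) X.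
  apply/eqP; rewrite eqEcard -bdry_crossings hX; apply/andP; split.
    by rewrite !subUset !sub1set; apply/andP; split; [apply/andP; split|]; apply/crossingsP.
  rewrite -setUA cardsU1 cards2 !inE negb_or ![(x, y) == _]eq_sym !ne //.
  by rewrite xpair_eqE negb_and nuu'.
have by2 : rdeg b y = 2.
  have yx : adj y x by rewrite adj_sym.
  have := rdeg_dele_in yx; rewrite (crit_deg3 critG (YT yX)) => -[<-].
  by apply: eq_card => z; rewrite !inE /b /dele [[set x; y]]setUC.
have [al _ fal] : exists2 al, al \notin set0 & forall z, b y z -> c y z != al.
  by apply: free_colour; rewrite cards0 by2.
have [d] : exists d, d \notin [set c u v; al] by apply: colour_avoid; rewrite ltnS card_set2_le.
rewrite !inE negb_or => /andP[d1 d2].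
apply: (@odd_matched b c d) => //; first exact: dele_sub.
  by move=> p q r _; apply: pc.
move=> w wY; have wX : w \notin X by rewrite inE in wY.
have [s ws cs] : exists2 s, b w s & c w s = d.
  have [->|nwy] := eqVneq w y.
    apply: (@all_colours _ b c y [set al]); rewrite ?by2 ?cards1 ?inE //.
    - by move=> s t; apply: pc.
    - by move=> s ys; rewrite inE fal.
  apply: (@all_colours _ b c w set0); rewrite ?cards0 ?inE //.
  - by move=> s t; apply: pc.
  - by move=> s; rewrite inE.
  rewrite /b rdeg_dele_out ?(crit_deg3 critG (YT wX)) //.
  by apply: contraNneq wX => ->.
exists s; split=> //; rewrite inE; apply/negP => sX.
have sw : adj s w by rewrite adj_sym; apply: dele_sub ws.
have : (s, w) \in crossings (@adj G) X by apply/crossingsP.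
rewrite -EP !inE -orbA => /or3P[]/eqP[e1 e2].
- by move: ws; rewrite e1 e2 /b /dele setUC eqxx andbF.
- by move: d1; rewrite -cs sc e1 e2 eqxx.
by move: d1; rewrite -cs sc e1 e2 -E eqxx.
Qed.

Lemma three_contract : critical3 (contract_graph X) /\ 1 < #|deg2 (contract_graph X)|.
Proof.
have := three_thinX; have := three_thinY => thY thX.
split; last first.
  rewrite contract_deg2 // hX addn0.
  by have /setIidPr -> := TX.
apply: contract_critical; rewrite ?hX //; first exact: three_always.
exact: three_cross.
Qed.

Lemma three_triangle : #|Y| = 3 -> blowup_concl G.
Proof.
move=> cY; have [cK dK] := three_contract.
apply: (blowup_conclP three_thinX three_thinY) => // x y xX yX nxy.
apply: contraT => nadj; have xY : x \in Y by rewrite inE.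
have := rdeg_splitD1 sa ia xY; rewrite (crit_deg3 critG (YT xX)).
have := thin_cut1 three_thinY xY.
suff : cut (@adj G) [set x] (Y :\ x) <= 1 by clear; lia.
rewrite cut1; apply: (@leq_trans #|Y :\ x :\ y|).
  apply: subset_leq_card; apply/subsetP => z; rewrite !inE.
  by case/andP=> -> xz; rewrite andbT; apply: contraNneq nadj => <-.
have := cardsD1 x Y; have := cardsD1 y (Y :\ x); rewrite cY !inE xX yX eq_sym nxy.
by clear; lia.
Qed.

Lemma three_meredith : #|Y| != 3 ->
  class1 (induced Y) /\ is_meredith_extension 3 G (contract_graph X) (induced Y).
Proof.
move=> nY3; set K := contract_graph X; set H := induced Y.
have thX := three_thinX; have thY := three_thinY.
have [cK dK] := three_contract; have [_ mK _ _] := cK.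
have hY : h Y = 3 by rewrite bdryC.
have dH (u : H) : deg u + (u \in attach (@adj G) Y) = 3.
  rewrite /deg -/(rdeg (@adj H) u) [rdeg _ _]sub_rel_deg attach_cut.
  have uY : val u \in Y := valP u; have uX : val u \notin X by rewrite inE in uY.
  have := rdeg_split sa (val u) Y; rewrite (crit_deg3 critG (YT uX)).
  have := thin_cut1 thY uY.
  by case: (cut _ _ (~: Y)) => [|[]] // _ ->.
have cA : #|attach (@adj G) Y| = 3.
  by rewrite -(rdeg_opt_none (@sub_rel _ (@adj G) Y)) [rdeg _ _](contract_deg_none thY).
have cE : connectors 3 H = attach (@adj G) Y.
  apply/setP => u; rewrite inE; have := dH u.
  by case: (u \in attach _ _); [rewrite addn1 => -[->]|rewrite addn0 => ->].
have d3 (u : H) : deg u <= 3 by rewrite -(dH u) leq_addr.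
(* [Y] has odd order greater than 1 and different from 3, so at least five vertices, of which only
   three meet the cut. *)
have [u0 du0] : exists u0 : H, deg u0 = 3.
  have /subsetPn[u _ uA] : ~~ ([set: H] \subset attach (@adj G) Y).
    apply/negP => /subset_leq_card; rewrite cA cardsT card_sig => le3.
    have := odd_side; move: Y1 nY3 le3.
    by case: #|_| => [|[|[|[|]]]].
  by exists u; have := dH u; rewrite (negPf uA) addn0.
have mH : max_deg H = 3.
  apply/eqP; rewrite eqn_leq; apply/andP; split; first exact/bigmax_leqP.
  by rewrite -du0; apply: leq_bigmax.
split.
  rewrite /class1 mH; apply/eqP; rewrite eqn_leq -{2}mH max_deg_le_index andbT.
  apply/chromatic_index_le.
  have [||c sc pc] := @side_colour G critG Y; [by rewrite setCK|by rewrite hY|].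
  exists (fun u v : H => c (val u) (val v)) => [u v|]; first exact: sc.
  by move=> u v w _ uv uw /(pc _ _ _ (valP u) uv uw) /val_inj.
have /card_gt0P[x0 _] : 0 < #|X| by apply: ltnW.
pose m (u : H) : K := if [pick x | (x \in X) && adj (val u) x] is Some x then proj X x else None.
have nX (u : H) : val u \notin X by have := valP u; rewrite inE.
have mE (u : H) x : x \in X -> adj (val u) x -> m u = proj X x.
  move=> xX ux; rewrite /m; case: pickP => [z /andP[zX uz]|/(_ x)]; last by rewrite xX ux.
  by rewrite (thY (val u) z x) // ?inE ?negbK ?nX.
have outP (u : H) : u \in attach (@adj G) Y -> exists2 x, x \in X & adj (val u) x.
  by case/attachP => x; rewrite inE negbK; exists x.
split=> //; first by rewrite cE.
  by move=> u; rewrite cE => uA; have := dH u; rewrite (negPf uA) addn0.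
exists (None : K), m; split.
- by rewrite /deg -/(rdeg (@adj K) _) [rdeg _ _](contract_deg_none thX).
- move=> u v; rewrite cE => /outP[x xX ux] /outP[z zX vz].
  rewrite (mE u x) // (mE v z) // => /(proj_inj xX) E; subst z.
  by apply: val_inj; apply: (thX x) xX (nX u) (nX v) _ _; rewrite adj_sym.
- rewrite cE; apply/setP => w; rewrite [RHS]inE; apply/imsetP/idP => [[u /outP[x xX ux] ->]|].
    rewrite (mE u x) //; have [x' -> E] := proj_in xX.
    apply/attachP; exists (val u); first by have := valP u; rewrite inE.
    by rewrite E adj_sym.
  case: w => [w|] // /attachP[y yX wy].
  have yY : y \in Y by rewrite inE.
  have yw : adj y (val w) by rewrite adj_sym.
  exists (exist _ y yY).
    by apply/attachP; exists (val w) => //; rewrite inE negbK; apply: valP.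
  by rewrite (mE _ (val w)) ?proj_val //; apply: valP.
apply: (@iso_glue G H (del_vertex (None : K)) _ (fun u : {x | x \in Y} => val u) (emb x0)).
- exact: val_inj.
- exact: emb_inj.
- move=> u w; apply/eqP => E; have := valP u; rewrite E inE.
  by rewrite (emb_in x0 w).
- move=> z; have [/(emb_onto x0)[u ->]|zX] := boolP (z \in X); first by right; exists u.
  have zY : z \in Y by rewrite inE.
  by left; exists (exist _ z zY).
- by [].
- exact: emb_adj.
move=> u w; rewrite cE; apply/idP/andP => [uw|[/outP[x xX ux] /eqP]].
  split; first by apply/attachP; exists (emb x0 w); rewrite // inE negbK (emb_in x0).
  by rewrite (mE u _ _ uw) ?(emb_in x0) // proj_emb.
by rewrite (mE u x) // -(proj_emb x0) => /(proj_inj xX) <-.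
Qed.

End ThreeCut.

Theorem theorem1p1 (G : sgraph) (n : nat) (hn : #|G| = n)
    (hG : nontrivial_critical3 G) :
  (exists H : sgraph,
     [/\ nontrivial_critical3 H, #|H| + 2 = n & is_vertex_blowup G H])
  \/ (exists G1 G2 : sgraph,
        [/\ critical3 G1 /\ #|G1| < n, critical3 G2 /\ #|G2| < n,
            nontrivial_critical3 G1 \/ nontrivial_critical3 G2
          & is_hajos_join G G1 G2])
  \/ (exists G0 H : sgraph,
        [/\ nontrivial_critical3 G0, class1 H & is_meredith_extension 3 G G0 H])
  \/ (odd n /\
      exists (S : sgraph) (v : S) (F : {set {set del_vertex v}}),
        [/\ snark S, #|S| = n + 1, F \subset edges (del_vertex v)
          & iso G (del_edges F)])
  \/ (~~ odd n /\
      exists (S : sgraph) (F : {set {set S}}),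
        [/\ snark S, #|S| = n, F \subset edges S, F != set0
          & iso G (del_edges F)]).
Proof.
subst n; case: hG => critG /(nontrivial_deg2 critG) T2.
have [/existsP[X /and3P[X1 Y1 /eqP hX]]|/existsPn no2] :=
    boolP [exists X : {set G}, [&& 1 < #|X|, 1 < #|~: X| & bdry (@adj G) X == 2]].
  have tX : two_cut X by [].
  suff : blowup_concl G \/ hajos_concl G by case; [left|right; left].
  have [al|al] := two_cut_always critG tX; last exact: two_cut_concl al.
  by apply: (two_cut_concl critG T2 (two_cutC tX)); rewrite setCK.
have {}no2 (Z : {set G}) : ~ two_cut Z.
  by case=> Z1 W1 hZ; have := no2 Z; rewrite Z1 W1 hZ.
have [/existsP[X /and4P[X1 Y1 /eqP hX /eqP XT]]|/existsPn no3] :=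
    boolP [exists X : {set G}, [&& 1 < #|X|, 1 < #|~: X|, bdry (@adj G) X == 3
      & ~: X :&: deg2 G == set0]].
  have YT y : y \notin X -> y \notin deg2 G.
    move=> yX; apply/negP => yT; have : y \in ~: X :&: deg2 G by rewrite !inE yX; rewrite inE in yT.
    by rewrite XT inE.
  have [cK dK] := three_contract critG T2 no2 X1 Y1 hX YT.
  have [Y3|Y3] := eqVneq #|~: X| 3.
    by left; apply: (three_triangle critG T2 no2 X1 Y1 hX YT).
  have [c1 me] := three_meredith critG T2 no2 X1 Y1 hX YT Y3.
  right; right; left; exists (contract_graph X), (induced (~: X)); split=> //.
  exact: crit_nontrivial.
have I : split_inv (@adj G) (deg2 G).
  have ge2 (X : {set G}) : 1 < #|X| -> 1 < #|~: X| -> 1 < bdry (@adj G) X.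
    by move=> X1 Y1; apply: (crit_bdry_ge2 critG); rewrite -card_gt0 ltnW.
  split.
  - exact: adj_sym.
  - exact: adj_irr.
  - exact: crit_deg.
  - move=> X X1 Y1; rewrite ltn_neqAle ge2 // andbT eq_sym.
    by apply/eqP => h2; apply: (no2 X).
  - move=> X X1 Y1 hX; have := no3 (~: X); rewrite setCK X1 Y1 bdryC ?hX //=; last exact: adj_sym.
    by case/set0Pn => t /setIP[tX tT]; exists t.
  - exact: crit_nbr.
  exact: crit_indep.
have [od|ev] := boolP (odd #|G|).
  by right; right; right; left; split=> //; apply: completion_odd.
by right; right; right; right; split=> //; apply: completion_even.
Qed.
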